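(* Let $P$, $\mathbf{\Phi}$, $\boldsymbol{\pi}$, $\boldsymbol{g}$, the fixed state $j\in E$, and the augmented truncations ${}_{(n)}\widetilde P$ with chains ${}_{(n)}\mathbf{\Phi}$ be as in the context. Suppose that for every initial state $i\in E$ and for $n\ge\max\{i,j\}$ both of the following hold: (i) $\mathbb{P}_i\left(\omega\in\Omega: {}_{(n)}\tau_j(\omega)\uparrow\tau_j(\omega)\text{ as }n\to\infty\right)=1$; (ii) $\mathbb{P}_i\left(\omega\in\Omega: {}_{(n)}\zeta_j(|{}_{(n)}\boldsymbol{g}|)(\omega)\uparrow\zeta_j(|\boldsymbol{g}|)(\omega)\text{ as }n\to\infty\right)=1$. If $\mathbb{E}_\ell[\tau_\ell^2]<\infty$ and $\mathbb{E}_\ell\left[\zeta_\ell^2(|\overline{\boldsymbol{g}}|)\right]<\infty$ for some $\ell\in E$, then $$\lim_{n\to\infty}{}_{(n)}\sigma^2({}_{(n)}\boldsymbol{g})=\sigma^2(\boldsymbol{g}),$$ where $\sigma^2(\boldsymbol{g})$ and ${}_{(n)}\sigma^2({}_{(n)}\boldsymbol{g})$ are the central-limit-theorem variance constants of $\mathbf{\Phi}$ and ${}_{(n)}\mathbf{\Phi}$, respectively.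
   Context: $E=\mathbb{Z}_+=\{0,1,2,\dots\}$. $\mathbf{\Phi}=\{\Phi_k:k\in\mathbb{Z}_+\}$ is a time-homogeneous discrete-time Markov chain on $E$ with one-step transition matrix $P=(p_{ij})$, irreducible and positive recurrent, with unique invariant probability vector $\boldsymbol{\pi}$. $\boldsymbol{g}=(g(i))_{i\in E}$ is a finite-valued (real) column vector on $E$ with $\boldsymbol{\pi}^T|\boldsymbol{g}|<\infty$ ($|\cdot|$ entrywise), and $\overline{\boldsymbol{g}}=\boldsymbol{g}-(\boldsymbol{\pi}^T\boldsymbol{g})\boldsymbol{e}$, where $\boldsymbol{e}$ is the vector of ones. A state $j\in E$ is fixed. For $n\ge 0$: ${}_{(n)}E=\{0,1,\dots,n\}$; ${}_{(n)}P$ is the $(n+1)\times(n+1)$ northwest corner truncation of $P$; ${}_{(n)}\widetilde P$ is a stochastic matrix on ${}_{(n)}E$ with ${}_{(n)}\widetilde P\ge{}_{(n)}P$ entrywise, having a unique invariant probability vector ${}_{(n)}\boldsymbol{\pi}$; ${}_{(n)}\mathbf{\Phi}=\{{}_{(n)}\Phi_k\}$ is a Markov chain with transition matrix ${}_{(n)}\widetilde P$. All chains are defined on a common probability space $\Omega$; under $\mathbb{P}_i$ (expectation $\mathbb{E}_i$) they start from $i$. ${}_{(n)}\boldsymbol{g}$ consists of the first $n+1$ entries of $\boldsymbol{g}$, and ${}_{(n)}\overline{\boldsymbol{g}}={}_{(n)}\boldsymbol{g}-({}_{(n)}\boldsymbol{\pi}^T{}_{(n)}\boldsymbol{g})\,{}_{(n)}\boldsymbol{e}$,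 with ${}_{(n)}\boldsymbol{e}$ the $(n+1)$-vector of ones. For any state $\ell$: $\tau_\ell=\inf\{k\ge1:\Phi_k=\ell\}$ and ${}_{(n)}\tau_\ell=\inf\{k\ge1:{}_{(n)}\Phi_k=\ell\}$. For a function $\boldsymbol{h}$ on $E$ (resp. on ${}_{(n)}E$): $\zeta_\ell(\boldsymbol{h})=\sum_{k=0}^{\tau_\ell-1}h(\Phi_k)$ (resp. ${}_{(n)}\zeta_\ell(\boldsymbol{h})=\sum_{k=0}^{{}_{(n)}\tau_\ell-1}h({}_{(n)}\Phi_k)$); $\zeta_\ell^2(\boldsymbol h)$ denotes $(\zeta_\ell(\boldsymbol h))^2$. A central limit theorem (CLT) holds for $\mathbf{\Phi}$ if there is a constant $0\le\sigma^2(\boldsymbol{g})<\infty$ such that for any initial distribution $n^{-1/2}\sum_{k=1}^n\overline g(\Phi_k)$ converges in distribution to $N(0,\sigma^2(\boldsymbol{g}))$; $\sigma^2(\boldsymbol g)$ is the variance constant. It is known that a CLT holds if $\mathbb{E}_\ell[\zeta_\ell^2(|\overline{\boldsymbol{g}}|)]<\infty$ for some (equivalently all) $\ell\in E$, and then $$\sigma^2(\boldsymbol{g})=\frac{1}{\mathbb{E}_\ell[\tau_\ell]}\mathbb{E}_\ell\left[\zeta_\ell^2(\overline{\boldsymbol{g}})\right].$$ The variance constant ${}_{(n)}\sigma^2({}_{(n)}\boldsymbol{g})$ of ${}_{(n)}\mathbf{\Phi}$ is defined in the same way with ${}_{(n)}\overline{\boldsymbol g}$, and is given by $\frac{1}{\mathbb{E}_j[{}_{(n)}\tau_j]}\mathbb{E}_j\left[{}_{(n)}\zeta_j^2({}_{(n)}\overline{\boldsymbol{g}})\right]$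 for $n\ge j$. *)

(* Defs.v *)
From HB Require Import structures.
From mathcomp Require Import all_boot all_order all_algebra.
From mathcomp Require Import all_classical all_reals all_analysis.

Set Implicit Arguments.
Unset Strict Implicit.
Unset Printing Implicit Defensive.

Import Order.TTheory GRing.Theory Num.Theory.
Import numFieldNormedType.Exports.

Local Open Scope classical_set_scope.
Local Open Scope ring_scope.

Section nat_transition_matrices.
Context {R : realType}.
Implicit Types (P : nat -> nat -> R) (pi g : nat -> R).

Definition prob_vec pi : Prop :=
  (forall i, 0 <= pi i) /\ series pi @ \oo --> (1 : R).

Definition stochastic P : Prop := forall i, prob_vec (P i).

Fixpoint nstep P (k : nat) (i l : nat) : \bar R :=
  if k is k'.+1
  then (\sum_(0 <= m <oo) ((P i m)%:E * nstep P k' m l))%E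
  else ((i == l)%:R)%:E.

Definition irreducible P : Prop := forall i l, exists k, (0 < nstep P k i l)%E.

Definition invariant_prob P pi : Prop :=
  prob_vec pi /\
  forall l, series (fun i => pi i * P i l) @ \oo --> pi l.

Definition centered pi g : nat -> R :=
  fun i => g i - limn (series (fun l => pi l * g l)).

End nat_transition_matrices.

Section finite_transition_matrices.
Context {R : realType} {n : nat}.
Implicit Types (A : 'M[R]_n) (q v : 'rV[R]_n).

Definition prob_rV q : Prop :=
  (forall i, 0 <= q ord0 i) /\ \sum_i q ord0 i = 1.

Definition stochastic_mx A : Prop := forall i, prob_rV (row i A).

Definition invariant_prob_mx A q : Prop := prob_rV q /\ q *m A = q.

Definition unique_invariant_prob_mx A q : Prop :=
  invariant_prob_mx A q /\ forall q', invariant_prob_mx A q' -> q' = q.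

Definition centered_rV q v : 'rV[R]_n :=
  v - const_mx (\sum_i q ord0 i * v ord0 i).

End finite_transition_matrices.

Definition nw_truncation {R : realType} (P : nat -> nat -> R) (n : nat)
  : 'M[R]_n.+1 := \matrix_(i, k) P i k.

Definition trunc_vec {R : realType} (g : nat -> R) (n : nat) : 'rV[R]_n.+1 :=
  \row_i g i.

Section markov_chains.
Context {R : realType} {d : measure_display} {T : measurableType d}
  {E : countType}.
Implicit Types (p : E -> E -> R) (Q : probability T R) (X : nat -> T -> E).

(* The initial law is arbitrary. The Markov property is stated on cylinders,
   with the conditional probability multiplied out. *)
Definition markov_chain p Q X : Prop :=
  (forall k x, measurable [set w | X k w = x]) /\
  forall (k : nat) (x : nat -> E),
    Q [set w | forall m, (m <= k.+1)%N -> X m w = x m] =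
    (Q [set w | forall m, (m <= k)%N -> X m w = x m] *
     (p (x k) (x k.+1))%:E)%E.

Definition markov_chain_from p Q X (i : E) : Prop :=
  markov_chain p Q X /\ Q [set w | X 0%N w = i] = 1%E.

(* The infimum of the empty set is +oo. *)
Definition return_time X (l : E) (w : T) : \bar R :=
  ereal_inf [set (k%:R)%:E | k in [set k : nat | (1 <= k)%N /\ X k w = l]].

Definition cycle_sum X (l : E) (h : E -> R) (w : T) : \bar R :=
  (\sum_(0 <= k <oo | (k%:R)%:E < return_time X l w) (h (X k w))%:E)%E.

End markov_chains.

(* The library's [normal_prob m s] takes the standard deviation, and for s = 0
   it is a junk value (the uniform law) instead of the point mass at m. *)
Definition centered_normal {R : realType} (s2 : R)
  : probability (measurableTypeR R) R :=
  if s2 == 0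
  then (\d_(0 : measurableTypeR R) : probability (measurableTypeR R) R)
  else (normal_prob 0 (Num.sqrt s2) : probability (measurableTypeR R) R).

Definition cvg_in_law {R : realType} {d : measure_display}
    {T : measurableType d} (Q : probability T R) (Y : nat -> T -> R)
    (nu : probability (measurableTypeR R) R) : Prop :=
  forall f : R -> R, continuous f -> (exists M : R, forall x, `|f x| <= M) ->
    (\int[Q]_w (f (Y n w))%:E)%E @[n --> \oo] --> (\int[nu]_x (f x)%:E)%E.

(* s2 is the variance constant in the central limit theorem for the chain with
   transition matrix p and the (already centred) function h. The initial
   distribution is the law of X 0, on which there is no constraint. *)
Definition clt_variance {R : realType} {E : countType} (p : E -> E -> R)
    (h : E -> R) (s2 : R) : Prop :=
  0 <= s2 /\
  forall (d : measure_display) (T : measurableType d) (Q : probability T R)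
    (X : nat -> T -> E),
    markov_chain p Q X ->
    cvg_in_law Q
      (fun n w => (Num.sqrt (n%:R : R))^-1 * \sum_(1 <= k < n.+1) h (X k w))
      (centered_normal s2).

Definition increases_to {R : realType} (u : nat -> \bar R) (m : nat)
    (l : \bar R) : Prop :=
  (forall a b : nat, (m <= a)%N -> (a <= b)%N -> (u a <= u b)%E) /\
  u @ \oo --> l.

(* Main.v *)
Require Import Defs.
From HB Require Import structures.
From mathcomp Require Import all_boot all_order all_algebra.
From mathcomp Require Import all_classical all_reals all_analysis.
From mathcomp Require Import measurable_realfun.
From mathcomp Require Import ring lra zify.

Set Implicit Arguments.
Unset Strict Implicit.
Unset Printing Implicit Defensive.

Import Order.TTheory GRing.Theory Num.Theory.
Import numFieldNormedType.Exports.

Local Open Scope classical_set_scope.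
Local Open Scope ring_scope.

(** The two kinds of variance constants are known only as variances of the normal
    limits of scaled partial sums, so the proof first identifies them with
    moments of cycle sums and then passes to the limit in these moments.

    Identification. Let the sum of [1 + |h|] over a cycle at [j] be square
    integrable. By [clt_variance_cycle], a central limit theorem for [h] forces
    the sum of [h] over a cycle to have mean zero, and the limit variance to be
    its second moment divided by the mean cycle length. The reason is the
    martingale approximation of the partial sums, for the chain started from its
    stationary law (built in [stationary_law] from the occupation measure of a
    cycle). All moments of cycle sums are values of the Green function of the
    chain killed when it enters [j] ([integral_zeta], [integral_zeta_sqr]), and
    this Green function solves the Poisson equation. Cutting [h] at a level set
    of the Green function leaves a martingale with bounded increments, for which
    the second moments are explicit ([bounded_energy]) and the fourth moments
    are quadratic in time ([mean_mart4]); the remaining tail contributes little,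
    uniformly in time ([hat_mart_sqr_le], [tail_mass_cvg]). So the truncated
    second moments [min (x ^ 2) K] of the scaled sums, which converge by the
    central limit theorem, determine the variance ([limit_variance]). A nonzero
    mean over a cycle would make the same truncated moments grow like [K].

    Convergence. Expanding the square expresses a variance constant through
    finitely many first and second moments of cycle sums of functions [u] with
    [0 <= u <= 1 + |g|] ([variance_moments]), and each of them converges
    ([cycle_sum_mean_cvg], [cycle_sqr_cvg]). The signed cycle sums need not
    converge almost surely, so this is a squeeze. The augmented truncations
    dominate the truncations entrywise, so Fatou applied to the Green function
    formulas bounds each moment of the finite chains from below in the limit. For
    [1 + |g|] itself the monotonicity hypotheses give convergence by domination,
    and this moment is the moment for [u] plus a nonnegative Green function
    expression ([green_cross_split]), to which the lower bound applies as well.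

    The moment hypotheses at one state are carried to the state [j] by
    [zeta_sqr_change_base]: between two visits to [j] the number of visits to any
    other state has a bounded mean, whatever the starting point. *)

(** * Functions of discrete variables *)

Section discrete_functions.
Context {R : realType} {d : measure_display} {T : measurableType d}.
Local Open Scope ereal_scope.

(** Every set of values of [Y] is a countable union of measurable fibres, so
    a function that factors through [Y] needs no measurability of its own. *)
Lemma measurable_discrete (C : countType) (Y : T -> C) d' (S : sigmaRingType d')
    (F : T -> S) :
  (forall c, measurable [set w | Y w = c]) ->
  (forall w w', Y w = Y w' -> F w = F w') ->
  measurable_fun setT F.
Proof.
move=> mY FY _ A mA; rewrite setTI.
have -> : F @^-1` A =
    \bigcup_(c : C) (if `[< exists2 w, Y w = c & A (F w) >]
                     then [set w | Y w = c] else set0).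
  apply/seteqP; split=> [w AFw|w [c _]].
    by exists (Y w) => //; case: asboolP => // -[]; exists w.
  by case: asboolP => //= -[w' <- AFw'] /FY; rewrite /preimage /= => ->.
apply: countable_bigcupT_measurable => // c.
by case: asboolP.
Qed.

Lemma integral_discrete (mu : {measure set T -> \bar R}) (D : set T)
    (C : countType) (Y : T -> C) (g : C -> \bar R) :
  measurable D -> (forall c, measurable [set w | Y w = c]) ->
  (forall c, 0 <= g c) ->
  \int[mu]_(w in D) g (Y w) =
  \sum_(0 <= n <oo) (if pickle_inv n is Some c
                     then g c * mu (D `&` [set w | Y w = c]) else 0).
Proof.
move=> mD mY g0.
pose F n := D `&` [set w | pickle (Y w) = n].
have FE n : F n = if pickle_inv n is Some c then D `&` [set w | Y w = c]
                  else set0.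
  case E: pickle_inv => [c|].
    congr (D `&` _); apply/seteqP; split=> w /= => [Yw|->].
      by move: E; rewrite -Yw pickleK_inv => -[].
    by have := pickle_invK (T := C) n; rewrite E.
  apply/seteqP; split=> w // -[_ /= Yw].
  by move: E; rewrite -Yw pickleK_inv.
have mF n : measurable (F n).
  by rewrite FE; case: pickle_inv => [c|//]; exact: measurableI.
have DE : D = \bigcup_n F n.
  apply/seteqP; split=> [w Dw|w [n _ []//]]; by exists (pickle (Y w)).
rewrite {1}DE ge0_integral_bigcup //; first last.
- by apply/trivIsetP => m n _ _ mn; apply/seteqP; split=> w // [[_ em] [_ en]]; move: mn; rewrite -em -en eqxx.
- apply: (@measurable_funS _ _ _ _ setT) => //.
  by apply: (measurable_discrete mY) => w w' ->.
apply: eq_eseriesr => n _.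
rewrite FE; case: pickle_inv => [c|]; last by rewrite integral_set0.
rewrite -integral_cst //; last exact: measurableI.
by apply: eq_integral => w; rewrite inE => -[_ /= ->].
Qed.

End discrete_functions.

Section adapted_functions.
Context {R : realType} {d : measure_display} {T : measurableType d}
  {E : countType} (X : nat -> T -> E).
Local Open Scope ereal_scope.

(** Dependence on the path up to time [k], without a filtration: for a discrete
    state space this is measurability with respect to the past
    ([measurable_adapted]). *)
Definition adapted {S : Type} (k : nat) (F : T -> S) : Prop :=
  forall w w', (forall m, (m <= k)%N -> X m w = X m w') -> F w = F w'.

Definition history (k : nat) (w : T) : seq E := mkseq (X^~ w) k.+1.

Lemma history_inj k w w' :
  history k w = history k w' <-> forall m, (m <= k)%N -> X m w = X m w'.
Proof.
split=> [h m mk|h].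
  have := congr1 (fun s => nth (X 0 w) s m) h.
  by rewrite !nth_mkseq.
apply: (@eq_from_nth _ (X 0 w)); rewrite !size_mkseq // => m mk.
by rewrite !nth_mkseq // h.
Qed.

Lemma adaptedW {S : Type} k m (F : T -> S) :
  (k <= m)%N -> adapted k F -> adapted m F.
Proof. by move=> km aF w w' h; apply: aF => i ik; apply: h; exact: leq_trans km. Qed.

Lemma adapted_X {S : Type} k (f : E -> S) : adapted k (fun w => f (X k w)).
Proof. by move=> w w' ->. Qed.

Lemma adapted2 {S1 S2 S : Type} k (F : S1 -> S2 -> S) f g :
  adapted k f -> adapted k g -> adapted k (fun w => F (f w) (g w)).
Proof. by move=> af ag w w' h; rewrite (af _ _ h) (ag _ _ h). Qed.

Lemma adapted1 {S1 S : Type} k (F : S1 -> S) f :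
  adapted k f -> adapted k (fun w => F (f w)).
Proof. by move=> af w w' h; rewrite (af _ _ h). Qed.

Lemma adapted_sum k n (F : nat -> T -> R) :
  (forall i, (i < n)%N -> adapted k (F i)) ->
  adapted k (fun w => \sum_(i < n) F i w)%R.
Proof.
by move=> aF w w' h; apply: eq_bigr => i _; apply: aF.
Qed.

Hypothesis mX : forall k x, measurable [set w | X k w = x].

Lemma measurable_history k s : measurable [set w | history k w = s].
Proof.
have [[w0 h0]|h] := pselect (exists w0, history k w0 = s); last first.
  rewrite (_ : mkset _ = set0) //; apply/seteqP; split => w //= hw.
  by apply: h; exists w.
rewrite (_ : mkset _ = \bigcap_(m in `I_k.+1) [set w | X m w = X m w0]).
  by apply: bigcap_measurable => //; exists 0%N.
by rewrite -h0; apply/seteqP; split=> w; rewrite /= history_inj.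
Qed.

Lemma measurable_adapted d' (S : sigmaRingType d') k (F : T -> S) :
  adapted k F -> measurable_fun setT F.
Proof.
move=> aF; apply: (measurable_discrete (measurable_history k)) => w w'.
by rewrite history_inj => /aF.
Qed.

Lemma measurable_comp_X d' (S : sigmaRingType d') k (g : E -> S) (D : set T) :
  measurable_fun D (g \o X k).
Proof.
apply: (@measurable_funS _ _ _ _ setT) => //.
by apply: (measurable_adapted (k := k)); exact: adapted_X.
Qed.

End adapted_functions.

(** * The Markov property *)

Section markov_property.
Context {R : realType} {d : measure_display} {T : measurableType d}
  {E : countType} (p : E -> E -> R) (Pr : E -> probability T R)
  (X : nat -> T -> E).
Local Open Scope ereal_scope.

Definition step (f : E -> \bar R) (x : E) : \bar R := \int[Pr x]_w f (X 1 w).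

Hypothesis chain : forall x, markov_chain_from p (Pr x) X x.

Lemma prob1_ae (Q : probability T R) A : measurable A -> Q A = 1 ->
  {ae Q, forall w, A w}.
Proof.
move=> mA QA; exists (~` A); split; first exact: measurableC.
  by rewrite [LHS]probability_setC// QA subee.
by move=> w.
Qed.

Lemma prob1_setI (Q : probability T R) A B : measurable A -> measurable B ->
  Q A = 1 -> Q (A `&` B) = Q B.
Proof.
move=> mA mB QA.
rewrite -[in RHS](setUIDK B A) setIC measureU0 //; first exact: measurableI.
  exact: measurableD.
apply/eqP; rewrite -measure_le0 -(subee (x := 1)) // -[X in _ - X]QA.
rewrite -probability_setC //; apply: le_measure; rewrite ?inE //.
- exact: measurableD.
- exact: measurableC.
Qed.

Lemma step_prob x y : Pr x [set w | X 1 w = y] = (p x y)%:E.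
Proof.
have [[mX cX] X0] := chain x.
have mX0 : measurable [set w | X 0 w = x] by [].
have := cX 0%N (fun k => if k is 0%N then x else y).
have -> : [set w | forall m, (m <= 0)%N -> X m w = (fun k => if k is 0%N then x else y) m] =
    [set w | X 0 w = x].
  apply/seteqP; split=> w /= => [/(_ 0%N isT)//|Xw m].
  by rewrite leqn0 => /eqP ->.
rewrite X0 mul1e => <-.
rewrite -(@prob1_setI (Pr x) [set w | X 0 w = x])//.
congr (Pr x _); apply/seteqP; split=> w /=.
  by move=> [? ?] [|[|]].
by move=> h; split; [exact: (h 0%N)|exact: (h 1%N)].
Qed.

Lemma step_ge0 f x : (forall y, 0 <= f y) -> 0 <= step f x.
Proof. by move=> f0; apply: integral_ge0 => w _. Qed.

Lemma stepE f x : (forall y, 0 <= f y) ->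
  step f x = \sum_(0 <= n <oo)
    (if pickle_inv n is Some c then f c * (p x c)%:E else 0).
Proof.
move=> f0; have [[mX _] _] := chain x.
rewrite /step (integral_discrete (C := E) _ (Y := X 1)) //.
apply: eq_eseriesr => n _; case: pickle_inv => // c.
by rewrite setTI; congr (_ * _); exact: step_prob.
Qed.

(** The one-step Markov property for an arbitrary function [F] of the past. The
    chain is described by its cylinder probabilities, and [F] is constant on each
    of the countably many cylinders of length [k]. *)
Lemma markov_step (Q : probability T R) k (F : T -> \bar R) (f : E -> \bar R) :
  markov_chain p Q X ->
  adapted X k F -> (forall w, 0 <= F w) -> (forall y, 0 <= f y) ->
  \int[Q]_w (F w * f (X k.+1 w)) = \int[Q]_w (F w * step f (X k w)).
Proof.
move=> [mX cX] aF F0 f0.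
have mf m (g : E -> \bar R) (D : set T) : measurable_fun D (g \o X m).
  exact: measurable_comp_X.
have mF (D : set T) : measurable_fun D F.
  apply: (@measurable_funS _ _ _ _ setT) => //.
  exact: (measurable_adapted mX aF).
pose D n := [set w | pickle (history X k w) = n].
have DE n w : D n w -> D n = [set w' | history X k w' = history X k w].
  move=> <-; apply/seteqP; split=> w' /=.
    by move/(pcan_inj pickleK).
  by rewrite /D/= => ->.
have mD n : measurable (D n).
  have [[w /DE ->]|nD] := pselect (exists w, D n w); first exact: measurable_history.
  by rewrite (_ : D n = set0) //; apply/seteqP; split=> // w Dw; apply: nD; exists w.
have -> : [set: T] = \bigcup_n D n.
  by apply/seteqP; split=> // w _; exists (pickle (history X k w)).
rewrite !ge0_integral_bigcup //; first last.
- by apply/trivIsetP => m n _ _ mn; apply/seteqP; split=> w // [em en]; move: mn; rewrite -em -en eqxx.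
- by move=> w _; rewrite mule_ge0.
- by apply: emeasurable_funM => //; exact: mf.
- by apply/trivIsetP => m n _ _ mn; apply/seteqP; split=> w // [em en]; move: mn; rewrite -em -en eqxx.
- by move=> w _; rewrite mule_ge0 // step_ge0.
- by apply: emeasurable_funM => //; exact: (mf _ (step f)).
apply: eq_eseriesr => n _.
have [[w0 Dw0]|nD] := pselect (exists w, D n w); last first.
  rewrite (_ : D n = set0) ?integral_set0 //.
  by apply/seteqP; split=> // w Dw; apply: nD; exists w.
have hD w : D n w -> forall m, (m <= k)%N -> X m w = X m w0.
  by rewrite (DE _ _ Dw0) /= history_inj.
transitivity (F w0 * \int[Q]_(w in D n) f (X k.+1 w)).
  rewrite -ge0_integralZl //; last exact: (mf _ f).
  apply: eq_integral => w; rewrite inE => /hD Dw.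
  by rewrite (aF _ _ Dw).
transitivity (F w0 * (step f (X k w0) * Q (D n))); last first.
  transitivity (\int[Q]_(w in D n) cst (F w0 * step f (X k w0)) w).
    by rewrite integral_cst // muleA.
  by apply: eq_integral => w; rewrite inE => /hD Dw; rewrite (aF _ _ Dw) Dw.
congr (F w0 * _).
rewrite (integral_discrete (C := E) _ (Y := X k.+1)) // stepE //.
rewrite -(@fineK _ (Q (D n))) ?fin_num_measure // muleC -nneseriesZl; last first.
  move=> m _; case: pickle_inv => // c; rewrite mule_ge0 //.
  by rewrite -step_prob.
apply: eq_eseriesr => m _; case: pickle_inv => [c|]; last by rewrite mule0.
rewrite muleCA fineK ?fin_num_measure //; congr (_ * _).
have := cX k (fun i => if (i <= k)%N then X i w0 else c).
rewrite leqnn ltnn.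
set A := [set w | _]; set B := [set w | _].
have -> : B = D n.
  rewrite (DE _ _ Dw0); apply/seteqP; split=> w /=; rewrite history_inj.
    by move=> h m' m'k; rewrite h // m'k.
  by move=> h m' m'k; rewrite m'k h.
move=> <-; congr (Q _).
rewrite (DE _ _ Dw0); apply/seteqP; split=> w /=.
  move=> -[/history_inj h1 h2] m' mk; case: ifPn => [|km]; first exact: h1.
  by rewrite -ltnNge in km; have -> : m' = k.+1 by apply/eqP; rewrite eqn_leq mk.
move=> h; split.
  by rewrite history_inj => m' m'k; have := h m' (leqW m'k); rewrite m'k.
by have := h _ (leqnn _); rewrite ltnn.
Qed.

End markov_property.

(** * Series of nonnegative terms *)

Section nneseries_complements.
Context {R : realType}.
Local Open Scope ereal_scope.
Implicit Types f a : nat -> \bar R.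

Lemma nneseries_shift n f : (forall k, 0 <= f k) ->
  \sum_(0 <= k <oo) f k = \sum_(0 <= k < n) f k + \sum_(0 <= k <oo) f (k + n)%N.
Proof.
move=> f0; rewrite (nneseries_split 0 n) // add0n; congr (_ + _).
by rewrite nneseries_addn.
Qed.

Lemma nneseriesS f : (forall k, 0 <= f k) ->
  \sum_(0 <= k <oo) f k = f 0%N + \sum_(0 <= k <oo) f k.+1.
Proof.
move=> f0; rewrite (nneseries_shift 1) // big_nat1; congr (_ + _).
by apply: eq_eseriesr => k _; rewrite addn1.
Qed.

Lemma nneseries_le f (M : \bar R) : (forall k, 0 <= f k) ->
  (forall n, \sum_(0 <= k < n) f k <= M) -> \sum_(0 <= k <oo) f k <= M.
Proof.
move=> f0 fM; apply: lime_le; first exact: is_cvg_nneseries.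
exact: nearW.
Qed.

Lemma nneseries_ge_term n f : (forall k, 0 <= f k) ->
  f n <= \sum_(0 <= k <oo) f k.
Proof.
move=> f0; apply: le_trans (nneseries_lim_ge n.+1 _) => //.
by rewrite big_nat_recr //= leeDr // sume_ge0.
Qed.

Lemma nneseriesZ (c : \bar R) f : 0 <= c -> (forall k, 0 <= f k) ->
  \sum_(0 <= k <oo) (c * f k) = c * \sum_(0 <= k <oo) f k.
Proof.
case: c => [c| |] // c0 f0; first by rewrite nneseriesZl.
have [[k fk]|nf] := pselect (exists k, 0 < f k).
  have S0 : 0 < \sum_(0 <= k <oo) f k.
    by apply: lt_le_trans fk _; exact: nneseries_ge_term.
  rewrite [RHS]gt0_mulye //; apply/eqP; rewrite -leye_eq.
  apply: le_trans (nneseries_ge_term k _) => [|i] /=.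
    by rewrite gt0_mulye.
  by rewrite mule_ge0.
have fE k : f k = 0.
  by apply/eqP; rewrite eq_le f0 andbT leNgt; apply/negP => fk; apply: nf; exists k.
rewrite [X in _ * X]eseries0; last by move=> k _ _; exact: fE.
by rewrite mule0 eseries0 // => k _ _; rewrite fE mule0.
Qed.

(** The double series of the products is split along its diagonal; the part
    above the diagonal is the part below it, with the summations exchanged. *)
Lemma nneseries_sqr (a : nat -> R) : (forall k, 0 <= a k)%R ->
  (\sum_(0 <= k <oo) (a k)%:E) ^+ 2 =
  \sum_(0 <= k <oo)
    ((a k * a k)%:E + 2%:E * \sum_(0 <= m <oo) (a k * a (k + m.+1)%N)%:E).
Proof.
move=> a0.
pose S := \sum_(0 <= k <oo) (a k)%:E.
have aa0 i k : 0 <= (a i * a k)%:E by rewrite lee_fin mulr_ge0.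
have aS0 k : 0 <= \sum_(0 <= m <oo) (a k * a (k + m.+1)%N)%:E.
  exact: nneseries_ge0.
have S0 : 0 <= S by apply: nneseries_ge0 => *; rewrite lee_fin.
pose L k := \sum_(0 <= i <oo) (if (i < k)%N then (a k * a i)%:E else 0).
have L0 k i : 0 <= (if (i < k)%N then (a k * a i)%:E else 0).
  by case: ifP => // _.
have rowE k : (a k)%:E * S = (a k * a k)%:E +
    \sum_(0 <= m <oo) (a k * a (k + m.+1)%N)%:E + L k.
  rewrite /S -nneseriesZl; last by move=> i _; rewrite lee_fin.
  rewrite [LHS](nneseries_shift k.+1); last by move=> i; exact: aa0.
  rewrite [L k](nneseries_shift k.+1) //.
  rewrite [X in _ = _ + (_ + X)]eseries0; last first.
    by move=> i _ _; rewrite addnS ltnNge leqW ?leq_addl.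
  rewrite adde0 !big_nat_recr //= ltnn adde0 -EFinM.
  rewrite [RHS]addeC addeA; congr (_ + _ + _).
    by apply: eq_big_nat => i /andP[_ ->].
  by apply: eq_eseriesr => i _; rewrite -EFinM -addSnnS addnC.
rewrite expe2 -/S.
transitivity (\sum_(0 <= k <oo) ((a k)%:E * S)).
  have [Sy|Sy] := eqVneq S +oo; last first.
    have Sfin : S \is a fin_num by rewrite fin_numE Sy andbT gt_eqF // (lt_le_trans _ S0).
    rewrite -[in LHS](fineK Sfin) -[X in _ * X = _]/(fine S)%:E.
    rewrite [X in _ * X](fineK Sfin) {2}/S -nneseriesZl; last first.
      by move=> i _; rewrite lee_fin.
    by apply: eq_eseriesr => i _; rewrite fineK // muleC.
  rewrite Sy mulyy.
  have [k ak] : exists k, (0 < a k)%R.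
    apply: contrapT => nk; move: Sy; rewrite /S eseries0 // => i _ _.
    congr (_%:E); apply/eqP; rewrite eq_le a0 andbT leNgt.
    by apply/negP => ai; apply: nk; exists i.
  apply/eqP; rewrite eq_sym -leye_eq.
  apply: le_trans (nneseries_ge_term k _) => /=.
    by rewrite gt0_muley // lte_fin.
  by move=> i; rewrite mule_ge0 // lee_fin.
under eq_eseriesr do rewrite rowE.
rewrite nneseriesD; last 2 first.
- by move=> k _ _; rewrite adde_ge0.
- by move=> k _ _; exact: nneseries_ge0.
have -> : \sum_(0 <= k <oo) L k =
    \sum_(0 <= k <oo) \sum_(0 <= m <oo) (a k * a (k + m.+1)%N)%:E.
  rewrite /L nneseries_interchange //; apply: eq_eseriesr => i _.
  rewrite (nneseries_shift i.+1) // big_nat_cond big1 ?add0e; last first.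
    by move=> k; rewrite andbT ltnS => /= /leq_gtF ->.
  by apply: eq_eseriesr => k _; rewrite ltn_addl // mulrC -addSnnS addnC.
rewrite -nneseriesD; last 2 first.
- by move=> k _ _; rewrite adde_ge0.
- by move=> k _ _; exact: nneseries_ge0.
apply: eq_eseriesr => k _.
by rewrite -addeA -mule2n mule_natl.
Qed.

End nneseries_complements.

(** * The Green function of the chain killed at a state *)

Section taboo_operator.
Context {R : realType} {d : measure_display} {T : measurableType d}
  {E : countType} (p : E -> E -> R) (Pr : E -> probability T R)
  (X : nat -> T -> E).
Local Open Scope ereal_scope.
Implicit Types (u f g : E -> \bar R) (l x y : E) (k m n : nat).

Definition mask l f y : \bar R := if y == l then 0 else f y.

(** The transition operator of the chain killed when it enters [l]. *)
Definition taboo l f : E -> \bar R := step Pr X (mask l f).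

(** The mean of the sum of [u] along a path from [x], over the times that precede
    the first return to [l] at a positive time; see [integral_zeta]. Extended
    values make it total. *)
Definition green l u x : \bar R :=
  \sum_(0 <= k <oo) iter k (taboo l) u x.

Hypothesis chain : forall x, markov_chain_from p (Pr x) X x.

Lemma mask_ge0 l f y : (forall z, 0 <= f z) -> 0 <= mask l f y.
Proof. by rewrite /mask; case: eqP. Qed.

Lemma measurable_step x f (D : set T) : measurable_fun D (fun w => f (X 1 w)).
Proof. by have [[mX _] _] := chain x; exact: (measurable_comp_X mX). Qed.

Lemma le_step f g x : (forall y, 0 <= f y) -> (forall y, f y <= g y) ->
  step Pr X f x <= step Pr X g x.
Proof.
move=> f0 fg; apply: ge0_le_integral => //; exact: (measurable_step x).
Qed.

Lemma stepD f g x : (forall y, 0 <= f y) -> (forall y, 0 <= g y) ->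
  step Pr X (fun y => f y + g y) x = step Pr X f x + step Pr X g x.
Proof.
move=> f0 g0; apply: ge0_integralD => //; exact: (measurable_step x).
Qed.

Lemma stepZ (c : \bar R) f x : (forall y, 0 <= f y) -> 0 <= c ->
  step Pr X (fun y => c * f y) x = c * step Pr X f x.
Proof.
move=> f0 c0; apply: ge0_integralZl => //; exact: (measurable_step x).
Qed.

Lemma step_cst (c : \bar R) x : step Pr X (cst c) x = c.
Proof. 
rewrite /step (integral_cst (Pr x) measurableT).
by rewrite [X in _ * X]probability_setT mule1. Qed.

Lemma step_series (f : nat -> E -> \bar R) x : (forall n y, 0 <= f n y) ->
  step Pr X (fun y => \sum_(0 <= n <oo) f n y) x =
  \sum_(0 <= n <oo) step Pr X (f n) x.
Proof.
move=> f0; apply: integral_nneseries => // n; exact: (measurable_step x).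
Qed.

Lemma step_atom f x y : (forall z, 0 <= f z) ->
  (p x y)%:E * f y <= step Pr X f x.
Proof.
move=> f0; rewrite -(step_prob chain).
have [[mX _] _] := chain x.
have -> : Pr x [set w | X 1 w = y] * f y =
    \int[Pr x]_(w in [set w | X 1 w = y]) f (X 1 w).
  rewrite muleC -integral_cst //; apply: eq_integral => w.
  by rewrite inE => /= ->.
apply: ge0_subset_integral => //; exact: (measurable_step x).
Qed.

Lemma taboo_ge0 l f x : (forall y, 0 <= f y) -> 0 <= taboo l f x.
Proof. by move=> f0; apply: step_ge0 => y; exact: mask_ge0. Qed.

Lemma iter_taboo_ge0 l u k x : (forall y, 0 <= u y) -> 0 <= iter k (taboo l) u x.
Proof. by move=> u0; elim: k x => //= k IH x; exact: taboo_ge0. Qed.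

Lemma eq_taboo l f g x : f =1 g -> taboo l f x = taboo l g x.
Proof. by move=> /funext ->. Qed.

Lemma le_taboo l f g x : (forall y, 0 <= f y) -> (forall y, f y <= g y) ->
  taboo l f x <= taboo l g x.
Proof.
move=> f0 fg; apply: le_step => y; first exact: mask_ge0.
by rewrite /mask; case: eqP.
Qed.

Lemma tabooD l f g x : (forall y, 0 <= f y) -> (forall y, 0 <= g y) ->
  taboo l (fun y => f y + g y) x = taboo l f x + taboo l g x.
Proof.
move=> f0 g0; rewrite /taboo -stepD; try by move=> y; exact: mask_ge0.
by congr step; apply/funext => y; rewrite /mask; case: eqP; rewrite ?adde0.
Qed.

Lemma tabooZ l (c : \bar R) f x : (forall y, 0 <= f y) -> 0 <= c ->
  taboo l (fun y => c * f y) x = c * taboo l f x.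
Proof.
move=> f0 c0; rewrite /taboo -stepZ //; last by move=> y; exact: mask_ge0.
by congr step; apply/funext => y; rewrite /mask; case: eqP; rewrite ?mule0.
Qed.

Lemma taboo_series l (f : nat -> E -> \bar R) x : (forall n y, 0 <= f n y) ->
  taboo l (fun y => \sum_(0 <= n <oo) f n y) x =
  \sum_(0 <= n <oo) taboo l (f n) x.
Proof.
move=> f0; rewrite /taboo -step_series; last by move=> n y; exact: mask_ge0.
congr step; apply/funext => y; rewrite /mask; case: eqP => // _.
by rewrite eseries0.
Qed.

Lemma taboo_le_cst l f x (C : \bar R) : 0 <= C ->
  (forall y, 0 <= f y) -> (forall y, f y <= C) -> taboo l f x <= C.
Proof.
move=> C0 f0 fC; rewrite -[leRHS](step_cst C x); apply: le_step => y.
  exact: mask_ge0.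
by rewrite /mask; case: eqP.
Qed.

Lemma iter_tabooD l f g k x : (forall y, 0 <= f y) -> (forall y, 0 <= g y) ->
  iter k (taboo l) (fun y => f y + g y) x =
  iter k (taboo l) f x + iter k (taboo l) g x.
Proof.
move=> f0 g0; elim: k x => //= k IH x; rewrite (eq_taboo _ _ IH) tabooD // => y;
exact: iter_taboo_ge0.
Qed.

Lemma iter_tabooZ l (c : \bar R) f k x : (forall y, 0 <= f y) -> 0 <= c ->
  iter k (taboo l) (fun y => c * f y) x = c * iter k (taboo l) f x.
Proof.
move=> f0 c0; elim: k x => //= k IH x; rewrite (eq_taboo _ _ IH) tabooZ // => y;
exact: iter_taboo_ge0.
Qed.

Lemma iter_taboo_series l (f : nat -> E -> \bar R) k x : (forall n y, 0 <= f n y) ->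
  iter k (taboo l) (fun y => \sum_(0 <= n <oo) f n y) x =
  \sum_(0 <= n <oo) iter k (taboo l) (f n) x.
Proof.
move=> f0; elim: k x => //= k IH x; rewrite (eq_taboo _ _ IH) taboo_series // => n y.
exact: iter_taboo_ge0.
Qed.

Lemma le_iter_taboo l f g k x : (forall y, 0 <= f y) -> (forall y, f y <= g y) ->
  iter k (taboo l) f x <= iter k (taboo l) g x.
Proof.
move=> f0 fg; elim: k x => //= k IH x; apply: le_taboo => // y.
exact: iter_taboo_ge0.
Qed.

Lemma green_ge0 l u x : (forall y, 0 <= u y) -> 0 <= green l u x.
Proof. by move=> u0; apply: nneseries_ge0 => k _ _; exact: iter_taboo_ge0. Qed.

(** The Poisson equation: the sum over a cycle is its first term followed by the
    sum from time one on. *)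
Lemma greenE l u x : (forall y, 0 <= u y) ->
  green l u x = u x + taboo l (green l u) x.
Proof.
move=> u0; rewrite /green nneseriesS; last by move=> k; exact: iter_taboo_ge0.
by rewrite taboo_series // => k y; exact: iter_taboo_ge0.
Qed.

Lemma le_green_ge l u x : (forall y, 0 <= u y) -> u x <= green l u x.
Proof.
by move=> u0; rewrite greenE // leeDl // taboo_ge0 // => y; exact: green_ge0.
Qed.

Lemma taboo_green_le l u x : (forall y, 0 <= u y) ->
  taboo l (green l u) x <= green l u x.
Proof. by move=> u0; rewrite [leRHS]greenE // leeDr. Qed.

Lemma le_green l f g x : (forall y, 0 <= f y) -> (forall y, f y <= g y) ->
  green l f x <= green l g x.
Proof.
move=> f0 fg; apply: lee_nneseries => [k _ _|k _]; first exact: iter_taboo_ge0.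
exact: le_iter_taboo.
Qed.

Lemma greenD l f g x : (forall y, 0 <= f y) -> (forall y, 0 <= g y) ->
  green l (fun y => f y + g y) x = green l f x + green l g x.
Proof.
move=> f0 g0; rewrite /green -nneseriesD; try by move=> k _ _; exact: iter_taboo_ge0.
by apply: eq_eseriesr => k _; rewrite iter_tabooD.
Qed.

Lemma greenZ l (c : \bar R) f x : (forall y, 0 <= f y) -> 0 <= c ->
  green l (fun y => c * f y) x = c * green l f x.
Proof.
move=> f0 c0; rewrite /green -nneseriesZ //; last by move=> k; exact: iter_taboo_ge0.
by apply: eq_eseriesr => k _; rewrite iter_tabooZ.
Qed.

Lemma green_series l (f : nat -> E -> \bar R) x : (forall n y, 0 <= f n y) ->
  green l (fun y => \sum_(0 <= n <oo) f n y) x =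
  \sum_(0 <= n <oo) green l (f n) x.
Proof.
move=> f0; rewrite /green nneseries_interchange; last first.
  by move=> i k; exact: iter_taboo_ge0.
by apply: eq_eseriesr => k _; rewrite iter_taboo_series.
Qed.

Definition green_part l u n x : \bar R :=
  \sum_(0 <= k < n) iter k (taboo l) u x.

Lemma green_part_ge0 l u n x : (forall y, 0 <= u y) -> 0 <= green_part l u n x.
Proof. by move=> u0; apply: sume_ge0 => k _; exact: iter_taboo_ge0. Qed.

Lemma green_partS l u n x : (forall y, 0 <= u y) ->
  green_part l u n.+1 x = u x + taboo l (green_part l u n) x.
Proof.
move=> u0; rewrite /green_part big_nat_recl //=; congr (_ + _).
elim: n x => [|n IH] x.
  rewrite big_nil; apply/esym; rewrite /taboo /step.
  rewrite (eq_integral (cst 0)) ?integral0 // => w _.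
  by rewrite /mask; case: eqP => // _; rewrite big_nil.
rewrite big_nat_recr //= IH.
rewrite -tabooD.
- by apply: eq_taboo => y; rewrite big_nat_recr.
- by move=> y; apply: sume_ge0 => k _; exact: iter_taboo_ge0.
- by move=> y; exact: iter_taboo_ge0.
Qed.

Lemma green_le l u (U : E -> \bar R) x : (forall y, 0 <= u y) ->
  (forall y, green_part l u 0 y <= U y) ->
  (forall y, u y + taboo l U y <= U y) -> green l u x <= U x.
Proof.
move=> u0 U0 uU; apply: nneseries_le; first by move=> k; exact: iter_taboo_ge0.
move=> n; rewrite -/(green_part l u n x); elim: n x => [|n IH] x; first exact: U0.
rewrite green_partS //; apply: le_trans (uU x); rewrite leeD2l //.
by apply: le_taboo => // y; exact: green_part_ge0.
Qed.

(** The Green function is the least nonnegative supersolution of the Poisson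
    equation; every upper bound on it is obtained in this way. *)
Lemma green_min l u (U : E -> \bar R) x : (forall y, 0 <= u y) ->
  (forall y, 0 <= U y) ->
  (forall y, u y + taboo l U y <= U y) -> green l u x <= U x.
Proof.
by move=> u0 U0 uU; apply: green_le => // y; rewrite /green_part big_nil.
Qed.

(** Maximum principle: before its first visit to the support of [u] the chain
    collects nothing, and what it collects from there on has mean at most [C]. *)
Lemma green_max l u (A : set E) (C : \bar R) x : (forall y, 0 <= u y) ->
  0 <= C ->
  (forall y, ~ A y -> u y = 0) -> (forall y, A y -> green l u y <= C) ->
  green l u x <= C.
Proof.
move=> u0 C0 uA gC; apply: nneseries_le; first by move=> k; exact: iter_taboo_ge0.
move=> n; rewrite -/(green_part l u n x); elim: n x => [|n IH] x.
  by rewrite /green_part big_nil.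
have [Ax|nAx] := pselect (A x).
  apply: le_trans (gC x Ax); apply: nneseries_lim_ge => k _ _.
  exact: iter_taboo_ge0.
rewrite green_partS // uA // add0e; apply: taboo_le_cst => // y.
exact: green_part_ge0.
Qed.

End taboo_operator.

(** * Moments of cycle sums *)

Section cycle_functionals.
Context {R : realType} {d : measure_display} {T : measurableType d}
  {E : countType} (p : E -> E -> R) (Pr : E -> probability T R)
  (X : nat -> T -> E).
Local Open Scope ereal_scope.

(** No visit to [l] at the times [m + 1, ..., m + k]; time [m] itself is left out
    because a cycle may start at [l]. *)
Definition avoids (l : E) (m k : nat) (w : T) : bool :=
  all (fun i => X i w != l) (iota m.+1 k).

Definition cycle_term (l : E) (u : E -> R) (k : nat) (w : T) : R :=
  if avoids l 0 k w then u (X k w) else 0%R.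

(** The sum of [u] over the times that precede the first return to [l]. As a series
    with vanishing terms after the return it makes sense on every path, including
    those that never return. *)
Definition zeta (l : E) (u : E -> R) (w : T) : \bar R :=
  \sum_(0 <= k <oo) (cycle_term l u k w)%:E.

Lemma avoidsS l m k w :
  avoids l m k.+1 w = avoids l m k w && (X (m + k.+1) w != l).
Proof. by rewrite /avoids -[k.+1]addn1 iotaD all_cat /= andbT addn1 addSn addnS. Qed.

Lemma avoidsD l m k i w :
  avoids l m (k + i) w = avoids l m k w && avoids l (m + k) i w.
Proof. by rewrite /avoids iotaD all_cat addSn. Qed.

Lemma adapted_avoids l m k : adapted X (m + k) (avoids l m k).
Proof.
move=> w w' h; apply: eq_in_all => i; rewrite mem_iota => /andP[_ im].
by rewrite h //; lia.
Qed.

Lemma adapted_cycle_term l u k : adapted X k (cycle_term l u k).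
Proof.
by move=> w w' h; rewrite /cycle_term (@adapted_avoids l 0 k _ _ h) h.
Qed.

Lemma cycle_term_ge0 l u k w : (forall y, 0 <= u y)%R -> (0 <= cycle_term l u k w)%R.
Proof. by move=> u0; rewrite /cycle_term; case: ifP. Qed.

Lemma zeta_ge0 l u w : (forall y, 0 <= u y)%R -> 0 <= zeta l u w.
Proof. by move=> u0; apply: nneseries_ge0 => k _ _; rewrite lee_fin cycle_term_ge0. Qed.

Lemma le_zeta l u v w : (forall y, 0 <= u y)%R -> (forall y, u y <= v y)%R ->
  zeta l u w <= zeta l v w.
Proof.
move=> u0 uv; apply: lee_nneseries => k; rewrite ?lee_fin ?cycle_term_ge0 // => _.
by rewrite /cycle_term; case: ifP.
Qed.

Lemma zetaD l u v w : (forall y, 0 <= u y)%R -> (forall y, 0 <= v y)%R ->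
  zeta l (fun y => u y + v y)%R w = zeta l u w + zeta l v w.
Proof.
move=> u0 v0; rewrite /zeta -nneseriesD; try by move=> *; rewrite lee_fin cycle_term_ge0.
by apply: eq_eseriesr => k _; rewrite -EFinD /cycle_term; case: ifP; rewrite ?addr0.
Qed.

Lemma zetaZ l (c : R) u w : (0 <= c)%R -> (forall y, 0 <= u y)%R ->
  zeta l (fun y => c * u y)%R w = c%:E * zeta l u w.
Proof.
move=> c0 u0; rewrite /zeta -nneseriesZl; last by move=> *; rewrite lee_fin cycle_term_ge0.
by apply: eq_eseriesr => k _; rewrite -EFinM /cycle_term; case: ifP; rewrite ?mulr0.
Qed.

Hypothesis chain : forall x, markov_chain_from p (Pr x) X x.
Hypothesis mX : forall k x, measurable [set w | X k w = x].

Lemma measurable_cycle_term l u k : measurable_fun setT (cycle_term l u k).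
Proof. exact: (measurable_adapted mX (@adapted_cycle_term l u k)). Qed.

Lemma measurable_zeta l u (D : set T) : (forall y, 0 <= u y)%R ->
  measurable_fun D (zeta l u).
Proof.
move=> u0; apply: (@measurable_funS _ _ _ _ setT) => //.
apply: ge0_emeasurable_sum => [k w _ _|k _].
  by rewrite lee_fin cycle_term_ge0.
by apply/measurable_EFinP; exact: measurable_cycle_term.
Qed.

(** The Markov property at each of the times [m + k, ..., m + 1], backwards. *)
Lemma integral_taboo_iter (Q : probability T R) l m k (F : T -> \bar R) u :
  markov_chain p Q X -> adapted X m F -> (forall w, 0 <= F w) ->
  (forall y, 0 <= u y) ->
  \int[Q]_w (F w * (if avoids l m k w then u (X (m + k) w) else 0)) =
  \int[Q]_w (F w * iter k (taboo Pr X l) u (X m w)).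
Proof.
move=> chQ aF F0; elim: k u => [|k IH] u u0; first by rewrite /= addn0.
rewrite iterSr -IH; last by move=> y; exact: taboo_ge0.
transitivity (\int[Q]_w (F w * (if avoids l m k w then 1 else 0) *
    mask l u (X (m + k).+1 w))).
  apply: eq_integral => w _; rewrite avoidsS addnS /mask.
  by case: avoids; rewrite ?mule0 ?mul0e //= ?mule1; case: eqP; rewrite ?mule0.
rewrite (markov_step chain) //.
- apply: eq_integral => w _; rewrite -muleA; congr (_ * _).
  by case: ifP; rewrite ?mul1e ?mul0e.
- apply: adapted2; first by apply: adaptedW aF; exact: leq_addr.
  by apply: (adapted1 (fun b : bool => if b then 1 else 0)); exact: adapted_avoids.
- by move=> w; rewrite mule_ge0 //; case: ifP.
- by move=> y; exact: mask_ge0.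
Qed.

Lemma integral_start x (f : E -> \bar R) : (forall y, 0 <= f y) ->
  \int[Pr x]_w f (X 0 w) = f x.
Proof.
move=> f0; have [_ X0] := chain x.
transitivity (\int[Pr x]_w cst (f x) w).
  apply: ge0_ae_eq_integral => //; first exact: (measurable_comp_X mX).
    by move=> w _ /=.
  have := prob1_ae (mX 0 x) X0.
  by apply: filterS => w /= -> _.
rewrite (integral_cst (Pr x) measurableT).
by rewrite [X in _ * X]probability_setT mule1.
Qed.

Lemma integral_alive x l k (u : E -> \bar R) : (forall y, 0 <= u y) ->
  \int[Pr x]_w (if avoids l 0 k w then u (X k w) else 0) =
  iter k (taboo Pr X l) u x.
Proof.
move=> u0; have := @integral_taboo_iter (Pr x) l 0 k (cst 1) u (chain x).1.
rewrite add0n /=.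
under eq_integral do rewrite mul1e.
under [in X in _ -> _ -> _ -> _ = X]eq_integral do rewrite mul1e.
move=> -> //; rewrite integral_start // => y; exact: iter_taboo_ge0.
Qed.

Lemma integral_zeta x l (u : E -> R) : (forall y, 0 <= u y)%R ->
  \int[Pr x]_w zeta l u w = green Pr X l (EFin \o u) x.
Proof.
move=> u0; rewrite /zeta integral_nneseries //.
- apply: eq_eseriesr => k _; rewrite -integral_alive; last first.
    by move=> y; rewrite lee_fin.
  by apply: eq_integral => w _; rewrite /cycle_term; case: ifP.
- by move=> k; apply/measurable_EFinP; exact: measurable_cycle_term.
- by move=> k w _; rewrite lee_fin cycle_term_ge0.
Qed.

(** Given the first [k] steps of the cycle, the mean of what it collects after
    time [k] is [taboo l (green l u)] at the current state. *)
Lemma integral_zeta_sqr x l (u : E -> R) : (forall y, 0 <= u y)%R ->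
  \int[Pr x]_w (zeta l u w ^+ 2) =
  green Pr X l (fun y => (u y)%:E *
    ((u y)%:E + 2%:E * taboo Pr X l (green Pr X l (EFin \o u)) y)) x.
Proof.
move=> u0; set U := EFin \o u.
have U0 y : 0 <= U y by rewrite lee_fin.
have T0 k y : 0 <= iter k (taboo Pr X l) U y by exact: iter_taboo_ge0.
have c0 k w := @cycle_term_ge0 l u k w u0.
under eq_integral => w _ do rewrite nneseries_sqr //.
have mc k := measurable_cycle_term l u k.
have ms k : measurable_fun [set: T] (fun w =>
   \sum_(0 <= m <oo) (cycle_term l u k w * cycle_term l u (k + m.+1) w)%:E).
  apply: ge0_emeasurable_sum => [m w _ _|m _].
    by rewrite lee_fin mulr_ge0.
  by apply/measurable_EFinP; exact: measurable_funM.
have s0 k w : 0 <= \sum_(0 <= m <oo)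
    (cycle_term l u k w * cycle_term l u (k + m.+1) w)%:E.
  by apply: nneseries_ge0 => *; rewrite lee_fin mulr_ge0.
have mcc k : measurable_fun [set: T] (fun w =>
    (cycle_term l u k w * cycle_term l u k w)%:E).
  by apply/measurable_EFinP; exact: measurable_funM.
have mss k : measurable_fun [set: T] (fun w => 2%:E *
   \sum_(0 <= m <oo) (cycle_term l u k w * cycle_term l u (k + m.+1) w)%:E).
  by apply: emeasurable_funM => //; exact: measurable_cst.
rewrite integral_nneseries //; first last.
- by move=> k w _; rewrite adde_ge0 ?mule_ge0 ?lee_fin ?mulr_ge0.
- by move=> k; apply: emeasurable_funD.
apply: eq_eseriesr => k _.
rewrite ge0_integralD //; first last.
- by move=> w _; rewrite mule_ge0.
- by move=> w _; rewrite lee_fin mulr_ge0.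
rewrite ge0_integralZl_EFin // integral_nneseries //; first last.
- by move=> m w _; rewrite lee_fin mulr_ge0.
- by move=> m; apply/measurable_EFinP; exact: measurable_funM.
have tail0 m y : 0 <= U y * iter m.+1 (taboo Pr X l) U y by rewrite mule_ge0.
have tailE y : U y * taboo Pr X l (green Pr X l U) y =
    \sum_(0 <= m <oo) U y * iter m.+1 (taboo Pr X l) U y.
  by rewrite /green (taboo_series chain) // -nneseriesZl // => i _; exact: (T0 i.+1).
transitivity (iter k (taboo Pr X l) (fun y => U y * U y + 2%:E *
    \sum_(0 <= m <oo) U y * iter m.+1 (taboo Pr X l) U y) x); last first.
  congr (iter _ _ _ _); apply/funext => y.
  have t0 : 0 <= taboo Pr X l (green Pr X l U) y.
    by apply: taboo_ge0 => z; exact: green_ge0.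
  have t2 : 0 <= 2%:E * taboo Pr X l (green Pr X l U) y by rewrite mule_ge0.
  rewrite -tailE [RHS](ge0_muleDr _ (U0 y) t2).
  by rewrite [X in _ + X = _]muleCA.
rewrite (iter_tabooD chain); first last.
- by move=> y; rewrite mule_ge0 //; exact: nneseries_ge0.
- by move=> y; rewrite mule_ge0.
rewrite (iter_tabooZ chain) //; last by move=> y; exact: nneseries_ge0.
rewrite (iter_taboo_series chain) //.
congr (_ + _ * _).
  rewrite -integral_alive; last by move=> y; rewrite mule_ge0.
  by apply: eq_integral => w _; rewrite /cycle_term; case: ifP; rewrite ?mulr0.
apply: eq_eseriesr => m _.
rewrite -integral_alive //.
transitivity (\int[Pr x]_w ((cycle_term l u k w)%:E *
    (if avoids l k m.+1 w then U (X (k + m.+1) w) else 0))).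
  apply: eq_integral => w _; rewrite EFinM /cycle_term avoidsD add0n.
  by case: avoids; rewrite ?mul0e //=; case: ifP.
rewrite integral_taboo_iter //.
- apply: eq_integral => w _; rewrite /cycle_term; case: ifP => //.
  by rewrite mul0e.
- exact: (chain x).1.
- by apply: adapted1; exact: adapted_cycle_term.
- by move=> w; rewrite lee_fin.
Qed.

End cycle_functionals.

(** * The stationary law *)

Section stationary_start.
Context {R : realType} {d : measure_display} {T : measurableType d}
  {E : countType} (p : E -> E -> R) (Pr : E -> probability T R)
  (X : nat -> T -> E) (j : E).
Local Open Scope ereal_scope.

Hypothesis chain : forall x, markov_chain_from p (Pr x) X x.
Hypothesis mean_cycle : green Pr X j (cst 1) j < +oo.

Let is_j (z : E) : \bar R := if z == j then 1 else 0.

Let is_j_ge0 z : 0 <= is_j z. Proof. by rewrite /is_j; case: eqP. Qed.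

(** The chain returns to [j] almost surely, since the return time is integrable;
    so the total mass of the hitting probabilities along a cycle is one. *)
Lemma green_hit : green Pr X j (step Pr X is_j) j = 1.
Proof.
have h0 y : 0 <= step Pr X is_j y by exact: step_ge0.
have one0 (y : E) : 0 <= cst 1 y :> \bar R by [].
pose t k := iter k (taboo Pr X j) (cst 1) j.
have t0 k : 0 <= t k by exact: iter_taboo_ge0.
have hit1 y : step Pr X is_j y + taboo Pr X j (cst 1) y = 1.
  rewrite /taboo -(stepD chain) //; last by move=> z; exact: mask_ge0.
  rewrite -[RHS](step_cst Pr X 1 y); congr step; apply/funext => z.
  by rewrite /is_j /mask; case: eqP; rewrite ?adde0 ?add0e.
have tS k : iter k (taboo Pr X j) (step Pr X is_j) j + t k.+1 = t k.
  rewrite /t iterSr -(iter_tabooD chain) //; last by move=> y; exact: taboo_ge0.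
  by congr (iter _ _ _ _); apply/funext => y; rewrite hit1.
have sumt n : green_part Pr X j (step Pr X is_j) n j + t n = 1.
  elim: n => [|n IH]; first by rewrite /green_part big_nil add0e.
  by rewrite /green_part big_nat_recr //= -addeA tS.
have tfin n : t n \is a fin_num.
  rewrite ge0_fin_numE // (@le_lt_trans _ _ 1) ?ltry // -(sumt n) leeDr //.
  exact: green_part_ge0.
have t_cvg : t @ \oo --> 0.
  have tail := nneseries_tail_cvg mean_cycle (fun k _ => t0 k).
  apply: (squeeze_cvge _ (cvg_cst 0) tail); apply: nearW => n.
  rewrite t0 /= -[leLHS]/(t n).
  have := @nneseries_lim_ge _ (fun k => iter k (taboo Pr X j) (cst 1) j) xpredT n n.+1.
  by rewrite big_nat1; apply=> k _ _; exact: t0.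
apply: cvg_lim => //.
rewrite (_ : (fun n => _) = (fun n => 1 - t n)); last first.
  apply/funext => n; rewrite -(sumt n) addeK //.
rewrite -[X in _ --> X]sube0; apply: cvgeB => //; exact: cvg_cst.
Qed.

(** The occupation measure [f |-> green f j] of a cycle is invariant: shifting time
    by one replaces the initial visit to [j] by the one that ends the cycle. *)
Lemma green_step f : (forall y, 0 <= f y) ->
  green Pr X j (step Pr X f) j = green Pr X j f j.
Proof.
move=> f0.
have stepE y : step Pr X f y = taboo Pr X j f y + f j * step Pr X is_j y.
  rewrite -(stepZ chain) // /taboo -(stepD chain).
  - congr step; apply/funext => z; rewrite /mask /is_j.
    by case: eqP => [->|_]; rewrite ?add0e ?mule1 ?mule0 ?adde0.
  - by move=> z; exact: mask_ge0.
  - by move=> z; rewrite mule_ge0.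
have T0 y : 0 <= taboo Pr X j f y by exact: taboo_ge0.
have h0 y : 0 <= step Pr X is_j y by exact: step_ge0.
rewrite (_ : step Pr X f = fun y => taboo Pr X j f y + f j * step Pr X is_j y);
  last exact/funext.
rewrite (greenD chain) //; last by move=> y; rewrite mule_ge0.
rewrite (greenZ chain) // green_hit mule1 addeC [RHS]/green nneseriesS; last first.
  by move=> k; exact: iter_taboo_ge0.
by congr (_ + _); apply: eq_eseriesr => k _; rewrite iterSr.
Qed.

Let m_fin : green Pr X j (cst 1) j \is a fin_num.
Proof. by rewrite ge0_fin_numE //; exact: green_ge0. Qed.

Definition cycle_mean : R := fine (green Pr X j (cst 1) j).

Lemma cycle_mean_ge1 : (1 <= cycle_mean)%R.
Proof.
rewrite -lee_fin /cycle_mean fineK //.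
exact: (@le_green_ge _ _ _ _ _ _ _ chain j (cst 1)).
Qed.

Lemma cycle_mean_gt0 : (0 < cycle_mean)%R.
Proof. exact: lt_le_trans cycle_mean_ge1. Qed.

Let is_x (x z : E) : \bar R := if z == x then 1 else 0.

Let is_x_ge0 x z : 0 <= is_x x z. Proof. by rewrite /is_x; case: eqP. Qed.

Let green_x_fin x : green Pr X j (is_x x) j \is a fin_num.
Proof.
rewrite ge0_fin_numE; last exact: green_ge0.
apply: le_lt_trans mean_cycle; apply: (le_green chain) => // y.
by rewrite /is_x; case: eqP.
Qed.

Let occ (x : E) : {nonneg R} :=
  NngNum (fine_ge0 (green_ge0 Pr X j j (is_x_ge0 x))).

Let occE x : (occ x)%:num%:E = green Pr X j (is_x x) j.
Proof. exact: fineK. Qed.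

Let cm_inv_ge0 : (0 <= cycle_mean^-1)%R.
Proof. by rewrite invr_ge0 ltW // cycle_mean_gt0. Qed.

Let cm_inv : {nonneg R} := NngNum (cm_inv_ge0).

Let part n : {measure set T -> \bar R} :=
  if pickle_inv n is Some x then mscale (occ x) (Pr x) else mzero.

Let mix : {measure set T -> \bar R} := mscale cm_inv (mseries part 0).

Let green_sum (f : E -> \bar R) : (forall y, 0 <= f y) ->
  green Pr X j f j = \sum_(0 <= n <oo)
    (if pickle_inv n is Some x then f x * green Pr X j (is_x x) j else 0).
Proof.
move=> f0; pose F n (y : E) :=
  if pickle_inv n is Some x then f x * is_x x y else 0.
have F0 n y : 0 <= F n y.
  by rewrite /F; case: pickle_inv => // x; rewrite mule_ge0.
transitivity (green Pr X j (fun y => \sum_(0 <= n <oo) F n y) j).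
  congr green; apply/funext => y.
  rewrite (nneseries_split 0 (pickle y)) // add0n big_nat_cond big1 ?add0e; last first.
    move=> n; rewrite andbT => /= ny; rewrite /F; case E0 : pickle_inv => [x|//].
    rewrite /is_x; case: eqP => [yx|]; last by rewrite mule0.
    have := pickle_invK (T := E) n; rewrite E0 /= => nx.
    by move: ny; rewrite yx nx ltnn.
  rewrite (nneseries_split (pickle y) 1) //.
  rewrite addn1 big_nat1.
  rewrite eseries0 ?adde0; last first.
    move=> n ny _; rewrite /F; case E0 : pickle_inv => [x|//].
    rewrite /is_x; case: eqP => [yx|]; last by rewrite mule0.
    have := pickle_invK (T := E) n; rewrite E0 /= => nx.
    by move: ny; rewrite yx nx ltnn.
  by rewrite /F pickleK_inv /is_x eqxx mule1.
rewrite (green_series chain) //; apply: eq_eseriesr => n _.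
rewrite /F; case: pickle_inv => [x|]; first by rewrite (greenZ chain).
rewrite -[RHS](mul0e (green Pr X j (cst 1) j)) -(greenZ chain) //.
by congr green; apply/funext => y; rewrite mul0e.
Qed.

Let mixE (F : T -> \bar R) : measurable_fun setT F -> (forall w, 0 <= F w) ->
  \int[mix]_w F w = (cycle_mean^-1)%:E * \sum_(0 <= n <oo)
    (if pickle_inv n is Some x then green Pr X j (is_x x) j * \int[Pr x]_w F w
     else 0).
Proof.
move=> mF F0; rewrite ge0_integral_mscale // ge0_integral_measure_series //.
congr (_ * _); apply: eq_eseriesr => n _; rewrite /part.
case: pickle_inv => [x|]; last by rewrite integral_measure_zero.
by rewrite ge0_integral_mscale // occE.
Qed.

Let mix1 : mix setT = 1.
Proof.
rewrite -(mul1e (mix setT)) -(integral_cst mix measurableT) mixE //.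
rewrite (eq_eseriesr (g := fun n => if pickle_inv n is Some x
    then cst 1 x * green Pr X j (is_x x) j else 0)); last first.
  move=> n _; case: pickle_inv => // x.
  rewrite (integral_cst (Pr x) measurableT) [X in _ * (_ * X)]probability_setT.
  by rewrite !mule1 mul1e.
rewrite -green_sum // -(fineK m_fin) -EFinM mulVf //.
by rewrite gt_eqF // cycle_mean_gt0.
Qed.

Let mixP : probability T R := mnormalize mix (Pr j).

Let mixPE A : mixP A = mix A.
Proof.
by rewrite /= /mnormalize /= -/mix mix1 onee_eq0 /= invr1 mule1.
Qed.

Let mixP_integral (F : T -> \bar R) : \int[mixP]_w F w = \int[mix]_w F w.
Proof. by apply: eq_measure_integral => A _ _; exact: mixPE. Qed.

(** The mixture of the laws of the chain over its starting point, weighted by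
    the mean number of visits to that point during a cycle at [j]. *)
Lemma stationary_law : exists Q : probability T R,
  markov_chain p Q X /\
  forall k (f : E -> \bar R), (forall y, 0 <= f y) ->
    \int[Q]_w f (X k w) = (cycle_mean^-1)%:E * green Pr X j f j.
Proof.
exists mixP.
have mX : forall k x, measurable [set w | X k w = x] by have [[]] := chain j.
have chQ : markov_chain p mixP X.
  split=> // k x.
  have mC m : measurable [set w | forall i, (i <= m)%N -> X i w = x i].
    rewrite (_ : mkset _ = \bigcap_(i in `I_m.+1) [set w | X i w = x i]) //.
    by apply: bigcap_measurable => //; exists 0%N.
  have mixA (A : set T) : measurable A -> mixP A = (cycle_mean^-1)%:E * \sum_(0 <= n <oo)
    (if pickle_inv n is Some x then green Pr X j (is_x x) j * Pr x A else 0).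
    move=> mA; rewrite mixPE; transitivity (\int[mix]_w (\1_A w)%:E).
      by rewrite integral_indic // setIT.
    rewrite mixE //; last exact/measurable_EFinP.
    congr (_ * _); apply: eq_eseriesr => n _; case: pickle_inv => // z.
    by rewrite integral_indic // setIT.
  rewrite !mixA // -muleA; congr (_ * _).
  rewrite muleC -nneseriesZ; first last.
  - by move=> n; case: pickle_inv => // z; rewrite mule_ge0 // green_ge0.
  - by rewrite -(step_prob chain).
  apply: eq_eseriesr => n _; case: pickle_inv => [z|]; last by rewrite mule0.
  by have [[_ ->] _] := chain z; rewrite [RHS]muleCA [in RHS](muleC (p _ _)%:E).
split=> // k; elim: k => [|k IH] f f0.
  rewrite mixP_integral mixE //; last exact: (measurable_comp_X mX).
  congr (_ * _); rewrite green_sum //; apply: eq_eseriesr => n _.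
  case: pickle_inv => // x; rewrite muleC; congr (_ * _).
  exact: (integral_start chain).
have := @markov_step _ _ _ _ _ _ _ chain mixP k (cst 1) f chQ.
under eq_integral do rewrite mul1e.
under [in X in _ -> _ -> _ -> _ = X]eq_integral do rewrite mul1e.
move=> -> //; rewrite IH ?green_step // => y; exact: step_ge0.
Qed.

End stationary_start.

(** * Bounded functions and bounded martingales *)

Section bounded_functions.
Context {R : realType} {d : measure_display} {T : measurableType d}.
Variable Q : probability T R.
Implicit Types F G : T -> R.

(** Integrals of such functions are linear without side conditions. *)
Definition tame F : Prop :=
  measurable_fun setT F /\ exists B : R, forall w, `|F w| <= B.

Lemma tame_cst (c : R) : tame (cst c).
Proof. by split; [exact: measurable_cst|exists `|c|]. Qed.

Lemma tameD F G : tame F -> tame G -> tame (fun w => F w + G w).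
Proof.
move=> [mF [B FB]] [mG [C GC]]; split; first exact: measurable_funD.
by exists (B + C) => w; apply: le_trans (ler_normD _ _) _; exact: lerD.
Qed.

Lemma tameM F G : tame F -> tame G -> tame (fun w => F w * G w).
Proof.
move=> [mF [B FB]] [mG [C GC]]; split; first exact: measurable_funM.
by exists (B * C) => w; rewrite normrM; apply: ler_pM.
Qed.

Lemma tameZ (c : R) F : tame F -> tame (fun w => c * F w).
Proof. by move=> tF; apply: tameM => //; exact: tame_cst. Qed.

Lemma tameB F G : tame F -> tame G -> tame (fun w => F w - G w).
Proof.
move=> tF tG; under [X in tame X]funext do rewrite -[- _]mulN1r.
by apply: tameD => //; exact: tameZ.
Qed.

Lemma tameX n F : tame F -> tame (fun w => F w ^+ n).
Proof.
move=> tF; elim: n => [|n IH].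
  under [X in tame X]funext do rewrite expr0; exact: tame_cst.
by under [X in tame X]funext do rewrite exprS; exact: tameM.
Qed.

Lemma tame_sum n (F : nat -> T -> R) : (forall k, tame (F k)) ->
  tame (fun w => \sum_(k < n) F k w).
Proof.
move=> tF; elim: n => [|n IH].
  under [X in tame X]funext do rewrite big_ord0; exact: tame_cst.
by under [X in tame X]funext do rewrite big_ord_recr /=; exact: tameD.
Qed.

Lemma tame_integrable F : tame F -> Q.-integrable setT (EFin \o F).
Proof.
move=> [mF [B FB]]; apply: measurable_bounded_integrable => //.
  by rewrite [X in (X < _)%E]probability_setT ltry.
exists B; split; first exact: num_real.
by move=> x Bx w _ /=; apply: le_trans (FB w) _; exact: ltW.
Qed.

Local Notation mean F := (\int[Q]_w F w).

Lemma mean_cst (c : R) : mean (cst c) = c.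
Proof. by rewrite Rintegral_cst // [X in fine X]probability_setT mulr1. Qed.

Lemma meanD F G : tame F -> tame G ->
  mean (fun w => F w + G w) = mean F + mean G.
Proof. by move=> tF tG; rewrite RintegralD //; exact: tame_integrable. Qed.

Lemma meanB F G : tame F -> tame G ->
  mean (fun w => F w - G w) = mean F - mean G.
Proof. by move=> tF tG; rewrite RintegralB //; exact: tame_integrable. Qed.

Lemma meanZ (c : R) F : tame F -> mean (fun w => c * F w) = c * mean F.
Proof. by move=> tF; rewrite RintegralZl //; exact: tame_integrable. Qed.

Lemma le_mean F G : tame F -> tame G -> (forall w, F w <= G w) ->
  mean F <= mean G.
Proof. by move=> tF tG FG; apply: le_Rintegral => //; exact: tame_integrable. Qed.

Lemma eq_mean F G : (forall w, F w = G w) -> mean F = mean G.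
Proof. by move=> FG; apply: eq_Rintegral => w _; exact: FG. Qed.

Lemma mean_integral F : tame F -> (\int[Q]_w (F w)%:E = (mean F)%:E)%E.
Proof.
by move=> tF; rewrite /Rintegral fineK //; apply: integrable_fin_num => //;
exact: tame_integrable.
Qed.

Lemma tame_adapted {E : countType} (X : nat -> T -> E) k F (B : R) :
  (forall k x, measurable [set w | X k w = x]) ->
  adapted X k F -> (forall w, `|F w| <= B) -> tame F.
Proof.
move=> mX aF FB; split; last by exists B.
exact: (measurable_adapted mX aF).
Qed.

End bounded_functions.

Section bounded_martingale.
Context {R : realType} {d : measure_display} {T : measurableType d}
  {E : countType} (p : E -> E -> R) (Pr : E -> probability T R)
  (X : nat -> T -> E) (Q : probability T R).
Hypothesis chain : forall x, markov_chain_from p (Pr x) X x.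
Hypothesis chainQ : markov_chain p Q X.
Variables (f g : E -> R) (B : R).
Hypothesis fB : forall x, `|f x| <= B.
Hypothesis gE : forall x, \int[Pr x]_w f (X 1 w) = g x.

Local Notation mean F := (\int[Q]_w F w).

Let mX : forall k x, measurable [set w | X k w = x]. Proof. by case: chainQ. Qed.

Let tame_X k (h : E -> R) (C : R) : (forall x, `|h x| <= C) -> tame (fun w => h (X k w)).
Proof.
move=> hC; apply: (@tame_adapted _ _ _ _ X k _ C) => //.
exact: adapted_X.
Qed.

Let B0 : E -> 0 <= B. Proof. by move=> x; exact: le_trans (fB x). Qed.

Lemma drift_bounded x : `|g x| <= B.
Proof.
have tf : tame (fun w => f (X 1 w)) by exact: tame_X fB.
rewrite -gE; apply: le_trans (le_normr_Rintegral _ _) _ => //.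
  exact: tame_integrable.
rewrite -[leRHS](mean_cst (Pr x) B); apply: le_mean => //; last exact: tame_cst.
by apply: (@tame_X 1%N (fun y => `|f y|) B) => y; rewrite normr_id.
Qed.

Let tf k : tame (fun w => f (X k w)). Proof. exact: tame_X fB. Qed.
Let tg k : tame (fun w => g (X k w)). Proof. exact: tame_X drift_bounded. Qed.

Lemma markov_mean k (G : T -> R) : adapted X k G -> tame G ->
  mean (fun w => G w * f (X k.+1 w)) = mean (fun w => G w * g (X k w)).
Proof.
move=> aG tG; have [mG [C GC]] := tG.
have key (H : T -> R) : adapted X k H -> tame H -> (forall w, 0 <= H w) ->
    mean (fun w => H w * (f (X k.+1 w) + B)) = mean (fun w => H w * (g (X k w) + B)).
  move=> aH tH H0; apply: EFin_inj; rewrite -!mean_integral; last 2 first.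
  - by apply: tameM => //; apply: tameD => //; exact: tame_cst.
  - by apply: tameM => //; apply: tameD => //; exact: tame_cst.
  have := @markov_step _ _ _ _ _ _ _ chain Q k (EFin \o H)
    (fun y => (f y + B)%:E) chainQ.
  move=> -> //.
  - apply: eq_integral => w _; rewrite EFinM /=; congr (_ * _)%E.
    rewrite /step mean_integral; last by apply: tameD => //; exact: tame_cst.
    by rewrite meanD //; [rewrite gE mean_cst|exact: tame_cst].
  - exact: adapted1.
  - by move=> y; rewrite lee_fin -lerBlDr sub0r lerNl (le_trans _ (fB y)) // -normrN ler_norm.
have tB : tame (fun w : T => B : R) by exact: tame_cst.
have tC : tame (fun w : T => C : R) by exact: tame_cst.
have tfB := tameD (tf k.+1) (tame_cst B).
have tgB := tameD (tg k) (tame_cst B).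
have e1 := key (fun w => G w + C).
have e2 := key (fun=> C).
have C0 (w : T) : 0 <= C := le_trans (normr_ge0 _) (GC w).
have {}e1 : mean (fun w => (G w + C) * (f (X k.+1 w) + B)) =
            mean (fun w => (G w + C) * (g (X k w) + B)).
  apply: e1; first by move=> w w' h; rewrite (aG _ _ h).
    exact: tameD.
  by move=> w; rewrite -lerBlDr sub0r lerNl (le_trans _ (GC w)) // -normrN ler_norm.
have {}e2 : mean (fun w => C * (f (X k.+1 w) + B)) =
            mean (fun w => C * (g (X k w) + B)).
  by apply: e2 => // w.
have expand (h : T -> R) : tame h ->
   mean (fun w => (G w + C) * (h w + B)) = mean (fun w => G w * h w) +
     mean (fun w => G w * B) + mean (fun w => C * (h w + B)).
  move=> th; rewrite -!meanD.
  - by apply: eq_mean => w; ring.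
  - by apply: tameD; apply: tameM.
  - by apply: tameM => //; exact: tameD.
  - exact: tameM.
  - exact: tameM.
move: e1; rewrite !expand // e2 => /addIr /addIr //.
Qed.

(** The martingale of the increments of [f] along the chain, compensated by their
    conditional means [g]. *)
Definition mart (n : nat) (w : T) : R :=
  \sum_(k < n) (f (X k.+1 w) - g (X k w)).

Lemma mart0 w : mart 0 w = 0. Proof. by rewrite /mart big_ord0. Qed.

Lemma martS n w : mart n.+1 w = mart n w + (f (X n.+1 w) - g (X n w)).
Proof. by rewrite /mart big_ord_recr. Qed.

Lemma adapted_mart n : adapted X n (mart n).
Proof.
apply: (adapted_sum (F := fun k w => f (X k.+1 w) - g (X k w))) => k kn w w' h.
by rewrite !h // ltnW.
Qed.

Lemma tame_mart n : tame (mart n).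
Proof.
by apply: (@tame_sum _ _ _ _ (fun k w => f (X k.+1 w) - g (X k w))) => k; exact: tameB.
Qed.

Let incr n w := f (X n.+1 w) - g (X n w).

Let tame_incr n : tame (incr n). Proof. exact: tameB. Qed.

Let incrB n w : `|incr n w| <= 2 * B.
Proof.
rewrite /incr (le_trans (ler_normB _ _)) // mulr2n mulrDl mul1r.
by rewrite lerD // drift_bounded.
Qed.

Let mean_incr n (G : T -> R) : adapted X n G -> tame G ->
  mean (fun w => G w * incr n w) = 0.
Proof.
move=> aG tG; transitivity (mean (fun w => G w * f (X n.+1 w) - G w * g (X n w))).
  by apply: eq_mean => w; rewrite mulrBr.
by rewrite meanB ?markov_mean ?subrr //; exact: tameM.
Qed.

Hypothesis stationary : forall k (h : E -> R) (C : R), (forall x, `|h x| <= C) ->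
  mean (fun w => h (X k w)) = mean (fun w => h (X 0 w)).

(** The variance of a compensated increment of [f] under the stationary law. *)
Definition energy : R :=
  mean (fun w => f (X 0 w) ^+ 2) - mean (fun w => g (X 0 w) ^+ 2).

Let mean_incr2 n : mean (fun w => incr n w ^+ 2) = energy.
Proof.
have sq (h : E -> R) : (forall x, `|h x| <= B) -> forall x, `|h x ^+ 2| <= B ^+ 2.
  by move=> hB x; rewrite normrX lerXn2r ?nnegrE ?normr_ge0 //; exact: B0.
have tgg : tame (fun w => g (X n w) * g (X n w)) by exact: tameM.
have := @markov_mean n (fun w => g (X n w)) (@adapted_X _ _ _ _ _ n g) (tg n).
move=> e.
transitivity (mean (fun w => f (X n.+1 w) ^+ 2) - 2 * mean (fun w => g (X n w) * f (X n.+1 w))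
   + mean (fun w => g (X n w) * g (X n w))).
  rewrite -meanZ; last exact: tameM.
  rewrite -meanB; last 2 first.
  - exact: tameX.
  - by apply: tameZ; exact: tameM.
  rewrite -meanD //.
    by apply: eq_mean => w; rewrite /incr; ring.
  apply: tameB; first exact: tameX.
  by apply: tameZ; exact: tameM.
rewrite e /energy (@stationary n.+1 (fun x => f x ^+ 2) (B ^+ 2)); last exact: sq.
rewrite -(@stationary n (fun x => g x ^+ 2) (B ^+ 2)); last exact/sq/drift_bounded.
under [X in _ = _ - X]eq_mean do rewrite expr2.
ring.
Qed.

Lemma mean_mart2 n : mean (fun w => mart n w ^+ 2) = n%:R * energy.
Proof.
elim: n => [|n IH].
  rewrite mul0r -[RHS](mean_cst Q 0); apply: eq_mean => w.
  by rewrite mart0 expr0n.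
transitivity (mean (fun w => mart n w ^+ 2) + 2 * mean (fun w => mart n w * incr n w)
   + mean (fun w => incr n w ^+ 2)).
  have tM := tame_mart n; have tI := tame_incr n.
  rewrite -meanZ; last exact: tameM.
  rewrite -meanD; [|exact: tameX|by apply: tameZ; exact: tameM].
  rewrite -meanD; [|by apply: tameD; [exact: tameX|apply: tameZ; exact: tameM]|exact: tameX].
  by apply: eq_mean => w; rewrite martS /incr; ring.
rewrite mean_incr //; [|exact: adapted_mart|exact: tame_mart].
by rewrite IH mean_incr2 mulr0 addr0 -natr1 mulrDl mul1r.
Qed.

Let energy_le : energy <= (2 * B) ^+ 2.
Proof.
rewrite -(mean_incr2 0) -[leRHS](mean_cst Q); apply: le_mean.
- by apply: tameX; exact: tame_incr.
- exact: tame_cst.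
move=> w; rewrite -real_normK ?num_real // lerXn2r ?nnegrE ?incrB //.
by rewrite mulr_ge0 //; exact: (B0 (X 0 w)).
Qed.

(** Fourth moments are quadratic in time: conditionally on the past the cubic
    cross term vanishes, and the other terms are controlled by the second
    moment because the increments are bounded. *)
Lemma mean_mart4 n : mean (fun w => mart n w ^+ 4) <= 8 * (2 * B) ^+ 4 * n%:R ^+ 2.
Proof.
set b := 2 * B.
elim: n => [|n IH].
  rewrite [leLHS](_ : _ = 0) ?expr0n ?mulr0 //.
  by rewrite -[RHS](mean_cst Q 0); apply: eq_mean => w; rewrite mart0 expr0n.
have tM := tame_mart n; have tI := tame_incr n.
have tM3 := tameX 3 tM; have tM2 := tameX 2 tM; have tM4 := tameX 4 tM.
have tMI : tame (fun w => mart n w ^+ 3 * incr n w) by exact: tameM.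
(* [(x + y) ^ 4] with [4 * x * y ^ 3 <= 2 * x ^ 2 * y ^ 2 + 2 * y ^ 4] and [y ^ 2 <= b ^ 2] *)
apply: (@le_trans _ _ (mean (fun w => mart n w ^+ 4 + 4 * (mart n w ^+ 3 * incr n w)
   + (8 * b ^+ 2 * mart n w ^+ 2 + 3 * b ^+ 4)))).
  apply: le_mean.
  - by apply: tameX; exact: tame_mart.
  - apply: tameD; first by apply: tameD => //; exact: tameZ.
    by apply: tameD; [exact: tameZ|exact: tame_cst].
  move=> w; rewrite martS -/(incr n w); have := incrB n w; rewrite -/b.
  move: (mart n w) (incr n w) => x y yb.
  have b0 : 0 <= b by exact: le_trans yb.
  have y2 : y ^+ 2 <= b ^+ 2.
    by rewrite -real_normK ?num_real // lerXn2r ?nnegrE.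
  have x2 := sqr_ge0 x; have y20 := sqr_ge0 y.
  have s1 : x ^+ 2 * y ^+ 2 <= x ^+ 2 * b ^+ 2 by exact: ler_wpM2l.
  have s2 : y ^+ 4 <= b ^+ 4.
    by rewrite (exprM y 2 2) (exprM b 2 2) lerXn2r ?nnegrE // sqr_ge0.
  have s3 : 4 * (x * y ^+ 3) <= 2 * (x ^+ 2 * y ^+ 2) + 2 * y ^+ 4.
    have := sqr_ge0 ((x - y) * y); rewrite -subr_ge0 => h.
    by rewrite [leRHS](_ : _ = 2 * ((x - y) * y - 0) ^+ 2 + 4 * (x * y ^+ 3)) ?lerDr;
      [rewrite subr0 mulr_ge0 // sqr_ge0|ring].
  rewrite [leLHS](_ : _ = x ^+ 4 + 4 * (x ^+ 3 * y) + (6 * (x ^+ 2 * y ^+ 2) + 4 * (x * y ^+ 3) + y ^+ 4)); last by ring.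
  lra.
rewrite meanD; last 2 first.
- by apply: tameD => //; exact: tameZ.
- by apply: tameD; [exact: tameZ|exact: tame_cst].
rewrite (meanD Q tM4); last exact: tameZ.
rewrite meanZ // mean_incr //; last first.
  by apply: (adapted1 (fun r : R => r ^+ 3)); exact: adapted_mart.
rewrite meanD; [|exact: tameZ|exact: tame_cst].
rewrite meanZ // (mean_cst Q (3 * b ^+ 4)) mean_mart2.
have en := energy_le; rewrite -/b in en.
have b20 := sqr_ge0 b.
have : b ^+ 2 * (n%:R * energy) <= n%:R * b ^+ 4.
  rewrite mulrCA ler_wpM2l // (exprM b 2 2) [leRHS]expr2.
  exact: ler_wpM2l.
have b40 : 0 <= b ^+ 4 by rewrite (exprM b 2 2) sqr_ge0.
have : 0 <= n%:R * b ^+ 4 by rewrite mulr_ge0.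
move=> h1 h2; apply: (@le_trans _ _ (mean (fun w => mart n w ^+ 4) +
    8 * (b ^+ 2 * (n%:R * energy)) + 3 * b ^+ 4)).
  by rewrite le_eqVlt; apply/orP; left; apply/eqP; ring.
move: IH h1 h2; rewrite -natr1; move: (Rintegral _ _ _) (b ^+ 2 * _) => x y IH h1 h2; nra.
Qed.

End bounded_martingale.

(** * Martingales of unbounded Green functions *)

Section monotone_limits.
Context {R : realType} {d : measure_display} {T : measurableType d}
  {E : countType} (p : E -> E -> R) (Pr : E -> probability T R)
  (X : nat -> T -> E) (j : E).
Local Open Scope ereal_scope.
Hypothesis chain : forall x, markov_chain_from p (Pr x) X x.
Implicit Types (x y : E).

Lemma fatou_bound (Q : probability T R) (F_ : nat -> T -> \bar R)
    (F : T -> \bar R) (M : \bar R) :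
  (forall n, measurable_fun setT (F_ n)) -> (forall n w, 0 <= F_ n w) ->
  measurable_fun setT F -> (forall w, 0 <= F w) ->
  {ae Q, forall w, F_ ^~ w @ \oo --> F w} ->
  (forall n, \int[Q]_w F_ n w <= M) -> \int[Q]_w F w <= M.
Proof.
move=> mF_ F_0 mF F0 F_F FM.
apply: (@le_trans _ _ (\int[Q]_w limn_einf (F_ ^~ w))).
  apply: ae_ge0_le_integral => //.
  - move=> w _; rewrite limn_einf_lim; apply: lime_ge.
      exact: is_cvg_einfs.
    by apply: nearW => n; apply: le_ereal_inf_tmp => _ [m /= _ <-]; exact: F_0.
  - apply: (emeasurable_fun_cvg (fun n w => einfs (F_ ^~ w) n)).
      by move=> n; exact: measurable_fun_einfs.
    by move=> w _; rewrite limn_einf_lim; exact: is_cvg_einfs.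
  by apply: filterS F_F => w Fw _; rewrite is_cvg_limn_einfE ?(cvg_lim _ Fw) //; apply/cvg_ex; eexists; exact: Fw.
apply: (le_trans (fatou Q measurableT mF_ (fun n w _ => F_0 n w))).
rewrite limn_einf_lim; apply: lime_le; first exact: is_cvg_einfs.
apply: nearW => n; apply: le_trans (FM n).
by apply: ereal_inf_lbound; exists n => /=.
Qed.

Lemma taboo_cvg (f : nat -> E -> \bar R) (F : E -> \bar R) x :
  (forall n y, 0 <= f n y) -> (forall y, nondecreasing_seq (f ^~ y)) ->
  (forall y, f ^~ y @ \oo --> F y) ->
  taboo Pr X j (f n) x @[n --> \oo] --> taboo Pr X j F x.
Proof.
move=> f0 ndf fF; rewrite /taboo /step.
have -> : \int[Pr x]_w mask j F (X 1 w) =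
    \int[Pr x]_w limn (fun n => mask j (f n) (X 1 w)).
  apply: eq_integral => w _; apply/esym/cvg_lim => //.
  rewrite /mask; case: eqP => _; [exact: cvg_cst|exact: fF].
apply: (@cvg_monotone_convergence _ _ _ (Pr x) setT measurableT
  (fun n w => mask j (f n) (X 1 w))).
- by move=> n; exact: (measurable_step chain x).
- by move=> n w _; apply: mask_ge0.
- by move=> w _ m n mn; rewrite /mask; case: eqP => // _; exact: ndf.
Qed.

Definition truncation (u : E -> R) (B : nat) (y : E) : \bar R :=
  (Num.min (u y) B%:R)%:E.

Variable u : E -> R.
Hypothesis u0 : forall y, (0 <= u y)%R.

Lemma truncation_ge0 B y : 0 <= truncation u B y.
Proof. by rewrite lee_fin le_min u0 ler0n. Qed.

Let trunc_nd B C y : (B <= C)%N -> truncation u B y <= truncation u C y.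
Proof.
move=> BC; rewrite lee_fin le_min !ge_min lexx /=; apply/orP; right.
by rewrite ler_nat.
Qed.

Let truncle B y : truncation u B y <= (u y)%:E.
Proof. by rewrite lee_fin ge_min lexx. Qed.

(** A bounded approximation from below of the Green function of [u]: both the
    function and the number of steps are truncated at [B]. *)
Definition green_trunc (B : nat) (y : E) : \bar R :=
  green_part Pr X j (truncation u B) B y.

Lemma green_trunc_ge0 B y : 0 <= green_trunc B y.
Proof. by apply: green_part_ge0 => z; exact: truncation_ge0. Qed.

Lemma green_trunc_nd y : nondecreasing_seq (green_trunc ^~ y).
Proof.
move=> B C BC; rewrite /green_trunc /green_part.
apply: (@le_trans _ _ (\sum_(0 <= k < B) iter k (taboo Pr X j) (truncation u C) y)).
  apply: lee_sum => k _; apply: (le_iter_taboo chain) => z.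
    exact: truncation_ge0.
  exact: trunc_nd.
rewrite (big_cat_nat _ BC) //= leeDl // sume_ge0 // => k _.
by apply: iter_taboo_ge0 => z; exact: truncation_ge0.
Qed.

Lemma green_trunc_le B y : green_trunc B y <= green Pr X j (EFin \o u) y.
Proof.
apply: (@le_trans _ _ (green Pr X j (truncation u B) y)).
  apply: nneseries_lim_ge => k _ _.
  by apply: iter_taboo_ge0 => z; exact: truncation_ge0.
apply: (le_green chain) => z; [exact: truncation_ge0|exact: truncle].
Qed.

(** The increasing limit of the truncated functions solves the fixed-point
    equation of which [green u] is the least solution. *)
Lemma green_trunc_cvg y : green_trunc ^~ y @ \oo --> green Pr X j (EFin \o u) y.
Proof.
pose L z := ereal_sup (range (green_trunc ^~ z)).
have cL z : green_trunc ^~ z @ \oo --> L z.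
  exact: ereal_nondecreasing_cvgn (@green_trunc_nd z).
have leL B z : green_trunc B z <= L z by apply: ereal_sup_ubound; exists B.
have L0 z : 0 <= L z by apply: le_trans (leL 0%N z); exact: green_trunc_ge0.
suff -> : green Pr X j (EFin \o u) y = L y by exact: cL.
apply/eqP; rewrite eq_le; apply/andP; split; last first.
  by apply: ge_ereal_sup => _ [n _ <-]; exact: green_trunc_le.
apply: (green_min chain) => // z.
have c1 : truncation u B z + taboo Pr X j (green_trunc B) z @[B --> \oo] -->
    (u z)%:E + taboo Pr X j L z.
  apply: cvgeD => //.
  - apply: cvg_near_cst; near=> B; rewrite /truncation; congr (_%:E).
    by apply/min_idPl; near: B; exact: nbhs_infty_ger.
  - by apply: taboo_cvg => //; [exact: green_trunc_ge0|exact: green_trunc_nd].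
rewrite -(cvg_lim _ c1) //; apply: lime_le; first by apply/cvg_ex; eexists; exact: c1.
apply: nearW => B.
rewrite -(green_partS chain); last by move=> t; exact: truncation_ge0.
apply: le_trans (leL B.+1 z).
rewrite /green_trunc /green_part; apply: lee_sum => k _.
apply: (le_iter_taboo chain) => t; first exact: truncation_ge0.
exact: trunc_nd.
Unshelve. all: by end_near. Qed.

Lemma taboo_green_trunc_cvg y :
  taboo Pr X j (green_trunc B) y @[B --> \oo] -->
  taboo Pr X j (green Pr X j (EFin \o u)) y.
Proof.
apply: taboo_cvg; [exact: green_trunc_ge0|exact: green_trunc_nd|exact: green_trunc_cvg].
Qed.

(** Each of the [B] terms is at most [B]. *)
Lemma green_trunc_bounded B y : green_trunc B y <= (B%:R * B%:R)%:E.
Proof.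
have h k : iter k (taboo Pr X j) (truncation u B) y <= B%:R%:E.
  elim: k y => [|k IH] y /=; first by rewrite lee_fin ge_min lexx orbT.
  apply: (taboo_le_cst chain) => //.
  by move=> z; apply: iter_taboo_ge0 => t; exact: truncation_ge0.
apply: (@le_trans _ _ (\sum_(0 <= k < B) B%:R%:E)); first exact: lee_sum.
by rewrite sumEFin big_const_nat subn0 iter_addr_0 mulr_natl.
Qed.

Lemma green_trunc_drift B y :
  green_trunc B y <= (u y)%:E + taboo Pr X j (green_trunc B) y.
Proof.
apply: (@le_trans _ _ (green_part Pr X j (truncation u B) B.+1 y)).
  rewrite /green_part big_nat_recr //= leeDl // iter_taboo_ge0 // => z.
  exact: truncation_ge0.
rewrite (green_partS chain); last by move=> t; exact: truncation_ge0.
by rewrite leeD2r.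
Qed.

End monotone_limits.

Lemma cvg_sum_ord {R : realType} (n : nat) (f : nat -> nat -> R) (l : nat -> R) :
  (forall k, f k B @[B --> \oo] --> l k) ->
  (\sum_(k < n) f k B) @[B --> \oo] --> \sum_(k < n) l k.
Proof.
move=> fl; elim: n => [|n IH].
  by under eq_fun do rewrite big_ord0; rewrite big_ord0; exact: cvg_cst.
by under eq_fun do rewrite big_ord_recr; rewrite big_ord_recr; exact: cvgD.
Qed.

Section stationary_energy.
Context {R : realType} {d : measure_display} {T : measurableType d}
  {E : countType} (p : E -> E -> R) (Pr : E -> probability T R)
  (X : nat -> T -> E) (j : E) (Q : probability T R) (m : R).
Hypothesis chain : forall x, markov_chain_from p (Pr x) X x.
Hypothesis chainQ : markov_chain p Q X.
Hypothesis stat : forall k (f : E -> \bar R), (forall y, 0 <= f y)%E ->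
  (\int[Q]_w f (X k w) = (m^-1)%:E * green Pr X j f j)%E.

Local Notation mean F := (\int[Q]_w F w).

Let mX : forall k x, measurable [set w | X k w = x]. Proof. by case: chainQ. Qed.

Lemma tame_comp_X k (h : E -> R) (C : R) : (forall x, `|h x| <= C) ->
  tame (fun w => h (X k w)).
Proof.
move=> hC; apply: (@tame_adapted _ _ _ _ X k _ C) => //.
exact: adapted_X.
Qed.

Lemma stationary_mean k (h : E -> R) (C : R) : (forall x, `|h x| <= C) ->
  mean (fun w => h (X k w)) = mean (fun w => h (X 0 w)).
Proof.
move=> hC; have tC : tame (fun w : T => C) by exact: tame_cst.
have th i := @tame_comp_X i h C hC.
suff e : mean (fun w => h (X k w) + C) = mean (fun w => h (X 0 w) + C).
  by move: e; rewrite !meanD // => /addIr.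
rewrite /Rintegral.
have hC0 y : (0 <= (h y + C)%:E)%E.
  by rewrite lee_fin -lerBlDr sub0r lerNl (le_trans _ (hC y)) // -normrN ler_norm.
by rewrite (stat k (f := fun y => (h y + C)%:E)) // (stat 0 (f := fun y => (h y + C)%:E)).
Qed.

Lemma taboo_mean x (F : E -> \bar R) (C : R) :
  (forall y, 0 <= F y)%E -> (forall y, F y <= C%:E)%E ->
  \int[Pr x]_w fine (mask j F (X 1 w)) = fine (taboo Pr X j F x).
Proof.
move=> F0 FC; rewrite /Rintegral /taboo /step; congr fine.
apply: eq_integral => w _; rewrite fineK // ge0_fin_numE; last exact: mask_ge0.
by apply: (@le_lt_trans _ _ C%:E); rewrite ?ltry // /mask; case: eqP => // _;
   exact: le_trans (FC (X 1 w)).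
Qed.

Let bounded_fine (F : E -> \bar R) (C : R) y : (0 <= F y)%E -> (F y <= C%:E)%E ->
  F y = (fine (F y))%:E /\ 0 <= fine (F y) <= C.
Proof.
move=> F0 FC; have Ffin : F y \is a fin_num.
  by rewrite ge0_fin_numE // (le_lt_trans FC) ?ltry.
by rewrite fineK //; split=> //; rewrite fine_ge0 //= -lee_fin fineK.
Qed.

Variable u : E -> R.
Hypothesis u0 : forall y, 0 <= u y.

Let U : E -> \bar R := EFin \o u.
Let U0 y : (0 <= U y)%E. Proof. by rewrite lee_fin. Qed.
Let G := green Pr X j U.

(** The martingale attached to the Green function [G] of [u], which is set to zero
    at [j], where a cycle ends. Since [G] may be infinite at some states, it is
    meaningful only almost surely, where [G] is finite along the path. *)
Definition hat_mart n w : R :=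
  \sum_(k < n) (fine (mask j G (X k.+1 w)) - fine (taboo Pr X j G (X k w))).

Hypothesis G_fin : {ae Q, forall w, forall k, (G (X k w) < +oo)%E}.

Lemma measurable_hat_mart n : measurable_fun setT (hat_mart n).
Proof.
apply: (measurable_adapted mX (k := n)).
apply: (adapted_sum (F := fun k w =>
  fine (mask j G (X k.+1 w)) - fine (taboo Pr X j G (X k w)))) => k kn w w' h.
by rewrite !h // ltnW.
Qed.

(** For bounded Green functions the second moment is [n] times the energy, and the
    Poisson equation bounds the energy by the mean of [2 * u * G]. Fatou along the
    truncations gives the general case. *)
Lemma hat_mart_sqr_le n :
  (\int[Q]_w (hat_mart n w ^+ 2)%:E <=
   n%:R%:E * (2%:E * ((m^-1)%:E * green Pr X j (fun y => U y * G y) j)))%E.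
Proof.
set M := (X in (_ <= X)%E).
pose GB B := green_trunc Pr X j u B.
have GB0 B y : (0 <= GB B y)%E by exact: (green_trunc_ge0 Pr X j u0).
have GBle B y : (GB B y <= (B%:R * B%:R : R)%:E)%E.
  exact: (green_trunc_bounded j chain u0).
have TB0 B y : (0 <= taboo Pr X j (GB B) y)%E by exact: taboo_ge0.
have TBle B y : (taboo Pr X j (GB B) y <= (B%:R * B%:R : R)%:E)%E.
  by apply: (taboo_le_cst chain) => //; rewrite lee_fin mulr_ge0.
pose f B y := fine (mask j (GB B) y).
pose g B y := fine (taboo Pr X j (GB B) y).
have fB B y : `|f B y| <= B%:R * B%:R.
  have mle : (mask j (GB B) y <= (B%:R * B%:R : R)%:E)%E.
    by rewrite /mask; case: eqP => // _; rewrite lee_fin mulr_ge0.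
  have [_ /andP[h1 h2]] := bounded_fine (mask_ge0 j y (GB0 B)) mle.
  by rewrite ger0_norm.
have gE B x : \int[Pr x]_w f B (X 1 w) = g B x.
  exact: (@taboo_mean _ _ (B%:R * B%:R)).
have gB B y := drift_bounded chainQ (fB B) (gE B) y.
apply: (@fatou_bound _ _ _ Q (fun B w => (mart X (f B) (g B) n w ^+ 2)%:E)).
- move=> B; apply/measurable_EFinP.
  by have [] := tameX 2 (tame_mart chainQ (fB B) (gE B) n).
- by move=> B w; rewrite lee_fin sqr_ge0.
- by apply/measurable_EFinP; apply: measurable_funX; exact: measurable_hat_mart.
- by move=> w; rewrite lee_fin sqr_ge0.
- apply: filterS G_fin => w Gw.
  apply/cvg_EFin; first exact: nearW.
  rewrite /comp /= expr2; under eq_fun do rewrite expr2.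
  suff h : mart X (f B) (g B) n w @[B --> \oo] --> hat_mart n w by exact: cvgM.
  apply: (@cvg_sum_ord _ n (fun k B => f B (X k.+1 w) - g B (X k w))
    (fun k => fine (mask j G (X k.+1 w)) - fine (taboo Pr X j G (X k w)))) => k.
  apply: cvgB.
    apply: fine_cvg; rewrite fineK; last first.
      by rewrite ge0_fin_numE; [rewrite /mask; case: eqP|apply: mask_ge0 => y; exact: green_ge0].
    rewrite /mask; case: eqP => _; first exact: cvg_cst.
    exact: (green_trunc_cvg chain u0).
  apply: fine_cvg; rewrite fineK; last first.
    rewrite ge0_fin_numE; last by apply: taboo_ge0 => y; exact: green_ge0.
    by apply: le_lt_trans (Gw k); exact: (taboo_green_le chain).
  exact: (taboo_green_trunc_cvg chain u0).
move=> B.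
have tm := tame_mart chainQ (fB B) (gE B) n.
rewrite mean_integral; last exact: tameX.
rewrite (mean_mart2 chain chainQ (fB B) (gE B)); last exact: stationary_mean.
rewrite /M EFinM; apply: lee_wpmul2l; first by rewrite lee_fin.
pose K y := Num.max (f B y ^+ 2 - g B y ^+ 2) 0.
have KB y : `|K y| <= (B%:R * B%:R) ^+ 2.
  rewrite ger0_norm ?le_max ?lexx ?orbT // ge_max sqr_ge0 andbT.
  rewrite lerBlDr (@le_trans _ _ ((B%:R * B%:R) ^+ 2)) ?lerDl ?sqr_ge0 //.
  by rewrite -real_normK ?num_real // lerXn2r ?nnegrE ?mulr_ge0.
have tK := tame_comp_X 0 KB.
have tf2 : tame (fun w => f B (X 0 w) ^+ 2) by exact/tameX/(tame_comp_X 0 (fB B)).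
have tg2 : tame (fun w => g B (X 0 w) ^+ 2) by exact/tameX/(tame_comp_X 0 (gB B)).
apply: (@le_trans _ _ (mean (fun w => K (X 0 w)))%:E).
  rewrite lee_fin /energy -meanB //; apply: le_mean => //; first exact: tameB.
  by move=> w; rewrite /K le_max lexx.
rewrite -mean_integral //.
apply: (@le_trans _ _ (\int[Q]_w (2%:E * (U (X 0 w) * G (X 0 w)))%E)%E).
  apply: ge0_le_integral => //.
  - by move=> w _; rewrite lee_fin le_max lexx orbT.
  - by have [mK _] := tK; exact/measurable_EFinP.
  - exact: (@measurable_comp_X _ _ _ _ mX _ _ 0 (fun y => 2%:E * (U y * G y))%E).
  move=> w _; move: (X 0 w) => y.
  have G0 : (0 <= G y)%E by exact: green_ge0.
  rewrite /K maxEle; case: ifP => [_|/negbT]; first by do 2 apply: mule_ge0 => //.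
  rewrite -ltNge subr_gt0 => gf.
  have [GBE /andP[x0 _]] := bounded_fine (GB0 B y) (GBle B y).
  have [TBE /andP[t0 _]] := bounded_fine (TB0 B y) (TBle B y).
  have fle : 0 <= f B y <= fine (GB B y).
    by rewrite /f /mask; case: eqP => _; rewrite ?lexx x0.
  have drift := green_trunc_drift j chain u0 B y.
  rewrite -/(GB B) GBE TBE -EFinD lee_fin -/(g B y) in drift.
  apply: (@le_trans _ _ (2%:E * ((u y)%:E * (fine (GB B y))%:E))%E); last first.
    apply: lee_wpmul2l => //; apply: lee_wpmul2l; first exact: U0.
    rewrite -GBE.
    exact: (green_trunc_le j chain u0).
  rewrite -!EFinM lee_fin.
  move: (u0 y) fle gf t0 drift x0; rewrite -/(g B y).
  move: (u y) (f B y) (g B y) (fine (GB B y)) => a b c e a0 /andP[b0 be] cb c0 drift e0.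
  have h1 : b ^+ 2 <= e ^+ 2 by rewrite lerXn2r ?nnegrE.
  have ce : c <= e by nra.
  have : (e - c) * (e + c) <= a * (2 * e).
    apply: ler_pM => //; lra.
  nra.
rewrite ge0_integralZl_EFin //; last 2 first.
- by move=> w _; rewrite mule_ge0 //; exact: green_ge0.
- exact: (@measurable_comp_X _ _ _ _ mX _ _ 0 (fun y => U y * G y)%E).
by rewrite (stat 0 (f := fun y => U y * G y)%E) // => y; rewrite mule_ge0 //; exact: green_ge0.
Qed.

End stationary_energy.

(** * The energy of a bounded Green function *)

Section bounded_energy.
Context {R : realType} {d : measure_display} {T : measurableType d}
  {E : countType} (p : E -> E -> R) (Pr : E -> probability T R)
  (X : nat -> T -> E) (j : E) (Q : probability T R) (m : R).
Hypothesis chain : forall x, markov_chain_from p (Pr x) X x.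
Hypothesis chainQ : markov_chain p Q X.
Hypothesis stat : forall k (f : E -> \bar R), (forall y, 0 <= f y)%E ->
  (\int[Q]_w f (X k w) = (m^-1)%:E * green Pr X j f j)%E.

Local Notation mean F := (\int[Q]_w F w).
Let mX : forall k x, measurable [set w | X k w = x]. Proof. by case: chainQ. Qed.

Definition zetaR (u : E -> R) (w : T) : R := fine (zeta X j u w).

Lemma green_base : (green Pr X j (fun y => if y == j then 1 else 0) j = 1)%E.
Proof.
set ind := (fun y => _).
have ind0 y : (0 <= ind y)%E by rewrite /ind; case: eqP.
apply/eqP; rewrite eq_le; apply/andP; split; last first.
  by have := le_green_ge chain j j ind0; rewrite {1}/ind eqxx.
have -> : (1 = ind j)%E by rewrite /ind eqxx.
apply: (green_min chain) => // y.
rewrite /taboo (_ : mask j ind = cst 0%E) ?step_cst ?adde0 //.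
by apply/funext => z; rewrite /mask /ind; case: eqP.
Qed.

Lemma fineZ (c : R) (x : \bar R) : fine (c%:E * x)%E = c * fine x.
Proof.
case: x => [x| |] //=; rewrite mulr0.
  by rewrite mulr_infty; case: sgrP => _; rewrite ?mul0e ?mul1e ?mulN1e.
by rewrite mulr_infty; case: sgrP => _; rewrite ?mul0e ?mul1e ?mulN1e.
Qed.

(** The integrand of [integral_zeta_sqr] as a real function, for a bounded Green
    function. *)
Definition square_green (u : E -> R) (y : E) : R :=
  u y * (u y + 2 * fine (taboo Pr X j (green Pr X j (EFin \o u)) y)).

Lemma zeta_sqr_square_green (u : E -> R) (C : R) :
  (forall y, 0 <= u y) -> (forall y, green Pr X j (EFin \o u) y <= C%:E)%E ->
  (\int[Pr j]_w (zeta X j u w ^+ 2) = green Pr X j (EFin \o square_green u) j)%E.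
Proof.
move=> u0 uC; rewrite (integral_zeta_sqr chain mX) //.
congr green; apply/funext => y /=; rewrite /square_green.
have T0 : (0 <= taboo Pr X j (green Pr X j (EFin \o u)) y)%E.
  by apply: taboo_ge0 => z; apply: green_ge0 => t; rewrite lee_fin.
have Tfin : taboo Pr X j (green Pr X j (EFin \o u)) y \is a fin_num.
  rewrite ge0_fin_numE // (@le_lt_trans _ _ C%:E) ?ltry // (le_trans _ (uC y)) //.
  by apply: (taboo_green_le chain) => t; rewrite lee_fin.
by rewrite -[in LHS](fineK Tfin) -EFinM.
Qed.

Variables (a b : E -> R) (C : R).
Hypothesis a0 : forall y, 0 <= a y.
Hypothesis b0 : forall y, 0 <= b y.
Let Ga := green Pr X j (EFin \o a).
Let Gb := green Pr X j (EFin \o b).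
Hypothesis GaC : forall y, (Ga y <= C%:E)%E.
Hypothesis GbC : forall y, (Gb y <= C%:E)%E.

Definition hat_fun y : R := fine (mask j Ga y) - fine (mask j Gb y).
Definition hat_drift y : R := fine (taboo Pr X j Ga y) - fine (taboo Pr X j Gb y).

Let fin_of (F : E -> \bar R) y : (0 <= F y)%E -> (F y <= C%:E)%E ->
  F y \is a fin_num /\ 0 <= fine (F y) <= C.
Proof.
move=> F0 FC; have Ffin : F y \is a fin_num.
  by rewrite ge0_fin_numE // (le_lt_trans FC) ?ltry.
by split=> //; rewrite fine_ge0 //= -lee_fin fineK.
Qed.

Let Ga0 y : (0 <= Ga y)%E. Proof. by apply: green_ge0 => t; rewrite lee_fin. Qed.
Let Gb0 y : (0 <= Gb y)%E. Proof. by apply: green_ge0 => t; rewrite lee_fin. Qed.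
Let C0 : 0 <= C. Proof. by rewrite -lee_fin; exact: le_trans (Ga0 j) (GaC j). Qed.

Let mask_le (F : E -> \bar R) y : (forall z, F z <= C%:E)%E -> (mask j F y <= C%:E)%E.
Proof. by move=> FC; rewrite /mask; case: eqP => // _; rewrite lee_fin. Qed.

Lemma hat_fun_bounded y : `|hat_fun y| <= C.
Proof.
have [_ /andP[h1 h2]] := fin_of (mask_ge0 j y Ga0) (mask_le y GaC).
have [_ /andP[h3 h4]] := fin_of (mask_ge0 j y Gb0) (mask_le y GbC).
by rewrite /hat_fun ler_norml; apply/andP; split; lra.
Qed.

Let tame_mask (x : E) (F : E -> \bar R) : (forall z, 0 <= F z)%E -> (forall z, F z <= C%:E)%E ->
  tame (fun w => fine (mask j F (X 1 w))).
Proof.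
move=> F0 FC.
have [mXx _] := (chain x).1.
apply: (@tame_adapted _ _ _ _ X 1 _ C) => //.
  exact: (@adapted_X _ _ _ _ _ 1%N (fun y => fine (mask j F y))).
move=> w; have [_ /andP[h1 h2]] := fin_of (mask_ge0 j (X 1 w) F0) (mask_le (X 1 w) FC).
by rewrite ger0_norm.
Qed.

Lemma hat_driftE x : \int[Pr x]_w hat_fun (X 1 w) = hat_drift x.
Proof.
rewrite /hat_fun meanB; [|exact: tame_mask|exact: tame_mask].
by rewrite /hat_drift (taboo_mean Pr X j x Ga0 GaC) (taboo_mean Pr X j x Gb0 GbC).
Qed.

Let S u := fine (\int[Pr j]_w (zeta X j u w ^+ 2))%E.

Let GabE y : green Pr X j (EFin \o (fun y => a y + b y)) y = (Ga y + Gb y)%E.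
Proof. by rewrite -(greenD chain) // => z; rewrite lee_fin. Qed.

Let taboo_le y (F : E -> \bar R) : (forall z, 0 <= F z)%E -> (forall z, F z <= C%:E)%E ->
  (taboo Pr X j F y <= C%:E)%E.
Proof. by move=> F0 FC; apply: (taboo_le_cst chain). Qed.

Let taboo_abE y :
  fine (taboo Pr X j (green Pr X j (EFin \o (fun y => a y + b y))) y) =
  fine (taboo Pr X j Ga y) + fine (taboo Pr X j Gb y).
Proof.
rewrite (eq_taboo _ _ _ _ GabE) (tabooD chain) // fineD //.
  by have [] := fin_of (taboo_ge0 Pr X j y Ga0) (taboo_le y Ga0 GaC).
by have [] := fin_of (taboo_ge0 Pr X j y Gb0) (taboo_le y Gb0 GbC).
Qed.

Let a_le y : 0 <= a y <= C.
Proof.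
rewrite a0 -lee_fin (le_trans _ (GaC y)) //.
by apply: (le_green_ge chain) => z; rewrite lee_fin.
Qed.

Let b_le y : 0 <= b y <= C.
Proof.
rewrite b0 -lee_fin (le_trans _ (GbC y)) //.
by apply: (le_green_ge chain) => z; rewrite lee_fin.
Qed.

Let ta y : 0 <= fine (taboo Pr X j Ga y) <= C.
Proof. by have [] := fin_of (taboo_ge0 Pr X j y Ga0) (taboo_le y Ga0 GaC). Qed.

Let tb y : 0 <= fine (taboo Pr X j Gb y) <= C.
Proof. by have [] := fin_of (taboo_ge0 Pr X j y Gb0) (taboo_le y Gb0 GbC). Qed.

Let mean_sq u (D : R) : (forall y, 0 <= u y) ->
  (forall y, green Pr X j (EFin \o u) y <= D%:E)%E ->
  mean (fun w => square_green u (X 0 w)) = m^-1 * S u.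
Proof.
move=> u0 uD; rewrite /Rintegral (stat 0 (f := EFin \o square_green u)); last first.
  move=> y; rewrite lee_fin mulr_ge0 // addr_ge0 // mulr_ge0 // fine_ge0 //.
  by apply: taboo_ge0 => z; apply: green_ge0 => t; rewrite lee_fin.
by rewrite fineZ /S (zeta_sqr_square_green u0 uD).
Qed.

Let v y := fine (Ga y) - fine (Gb y).

Let mean_comb (F1 F2 F3 : T -> R) : tame F1 -> tame F2 -> tame F3 ->
  mean (fun w => 2 * F1 w + 2 * F2 w - F3 w) = 2 * mean F1 + 2 * mean F2 - mean F3.
Proof.
move=> t1 t2 t3; have t21 := tameZ 2 t1; have t22 := tameZ 2 t2.
rewrite meanB //; last exact: tameD.
by rewrite meanD // !meanZ.
Qed.

Let mean_base : mean (fun w => (X 0 w == j)%:R) = m^-1.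
Proof.
have ind0 y : (0 <= (if y == j then 1 else 0 : \bar R))%E by case: eqP.
have := stat 0 ind0; rewrite green_base mule1 => e.
rewrite /Rintegral -[RHS]/(fine (m^-1)%:E) -e.
by congr fine; apply: eq_integral => w _; case: eqP.
Qed.

(** Off [j] the square of [hat_fun] is that of [v], the difference of the two
    Green functions, and [v - hat_drift = a - b] everywhere; hence the energy is
    the mean of [(a - b) * (a - b + 2 * hat_drift)], up to the value at [j]. *)
Lemma bounded_energy :
  energy X Q hat_fun hat_drift =
  m^-1 * (2 * S a + 2 * S b - S (fun y => a y + b y) - v j ^+ 2).
Proof.
have vB y : `|v y| <= C.
  have [_ /andP[h1 h2]] := fin_of (Ga0 y) (GaC y).
  have [_ /andP[h3 h4]] := fin_of (Gb0 y) (GbC y).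
  by rewrite /v ler_norml; apply/andP; split; lra.
have dB y : `|hat_drift y| <= C.
  have /andP[h1 h2] := ta y; have /andP[h3 h4] := tb y.
  by rewrite /hat_drift; move: (fine _) (fine _) h1 h2 h3 h4 => r1 r2 *; rewrite ler_norml; apply/andP; split; lra.
have tf := tame_comp_X chainQ 0 hat_fun_bounded.
have td := tame_comp_X chainQ 0 dB.
have tv := tame_comp_X chainQ 0 vB.
have tj : tame (fun w => (X 0 w == j)%:R : R).
  apply: (tame_comp_X chainQ 0 (h := fun y => (y == j)%:R) (C := 1)) => y.
  by case: eqP; rewrite ?normr1 ?normr0.
have sqB u : (forall y, 0 <= u y <= 2 * C) ->
    (forall y, 0 <= fine (taboo Pr X j (green Pr X j (EFin \o u)) y) <= 2 * C) ->
    tame (fun w => square_green u (X 0 w)).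
  move=> uC tC; apply: (tame_comp_X chainQ 0 (C := 2 * C * (2 * C + 2 * (2 * C)))) => y.
  have /andP[h1 h2] := uC y; have /andP[h3 h4] := tC y.
  rewrite /square_green ger0_norm; last by rewrite mulr_ge0 // addr_ge0 // mulr_ge0.
  by apply: ler_pM => //; lra.
have dbl (r : R) : 0 <= r <= C -> 0 <= r <= 2 * C.
  by move=> /andP[h1 h2]; apply/andP; split=> //; lra.
have ts_a : tame (fun w => square_green a (X 0 w)).
  by apply: sqB => y; apply: dbl; [exact: a_le|exact: ta].
have ts_b : tame (fun w => square_green b (X 0 w)).
  by apply: sqB => y; apply: dbl; [exact: b_le|exact: tb].
have ts_ab : tame (fun w => square_green (fun y => a y + b y) (X 0 w)).
  apply: sqB => y.
    by have /andP[h1 h2] := a_le y; have /andP[h3 h4] := b_le y; apply/andP; split; lra.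
  rewrite taboo_abE; have /andP[h1 h2] := ta y; have /andP[h3 h4] := tb y.
  by apply/andP; split; lra.
have Ma := mean_sq a0 GaC.
have Mb := mean_sq b0 GbC.
have Mab : mean (fun w => square_green (fun y => a y + b y) (X 0 w)) =
    m^-1 * S (fun y => a y + b y).
  apply: (@mean_sq _ (C + C)) => y; first exact: addr_ge0.
  by rewrite GabE EFinD leeD.
have f2 : mean (fun w => hat_fun (X 0 w) ^+ 2) =
    mean (fun w => v (X 0 w) ^+ 2) - v j ^+ 2 * m^-1.
  rewrite -mean_base -meanZ // -meanB; [|exact: tameX|exact: tameZ].
  apply: eq_mean => w; rewrite /hat_fun /mask /v.
  by case: eqP => [->|_] /=; rewrite ?mulr0 ?subr0 // mulr1 subrr expr0n.
have vd y : v y - hat_drift y = a y - b y.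
  have eq1 (u : E -> R) : (forall z, 0 <= u z) ->
      (forall z, green Pr X j (EFin \o u) z <= C%:E)%E ->
      fine (green Pr X j (EFin \o u) y) = u y + fine (taboo Pr X j (green Pr X j (EFin \o u)) y).
    move=> u0 uC; rewrite [in LHS](greenE chain); last by move=> z; rewrite lee_fin.
    rewrite fineD //.
    have gu0 z : (0 <= green Pr X j (EFin \o u) z)%E.
      by apply: green_ge0 => t; rewrite lee_fin.
    by have [] := fin_of (taboo_ge0 Pr X j y gu0) (taboo_le y gu0 uC).
  rewrite /v /hat_drift /Ga /Gb (eq1 _ a0 GaC) (eq1 _ b0 GbC) -/Ga -/Gb; ring.
rewrite /energy f2.
have -> : mean (fun w => v (X 0 w) ^+ 2) - v j ^+ 2 * m^-1 - mean (fun w => hat_drift (X 0 w) ^+ 2) =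
    mean (fun w => v (X 0 w) ^+ 2 - hat_drift (X 0 w) ^+ 2) - v j ^+ 2 * m^-1.
  by rewrite meanB; [ring|exact: tameX|exact: tameX].
have -> : mean (fun w => v (X 0 w) ^+ 2 - hat_drift (X 0 w) ^+ 2) =
    2 * mean (fun w => square_green a (X 0 w)) + 2 * mean (fun w => square_green b (X 0 w))
    - mean (fun w => square_green (fun y => a y + b y) (X 0 w)).
  rewrite -(mean_comb ts_a ts_b ts_ab); apply: eq_mean => w.
  move: (X 0 w) => y; rewrite /square_green taboo_abE.
  have := vd y; rewrite /hat_drift -/Ga -/Gb.
  move: (v y) (fine (taboo Pr X j Ga y)) (fine (taboo Pr X j Gb y)) => r s t e.
  have -> : r = a y - b y + (s - t) by rewrite -e; ring.
  ring.
rewrite Ma Mb Mab; move: (S a) (S b) (S _) (v j) (m^-1) => s1 s2 s3 s4 s5; ring.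
Qed.

End bounded_energy.

(** * Cutting a function at the level sets of the Green function *)

Section level_sets.
Context {R : realType} {d : measure_display} {T : measurableType d}
  {E : countType} (p : E -> E -> R) (Pr : E -> probability T R)
  (X : nat -> T -> E) (j : E) (Q : probability T R) (m : R).
Hypothesis chain : forall x, markov_chain_from p (Pr x) X x.
Hypothesis chainQ : markov_chain p Q X.
Hypothesis m0 : 0 < m.
Hypothesis stat : forall k (f : E -> \bar R), (forall y, 0 <= f y)%E ->
  (\int[Q]_w f (X k w) = (m^-1)%:E * green Pr X j f j)%E.
Variable W : E -> R.
Hypothesis W1 : forall y, 1 <= W y.
Hypothesis W_sqr : (\int[Pr j]_w (zeta X j W w ^+ 2) < +oo)%E.

Let mX : forall k x, measurable [set w | X k w = x]. Proof. by case: chainQ. Qed.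
Let W0 y : 0 <= W y. Proof. exact: le_trans (W1 y). Qed.

(** The Green function of the weight [W], which dominates those of all functions
    below [W]. *)
Definition level : E -> \bar R := green Pr X j (EFin \o W).

Local Open Scope ereal_scope.

Lemma level_ge0 y : 0 <= level y.
Proof. by apply: green_ge0 => t; rewrite lee_fin. Qed.

Let WA0 y : 0 <= (W y)%:E * level y.
Proof. by rewrite mule_ge0 ?lee_fin // level_ge0. Qed.

Let green_WA : green Pr X j (fun y => (W y)%:E * level y) j < +oo.
Proof.
apply: le_lt_trans W_sqr; rewrite (integral_zeta_sqr chain mX) //.
apply: (le_green chain) => // y; apply: lee_wpmul2l; first by rewrite lee_fin.
have T0 : 0 <= taboo Pr X j level y by apply: taboo_ge0; exact: level_ge0.
rewrite {1}/level (greenE chain); last by move=> t; rewrite lee_fin.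
rewrite leeD2l // -[leLHS]mul1e; apply: lee_wpmul2r => //.
by rewrite lee_fin ler1n.
Qed.

Lemma level_fin : {ae Q, forall w, forall k, level (X k w) < +oo}.
Proof.
apply/ae_foralln => k.
have : Q.-integrable setT (fun w => level (X k w)).
  apply/integrableP; split; first exact: (@measurable_comp_X _ _ _ _ mX _ _ k level).
  under eq_integral do rewrite gee0_abs ?level_ge0 //.
  rewrite (stat k (f := level)); last exact: level_ge0.
  apply: lte_mul_pinfty => //; first by rewrite lee_fin invr_ge0 ltW.
  apply: le_lt_trans green_WA; apply: (le_green chain); first exact: level_ge0.
  by move=> y; rewrite -[leLHS]mul1e; apply: lee_wpmul2r; rewrite ?level_ge0 ?lee_fin.
move=> /(integrable_ae measurableT); apply: filterS => w /(_ I).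
by rewrite ge0_fin_numE // level_ge0.
Qed.

(** Restricting [u] to a level set makes its Green function bounded, by the maximum
    principle ([green_cut_le]); this is why the cut is made on the values of
    [level] and not on those of [u]. *)
Definition cut (N : nat) (u : E -> R) (y : E) : R :=
  if level y <= N%:R%:E then u y else 0%R.

Definition tail (N : nat) (u : E -> R) (y : E) : R :=
  if level y <= N%:R%:E then 0%R else u y.

Lemma cutDtail N u y : u y = (cut N u y + tail N u y)%R.
Proof. by rewrite /cut /tail; case: ifP; rewrite ?addr0 ?add0r. Qed.

Lemma cut_ge0 N u : (forall y, 0 <= u y)%R -> forall y, (0 <= cut N u y)%R.
Proof. by move=> u0 y; rewrite /cut; case: ifP. Qed.

Lemma tail_ge0 N u : (forall y, 0 <= u y)%R -> forall y, (0 <= tail N u y)%R.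
Proof. by move=> u0 y; rewrite /tail; case: ifP. Qed.

Lemma tail_le N u v : (forall y, u y <= v y)%R -> forall y, (tail N u y <= tail N v y)%R.
Proof. by move=> uv y; rewrite /tail; case: ifP. Qed.

Lemma green_cut_le N u : (forall y, 0 <= u y <= W y)%R ->
  forall y, green Pr X j (EFin \o cut N u) y <= N%:R%:E.
Proof.
move=> uW y; have u0 z : (0 <= u z)%R by case/andP: (uW z).
apply: (green_max chain (A := [set z | level z <= N%:R%:E])) => //.
- by move=> z; rewrite lee_fin cut_ge0.
- by move=> z /= /negP/negbTE h; rewrite /cut h.
move=> z /= zN; apply: le_trans zN; apply: (le_green chain) => t.
  by rewrite lee_fin cut_ge0.
rewrite lee_fin /cut; case: ifP => // _; by case/andP: (uW t).
Qed.

(** This quantity controls the second moments of everything built from the tails. It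
    tends to zero because [W * level] is integrable for the stationary law, which
    is equivalent to the square integrability of the cycle sum of [W]. *)
Definition tail_mass N : \bar R :=
  \int[Q]_w ((tail N W (X 0 w))%:E * level (X 0 w)).

Lemma tail_massE N :
  green Pr X j (fun y => (tail N W y)%:E * level y) j = m%:E * tail_mass N.
Proof.
rewrite /tail_mass (stat 0 (f := fun y => (tail N W y)%:E * level y)); last first.
  by move=> y; rewrite mule_ge0 ?level_ge0 // lee_fin tail_ge0.
by rewrite muleA -EFinM divff ?mul1e // gt_eqF.
Qed.

Lemma tail_mass_cvg : tail_mass N @[N --> \oo] --> 0.
Proof.
have mg (f : E -> \bar R) : measurable_fun setT (fun w => f (X 0 w)).
  exact: (@measurable_comp_X _ _ _ _ mX _ _ 0 f).
have ig : Q.-integrable setT (fun w => (W (X 0 w))%:E * level (X 0 w)).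
  apply/integrableP; split; first exact: (mg (fun y => (W y)%:E * level y)).
  under eq_integral do rewrite gee0_abs ?WA0 //.
  rewrite (stat 0 (f := fun y => (W y)%:E * level y)) //.
  by apply: lte_mul_pinfty => //; rewrite lee_fin invr_ge0 ltW.
have [] := @dominated_convergence _ _ _ Q setT measurableT
  (fun N w => (tail N W (X 0 w))%:E * level (X 0 w)) (cst 0)
  (fun w => (W (X 0 w))%:E * level (X 0 w)).
- by move=> N; exact: (mg (fun y => (tail N W y)%:E * level y)).
- exact: measurable_cst.
- apply: filterS level_fin => w /(_ 0%N) Lw _.
  have Lfin : level (X 0 w) \is a fin_num by rewrite ge0_fin_numE // level_ge0.
  apply: cvg_near_cst; near=> N; rewrite /tail ifT ?mul0e //.
  rewrite -(fineK Lfin) lee_fin; near: N; exact: nbhs_infty_ger.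
- exact: ig.
- apply: aeW => w N _; rewrite gee0_abs; last first.
    by rewrite mule_ge0 ?level_ge0 // lee_fin tail_ge0.
  apply: lee_wpmul2r; first exact: level_ge0.
  by rewrite lee_fin /tail; case: ifP.
by move=> _ _; rewrite integral0.
Unshelve. all: by end_near. Qed.

Lemma tail_mass_fin N : tail_mass N \is a fin_num.
Proof.
rewrite ge0_fin_numE; last first.
  by apply: integral_ge0 => w _; rewrite mule_ge0 ?level_ge0 // lee_fin tail_ge0.
rewrite /tail_mass (stat 0 (f := fun y => (tail N W y)%:E * level y)); last first.
  by move=> y; rewrite mule_ge0 ?level_ge0 // lee_fin tail_ge0.
apply: lte_mul_pinfty => //; first by rewrite lee_fin invr_ge0 ltW.
apply: le_lt_trans green_WA; apply: (le_green chain) => y.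
  by rewrite mule_ge0 ?level_ge0 // lee_fin tail_ge0.
apply: lee_wpmul2r; first exact: level_ge0.
by rewrite lee_fin /tail; case: ifP.
Qed.

Lemma green_tail_le N u : (forall y, 0 <= u y <= W y)%R -> forall y,
  (tail N u y)%:E * green Pr X j (EFin \o tail N u) y <= (tail N W y)%:E * level y.
Proof.
move=> uW y; have u0 z : (0 <= u z)%R by case/andP: (uW z).
have uleW z : (u z <= W z)%R by case/andP: (uW z).
apply: lee_pmul; rewrite ?lee_fin.
- exact: tail_ge0.
- by apply: green_ge0 => z; rewrite lee_fin tail_ge0.
- exact: tail_le.
- apply: (le_green chain) => z; rewrite lee_fin; first exact: tail_ge0.
  by apply: le_trans (uleW z); rewrite /tail; case: ifP.
Qed.

Lemma zeta_tail_sqr_le N :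
  \int[Pr j]_w (zeta X j (tail N W) w ^+ 2) <= 2%:E * (m%:E * tail_mass N).
Proof.
have tW0 := tail_ge0 N W0.
have G0 y : 0 <= green Pr X j (EFin \o tail N W) y.
  by apply: green_ge0 => z; rewrite lee_fin.
rewrite (integral_zeta_sqr chain mX) // -tail_massE -(greenZ chain) //; last first.
  by move=> y; rewrite mule_ge0 ?level_ge0 // lee_fin.
apply: (le_green chain) => y.
  rewrite mule_ge0 ?lee_fin // adde_ge0 ?lee_fin // mule_ge0 ?lee_fin //.
  exact: taboo_ge0.
have := @green_tail_le N W (fun z => introT andP (conj (W0 z) (lexx _))) y.
move=> h; apply: le_trans (lee_wpmul2l _ h); last by rewrite lee_fin.
rewrite muleCA; apply: lee_wpmul2l; first by rewrite lee_fin.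
have T0 : 0 <= taboo Pr X j (green Pr X j (EFin \o tail N W)) y by exact: taboo_ge0.
rewrite [X in _ <= 2%:E * X](greenE chain); last by move=> z; rewrite lee_fin.
rewrite [leRHS](ge0_muleDr _ _ T0); last by rewrite lee_fin.
apply: leeD2r.
by rewrite -EFinM lee_fin ler_peMl // ler1n.
Qed.

End level_sets.

(** * Square integrable functions *)

Section second_moments_on_probability.
Context {R : realType} {d : measure_display} {T : measurableType d}.
Variable Q : probability T R.
Implicit Types F G : T -> R.

Definition square_integrable F : Prop :=
  measurable_fun setT F /\ Q.-integrable setT (EFin \o (fun w => F w ^+ 2)).

Local Notation mean F := (\int[Q]_w F w).

Lemma le_integrableR F G : measurable_fun setT F ->
  Q.-integrable setT (EFin \o G) -> (forall w, `|F w| <= G w) ->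
  Q.-integrable setT (EFin \o F).
Proof.
move=> mF iG FG; apply: le_integrable iG => //; first exact/measurable_EFinP.
move=> w _ /=; rewrite lee_fin; apply: le_trans (FG w) (ler_norm _).
Qed.

Lemma integrableDR F G : Q.-integrable setT (EFin \o F) ->
  Q.-integrable setT (EFin \o G) -> Q.-integrable setT (EFin \o (fun w => F w + G w)).
Proof.
by move=> iF iG; apply: eq_integrable (integrableD measurableT iF iG).
Qed.

Lemma integrableZR (c : R) F : Q.-integrable setT (EFin \o F) ->
  Q.-integrable setT (EFin \o (fun w => c * F w)).
Proof.
by move=> iF; apply: eq_integrable (integrableZl measurableT c iF).
Qed.

Lemma square_integrable_integrableM F G : square_integrable F -> square_integrable G ->
  Q.-integrable setT (EFin \o (fun w => F w * G w)).
Proof.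
move=> [mF iF] [mG iG].
apply: (le_integrableR _ (integrableDR iF iG)); first exact: measurable_funM.
move=> w; rewrite normrM -[F w ^+ 2]real_normK ?num_real // -[G w ^+ 2]real_normK ?num_real //.
by move: `|F w| `|G w| (normr_ge0 (F w)) (normr_ge0 (G w)) => x y x0 y0; nra.
Qed.

Lemma square_integrable_cst (c : R) : square_integrable (cst c).
Proof.
by split=> //; apply: (tame_integrable Q); exact/tameX/tame_cst.
Qed.

Lemma square_integrable_integrable F : square_integrable F -> Q.-integrable setT (EFin \o F).
Proof.
move=> sF; have := square_integrable_integrableM sF (square_integrable_cst 1).
by apply: eq_integrable => // w _; rewrite /= mulr1.
Qed.

Lemma square_integrableD F G : square_integrable F -> square_integrable G ->
  square_integrable (fun w => F w + G w).
Proof.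
move=> sF sG; have iFG := square_integrable_integrableM sF sG.
have [mF iF] := sF; have [mG iG] := sG; split; first exact: measurable_funD.
have h := integrableDR (integrableDR iF iG) (integrableZR 2 iFG).
by apply: eq_integrable h => // w _ /=; congr (_%:E); ring.
Qed.

Lemma square_integrableZ (c : R) F : square_integrable F -> square_integrable (fun w => c * F w).
Proof.
move=> [mF iF]; split; first exact: measurable_funM.
by apply: eq_integrable (integrableZR (c ^+ 2) iF) => // w _ /=; rewrite exprMn.
Qed.

Lemma square_integrableB F G : square_integrable F -> square_integrable G ->
  square_integrable (fun w => F w - G w).
Proof.
move=> sF sG; have := square_integrableD sF (square_integrableZ (-1) sG).
by under [X in square_integrable X -> _]funext do rewrite mulN1r.
Qed.

Lemma sqr_mean_le F : square_integrable F -> (mean F) ^+ 2 <= mean (fun w => F w ^+ 2).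
Proof.
move=> sF; have iF := square_integrable_integrable sF; have [mF iF2] := sF.
set a := mean F; have sFa := square_integrableB sF (square_integrable_cst a).
have : 0 <= mean (fun w => (F w - a) ^+ 2) by apply: Rintegral_ge0 => w _; exact: sqr_ge0.
have -> : mean (fun w => (F w - a) ^+ 2) =
    mean (fun w => (F w ^+ 2 + (- (2 * a)) * F w) + a ^+ 2).
  by apply: eq_Rintegral => w _; ring.
have icst : Q.-integrable setT (EFin \o cst (a ^+ 2)) by exact/tame_integrable/tame_cst.
rewrite RintegralD //; last exact/integrableDR/integrableZR.
rewrite RintegralD //; last exact: integrableZR.
rewrite RintegralZl // (mean_cst Q (a ^+ 2)) -/a => h; rewrite -subr_ge0.
by apply: le_trans h _; rewrite le_eqVlt; apply/orP; left; apply/eqP; ring.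
Qed.

(** The square mean of a sum, with an arbitrarily small loss on one term. *)
Lemma mean_sqrD_le (eta : R) F G : 0 < eta -> square_integrable F -> square_integrable G ->
  mean (fun w => (F w + G w) ^+ 2) <=
  (1 + eta) * mean (fun w => F w ^+ 2) + (1 + eta^-1) * mean (fun w => G w ^+ 2).
Proof.
move=> e0 sF sG; have [mF iF] := sF; have [mG iG] := sG.
have [_ iFG] := square_integrableD sF sG.
rewrite -(RintegralZl (1 + eta) measurableT iF) -(RintegralZl (1 + eta^-1) measurableT iG).
rewrite -RintegralD //; [|exact: integrableZR|exact: integrableZR].
apply: le_Rintegral => //; first by apply: integrableDR; exact: integrableZR.
move=> w _; rewrite -subr_ge0.
have -> : (1 + eta) * F w ^+ 2 + (1 + eta^-1) * G w ^+ 2 - (F w + G w) ^+ 2 =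
   eta^-1 * (eta * F w - G w) ^+ 2 by field; rewrite gt_eqF.
by rewrite mulr_ge0 ?sqr_ge0 // invr_ge0 ltW.
Qed.

Lemma ae_eq_mean F G : measurable_fun setT F -> measurable_fun setT G ->
  {ae Q, forall w, F w = G w} -> mean F = mean G.
Proof.
move=> mF mG FG; rewrite /Rintegral; congr fine; apply: ae_eq_integral => //.
- exact/measurable_EFinP.
- exact/measurable_EFinP.
by apply: filterS FG => w -> _.
Qed.

End second_moments_on_probability.

(** * The martingale approximation and the limit variance *)

Section martingale_approximation.
Local Opaque green taboo step.
Context {R : realType} {d : measure_display} {T : measurableType d}
  {E : countType} (p : E -> E -> R) (Pr : E -> probability T R)
  (X : nat -> T -> E) (j : E) (Q : probability T R) (m : R).
Hypothesis chain : forall x, markov_chain_from p (Pr x) X x.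
Hypothesis chainQ : markov_chain p Q X.
Hypothesis m0 : 0 < m.
Hypothesis stat : forall k (f : E -> \bar R), (forall y, 0 <= f y)%E ->
  (\int[Q]_w f (X k w) = (m^-1)%:E * green Pr X j f j)%E.

Variable H : E -> R.
Let W y := 1 + `|H y|.
Hypothesis W_sqr : (\int[Pr j]_w (zeta X j W w ^+ 2) < +oo)%E.

Local Notation mean F := (\int[Q]_w F w).
Let mX : forall k x, measurable [set w | X k w = x]. Proof. by case: chainQ. Qed.
Let W1 y : 1 <= W y. Proof. by rewrite /W lerDl. Qed.
Let W0 y : 0 <= W y. Proof. exact: le_trans (W1 y). Qed.

Definition posp (y : E) : R := Num.max (H y) 0.
Definition negp (y : E) : R := Num.max (- H y) 0.

Lemma posp_ge0 y : 0 <= posp y. Proof. by rewrite le_max lexx orbT. Qed.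
Lemma negp_ge0 y : 0 <= negp y. Proof. by rewrite le_max lexx orbT. Qed.

Lemma pospBnegp y : H y = posp y - negp y.
Proof.
rewrite /posp /negp; case: (leP (H y) 0) => h.
  by rewrite max_l ?oppr_ge0 // sub0r opprK.
by rewrite max_r ?subr0 // oppr_le0 ltW.
Qed.

Lemma pospDnegp y : posp y + negp y = `|H y|.
Proof.
rewrite /posp /negp; have [h|h] := lerP 0 (H y); rewrite !maxEle.
  by rewrite oppr_le0 h addr0 ger0_norm.
by rewrite oppr_le0 leNgt h /= add0r ltr0_norm.
Qed.

Let pospW y : 0 <= posp y <= W y.
Proof.
rewrite posp_ge0 /= ge_max W0 andbT (le_trans (ler_norm _)) // /W lerDr //.
Qed.

Let negpW y : 0 <= negp y <= W y.
Proof.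
by rewrite negp_ge0 /= ge_max W0 andbT (le_trans (ler_norm _)) // normrN /W lerDr.
Qed.

Local Notation A := (level Pr X j W).
Local Notation grn u := (green Pr X j (EFin \o u)).

Let lfin : {ae Q, forall w, forall k, (A (X k w) < +oo)%E}.
Proof. exact: (level_fin chain chainQ m0 stat W1 W_sqr). Qed.

Let grn_ge0 (u : E -> R) y : (forall z, 0 <= u z) -> (0 <= grn u y)%E.
Proof. by move=> u0; apply: green_ge0 => z; rewrite lee_fin. Qed.

Let grn_le (u : E -> R) y : (forall z, 0 <= u z <= W z) -> (grn u y <= A y)%E.
Proof.
move=> uW; apply: (le_green chain) => z; rewrite lee_fin; by case/andP: (uW z).
Qed.

Let tail_uW N (u : E -> R) : (forall z, 0 <= u z <= W z) ->
  forall z, 0 <= tail Pr X j W N u z <= W z.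
Proof. by move=> uW z; rewrite /tail; case: ifP => // _; rewrite lexx W0. Qed.

Let cut_uW N (u : E -> R) : (forall z, 0 <= u z <= W z) ->
  forall z, 0 <= cut Pr X j W N u z <= W z.
Proof. by move=> uW z; rewrite /cut; case: ifP => // _; rewrite lexx W0. Qed.

Lemma hat_mart_tail N (u : E -> R) n : (forall z, 0 <= u z <= W z) ->
  (\int[Q]_w (hat_mart Pr X j (tail Pr X j W N u) n w ^+ 2)%:E <=
   n%:R%:E * (2%:E * tail_mass Pr X j Q W N))%E.
Proof.
move=> uW; have tu := tail_uW N uW.
have tu0 z : 0 <= tail Pr X j W N u z by case/andP: (tu z).
apply: (le_trans (hat_mart_sqr_le chain chainQ stat tu0 _ n)).
  apply: filterS lfin => w Lw k; apply: le_lt_trans (Lw k); exact: grn_le.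
do 2 (apply: lee_wpmul2l; first by rewrite lee_fin).
have -> : tail_mass Pr X j Q W N = ((m^-1)%:E * (m%:E * tail_mass Pr X j Q W N))%E.
  by rewrite muleA -EFinM mulVf ?mul1e // gt_eqF.
rewrite -(tail_massE m0 stat W1); apply: lee_wpmul2l.
  by rewrite lee_fin invr_ge0 ltW.
apply: (le_green chain) => y; last exact: green_tail_le.
by rewrite mule_ge0 ?lee_fin // grn_ge0.
Qed.

Let f N := hat_fun Pr X j (cut Pr X j W N posp) (cut Pr X j W N negp).
Let g N := hat_drift Pr X j (cut Pr X j W N posp) (cut Pr X j W N negp).

(** The part of the solution of the Poisson equation that telescopes. *)
Definition drift y : R :=
  fine (taboo Pr X j (grn posp) y) - fine (taboo Pr X j (grn negp) y).

Hypothesis mean_zero : grn posp j = grn negp j.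

Let tgrn_le (u : E -> R) y : (forall z, 0 <= u z <= W z) ->
  (taboo Pr X j (grn u) y <= grn u y)%E.
Proof.
by move=> uW; apply: (taboo_green_le chain) => z; rewrite lee_fin; case/andP: (uW z).
Qed.

Let fin_grn (u : E -> R) y : (A y < +oo)%E -> (forall z, 0 <= u z <= W z) ->
  grn u y \is a fin_num /\ taboo Pr X j (grn u) y \is a fin_num.
Proof.
move=> Ay uW; have u0 z : 0 <= u z by case/andP: (uW z).
have h : (grn u y < +oo)%E by apply: le_lt_trans Ay; exact: grn_le.
split; first by rewrite ge0_fin_numE ?grn_ge0.
rewrite ge0_fin_numE; first by apply: le_lt_trans h; exact: tgrn_le.
by apply: taboo_ge0 => z; exact: grn_ge0.
Qed.

Let split_grn N (u : E -> R) y : (forall z, 0 <= u z <= W z) ->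
  grn u y = (grn (cut Pr X j W N u) y + grn (tail Pr X j W N u) y)%E.
Proof.
move=> uW.
rewrite -(greenD chain); last 2 first.
- by move=> z; rewrite lee_fin; case/andP: (cut_uW N uW z).
- by move=> z; rewrite lee_fin; case/andP: (tail_uW N uW z).
by congr green; apply/funext => z /=; rewrite -EFinD -cutDtail.
Qed.

Let split_tgrn N (u : E -> R) y : (forall z, 0 <= u z <= W z) ->
  taboo Pr X j (grn u) y = (taboo Pr X j (grn (cut Pr X j W N u)) y +
    taboo Pr X j (grn (tail Pr X j W N u)) y)%E.
Proof.
move=> uW; rewrite -(tabooD chain); last 2 first.
- by move=> z; apply: grn_ge0 => t; case/andP: (cut_uW N uW t).
- by move=> z; apply: grn_ge0 => t; case/andP: (tail_uW N uW t).
by apply: eq_taboo => z; exact: split_grn.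
Qed.

Local Opaque cut tail level posp negp.

Let regroup (a b a' b' r s : R) : r = a + b -> s = a' + b' ->
  r - s = a - a' + b - b'.
Proof. by move=> -> ->; ring. Qed.

(** Where the level function is finite, [H] is the difference [v] of the Green
    functions of its positive and negative parts minus [drift]. As [v] vanishes at
    [j] by the centering, it may be set to zero there, and it is then split along
    the cut at [N]. *)
Let poisson_split N y : (A y < +oo)%E ->
  H y = f N y + fine (mask j (grn (tail Pr X j W N posp)) y)
    - fine (mask j (grn (tail Pr X j W N negp)) y) - drift y.
Proof.
move=> Ay.
have [p1 p2] := fin_grn Ay pospW; have [n1 n2] := fin_grn Ay negpW.
have vE : fine (grn posp y) - fine (grn negp y) - drift y = H y.
  rewrite /drift [grn posp y](greenE chain); last by move=> z; rewrite lee_fin posp_ge0.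
  rewrite [grn negp y](greenE chain); last by move=> z; rewrite lee_fin negp_ge0.
  rewrite (fineD (_ : (EFin \o posp) y \is a fin_num) p2) //.
  rewrite (fineD (_ : (EFin \o negp) y \is a fin_num) n2) //.
  rewrite [RHS]pospBnegp /=; ring.
rewrite -vE; congr (_ - _).
have [cp _] := fin_grn Ay (cut_uW N pospW); have [cn _] := fin_grn Ay (cut_uW N negpW).
have [tp _] := fin_grn Ay (tail_uW N pospW); have [tn _] := fin_grn Ay (tail_uW N negpW).
rewrite /f /hat_fun /mask; case: eqP => [->|_].
  by rewrite mean_zero /=; ring.
by apply: regroup; [rewrite -(fineD cp tp)|rewrite -(fineD cn tn)];
  congr fine; exact: split_grn.
Qed.

Let driftE N y : (A y < +oo)%E ->
  drift y = g N y + fine (taboo Pr X j (grn (tail Pr X j W N posp)) y)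
    - fine (taboo Pr X j (grn (tail Pr X j W N negp)) y).
Proof.
move=> Ay.
have [_ cp] := fin_grn Ay (cut_uW N pospW); have [_ cn] := fin_grn Ay (cut_uW N negpW).
have [_ tp] := fin_grn Ay (tail_uW N pospW); have [_ tn] := fin_grn Ay (tail_uW N negpW).
by apply: regroup; [rewrite -(fineD cp tp)|rewrite -(fineD cn tn)];
  congr fine; exact: split_tgrn.
Qed.

Let telescope_step (h f1 p1 n1 d1 d0 g0 p0 n0 : R) :
  h = f1 + p1 - n1 - d1 -> d0 = g0 + p0 - n0 ->
  h = f1 - g0 + (p1 - p0) - (n1 - n0) + (d0 - d1).
Proof. by move=> -> ->; ring. Qed.

Definition partial_sum n w : R := \sum_(1 <= k < n.+1) H (X k w).

(** The Poisson equation at the consecutive states of the chain, summed up. The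
    coboundary of [drift] is negligible after division by the square root of time
    although [drift] need not be square integrable, since only truncated second
    moments are considered. *)
Lemma martingale_decomposition N n w : (forall k, (A (X k w) < +oo)%E) ->
  partial_sum n w = mart X (f N) (g N) n w
    + hat_mart Pr X j (tail Pr X j W N posp) n w
    - hat_mart Pr X j (tail Pr X j W N negp) n w + (drift (X 0 w) - drift (X n w)).
Proof.
move=> Aw; rewrite /partial_sum big_add1 /= big_mkord.
have -> : drift (X 0 w) - drift (X n w) =
    \sum_(k < n) (drift (X k w) - drift (X k.+1 w)).
  elim: n => [|n IH]; first by rewrite big_ord0 subrr.
  by rewrite big_ord_recr /= -IH; ring.
rewrite /mart /hat_mart -big_split /= -sumrB -big_split /=.
apply: eq_bigr => k _.
exact: telescope_step (poisson_split N (Aw k.+1)) (driftE N (Aw k)).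
Qed.

Let cutp_le N y : (grn (cut Pr X j W N posp) y <= (N%:R)%:E)%E.
Proof. exact: green_cut_le. Qed.

Let cutn_le N y : (grn (cut Pr X j W N negp) y <= (N%:R)%:E)%E.
Proof. exact: green_cut_le. Qed.

Let cutp_ge0 N y : 0 <= cut Pr X j W N posp y.
Proof. by case/andP: (cut_uW N pospW y). Qed.

Let cutn_ge0 N y : 0 <= cut Pr X j W N negp y.
Proof. by case/andP: (cut_uW N negpW y). Qed.

Let fB N y : `|f N y| <= N%:R.
Proof. exact: hat_fun_bounded. Qed.

Let gE N x : \int[Pr x]_w f N (X 1 w) = g N x.
Proof. exact: (hat_driftE chain (C := N%:R)). Qed.

Let statR k (h : E -> R) (C : R) : (forall x, `|h x| <= C) ->
  mean (fun w => h (X k w)) = mean (fun w => h (X 0 w)).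
Proof. exact: (stationary_mean chainQ stat). Qed.

Definition scaled n w : R := (Num.sqrt n%:R)^-1 * partial_sum n w.
Let appr N n w : R := (Num.sqrt n%:R)^-1 * mart X (f N) (g N) n w.
Let rest N n w : R := scaled n w - appr N n w.

Let sqrtV n : (0 < n)%N -> ((Num.sqrt n%:R)^-1 : R) ^+ 2 = n%:R^-1.
Proof. by move=> n0; rewrite exprVn sqr_sqrtr. Qed.

Let tame_appr N n : tame (appr N n).
Proof. by apply: tameZ; exact: (tame_mart chainQ (fB N) (gE N)). Qed.

(** The limit variance of the part of [H] that is cut at level [N]. *)
Definition bounded_variance N : R := energy X Q (f N) (g N).

Let mean_appr2 N n : (0 < n)%N -> mean (fun w => appr N n w ^+ 2) = bounded_variance N.
Proof.
move=> n0.
transitivity (n%:R^-1 * mean (fun w => mart X (f N) (g N) n w ^+ 2)).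
  rewrite -meanZ; last exact/tameX/(tame_mart chainQ (fB N) (gE N)).
  by apply: eq_mean => w; rewrite /appr exprMn sqrtV.
rewrite (mean_mart2 chain chainQ (fB N) (gE N) statR) mulrA mulVf ?mul1r //.
by rewrite pnatr_eq0 -lt0n.
Qed.

Let mean_appr4 N n : (0 < n)%N ->
  mean (fun w => appr N n w ^+ 4) <= 8 * (2 * N%:R) ^+ 4.
Proof.
move=> n0.
have -> : mean (fun w => appr N n w ^+ 4) =
    n%:R^-1 ^+ 2 * mean (fun w => mart X (f N) (g N) n w ^+ 4).
  rewrite -meanZ; last exact/tameX/(tame_mart chainQ (fB N) (gE N)).
  by apply: eq_mean => w; rewrite /appr exprMn (exprM _ 2 2) sqrtV.
have n0' : 0 < n%:R :> R by rewrite ltr0n.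
rewrite exprVn ler_pdivrMl ?exprn_gt0 // mulrC.
exact: (mean_mart4 chain chainQ (fB N) (gE N) statR).
Qed.

Let adapted_scaled n : adapted X n (scaled n).
Proof.
move=> w w' h; rewrite /scaled /partial_sum; congr (_ * _).
by apply: eq_big_nat => k /andP[_ kn]; rewrite h.
Qed.

Let adapted_rest N n : adapted X n (rest N n).
Proof.
apply: (adapted2 (fun x y : R => x - y)); first exact: adapted_scaled.
by apply: (adapted1 (fun x : R => _ * x)); exact: adapted_mart.
Qed.

Let minK_bound (x K : R) : 0 < K -> `|Num.min (x ^+ 2) K| <= K.
Proof.
by move=> K0; rewrite ger0_norm ?ge_min ?lexx ?orbT // le_min sqr_ge0 ltW.
Qed.

Let tame_min (Y : T -> R) n K : 0 < K -> adapted X n Y ->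
  tame (fun w => Num.min (Y w ^+ 2) K).
Proof.
move=> K0 aY; apply: (@tame_adapted _ _ _ _ X n _ K) => //.
  by apply: (adapted1 (fun x : R => Num.min (x ^+ 2) K)).
by move=> w; exact: minK_bound.
Qed.

Let bnd n K y : R := Num.min (4 * n%:R^-1 * drift y ^+ 2) K.

Let bnd_ge0 n K y : 0 < K -> 0 <= bnd n K y.
Proof.
move=> K0; rewrite le_min; apply/andP; split; last exact: ltW.
apply: mulr_ge0; last exact: sqr_ge0.
by apply: mulr_ge0 => //; rewrite invr_ge0.
Qed.

Let bnd_cvg K : 0 < K -> (\int[Q]_w (bnd n K (X 0 w))%:E)%E @[n --> \oo] --> 0%E.
Proof.
move=> K0.
have mb n : measurable_fun setT (fun w => (bnd n K (X 0 w))%:E).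
  exact: (@measurable_comp_X _ _ _ _ mX _ _ 0 (fun y => (bnd n K y)%:E)).
have [] := @dominated_convergence _ _ _ Q setT measurableT
  (fun n w => (bnd n K (X 0 w))%:E) (cst 0%E) (cst K%:E).
- exact: mb.
- exact: measurable_cst.
- apply: aeW => w _; apply: cvg_EFin; first exact: nearW.
  rewrite [X in X @ _ --> _](_ : _ = fun n => bnd n K (X 0 w)) //.
  have c1 : 4 * (n%:R^-1 : R) * drift (X 0 w) ^+ 2 @[n --> \oo] --> 0.
    rewrite -[X in _ --> X](mul0r (drift (X 0 w) ^+ 2)).
    apply: cvgMl; rewrite -[X in _ --> X](mulr0 4); apply: cvgMr.
    by rewrite -cvg_shiftS; exact: cvg_harmonic.
  apply: (squeeze_cvgr _ (cvg_cst 0) c1); apply: nearW => n.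
  by rewrite bnd_ge0 // ge_min lexx.
- by apply: finite_measure_integrable_cst.
- by apply: aeW => w n _; rewrite gee0_abs lee_fin ?bnd_ge0 // ge_min lexx orbT.
by move=> _ _; rewrite integral0.
Unshelve. all: by end_near. Qed.

Let rest_le N n K : (0 < n)%N -> 0 < K ->
  ((mean (fun w => Num.min (rest N n w ^+ 2) K))%:E <=
   16%:E * tail_mass Pr X j Q W N + 2%:E * \int[Q]_w (bnd n K (X 0 w))%:E)%E.
Proof.
move=> n0 K0; have n0' : 0 < n%:R :> R by rewrite ltr0n.
have tm := tame_min K0 (@adapted_rest N n).
pose Mp w := hat_mart Pr X j (tail Pr X j W N posp) n w.
pose Mn w := hat_mart Pr X j (tail Pr X j W N negp) n w.
have mMp : measurable_fun setT Mp by exact: (measurable_hat_mart Pr j chainQ).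
have mMn : measurable_fun setT Mn by exact: (measurable_hat_mart Pr j chainQ).
have mb k : measurable_fun setT (fun w => (bnd n K (X k w))%:E).
  exact: (@measurable_comp_X _ _ _ _ mX _ _ k (fun y => (bnd n K y)%:E)).
have bb k : (\int[Q]_w (bnd n K (X k w))%:E = \int[Q]_w (bnd n K (X 0 w))%:E)%E.
  rewrite (stat k (f := fun y => (bnd n K y)%:E)); last by move=> y; rewrite lee_fin bnd_ge0.
  by rewrite (stat 0 (f := fun y => (bnd n K y)%:E)) // => y; rewrite lee_fin bnd_ge0.
pose c : R := 4 * n%:R^-1.
have c0 : 0 <= c by rewrite mulr_ge0 // invr_ge0.
have c0M (M : T -> R) w : (0 <= c%:E * (M w ^+ 2)%:E)%E.
  by rewrite -EFinM lee_fin mulr_ge0 // sqr_ge0.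
have b0 k w : (0 <= (bnd n K (X k w))%:E)%E by rewrite lee_fin bnd_ge0.
have mcM (M : T -> R) : measurable_fun setT M ->
    measurable_fun setT (fun w => c%:E * (M w ^+ 2)%:E)%E.
  move=> mM; apply: emeasurable_funM; first exact: measurable_cst.
  by apply/measurable_EFinP; exact: measurable_funX.
have toE (x a b r s : R) : x <= c * a + c * b + (r + s) ->
    (x%:E <= (c%:E * a%:E + c%:E * b%:E) + (r%:E + s%:E))%E.
  by rewrite -!EFinM -!EFinD lee_fin.
have cM (M : T -> R) : measurable_fun setT M ->
    (\int[Q]_w (M w ^+ 2)%:E <= n%:R%:E * (2%:E * tail_mass Pr X j Q W N))%E ->
    (\int[Q]_w (c%:E * (M w ^+ 2)%:E) <= 8%:E * tail_mass Pr X j Q W N)%E.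
  move=> mM h; rewrite ge0_integralZl_EFin //; last 2 first.
  - by move=> w _; rewrite lee_fin sqr_ge0.
  - by apply/measurable_EFinP; exact: measurable_funX.
  apply: (@le_trans _ _ (c%:E * (n%:R%:E * (2%:E * tail_mass Pr X j Q W N)))%E).
    by apply: lee_wpmul2l => //; rewrite lee_fin.
  rewrite !muleA -!EFinM.
  have -> : c * n%:R * 2 = 8 by rewrite /c; field; rewrite gt_eqF.
  exact: lexx.
rewrite -mean_integral //.
apply: (@le_trans _ _ (\int[Q]_w ((c%:E * (Mp w ^+ 2)%:E + c%:E * (Mn w ^+ 2)%:E)
   + ((bnd n K (X 0 w))%:E + (bnd n K (X n w))%:E)))%E).
  have m1 : measurable_fun setT (fun w => (c%:E * (Mp w ^+ 2)%:E + c%:E * (Mn w ^+ 2)%:E)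
     + ((bnd n K (X 0 w))%:E + (bnd n K (X n w))%:E))%E.
    apply: emeasurable_funD; last exact: emeasurable_funD.
    by apply: emeasurable_funD; exact: mcM.
  apply: ae_ge0_le_integral => //.
  - by move=> w _; rewrite lee_fin le_min sqr_ge0 ltW.
  - by have [mt _] := tm; exact/measurable_EFinP.
  - by move=> w _; apply: adde_ge0; apply: adde_ge0.
  apply: filterS lfin => w Aw _.
  apply: toE; rewrite /rest /scaled /appr.
  rewrite (martingale_decomposition N n Aw) -/(Mp w) -/(Mn w) /bnd -/c.
  rewrite -mulrBr exprMn sqrtV //.
  have -> : mart X (f N) (g N) n w + Mp w - Mn w + (drift (X 0 w) - drift (X n w)) -
     mart X (f N) (g N) n w = Mp w - Mn w + (drift (X 0 w) - drift (X n w)) by ring.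
  move: (Mp w) (Mn w) (drift (X 0 w)) (drift (X n w)) => r1 r2 r3 r4.
  have key : n%:R^-1 * (r1 - r2 + (r3 - r4)) ^+ 2 <=
      c * r1 ^+ 2 + c * r2 ^+ 2 + (c * r3 ^+ 2 + c * r4 ^+ 2).
    have -> : c * r1 ^+ 2 + c * r2 ^+ 2 + (c * r3 ^+ 2 + c * r4 ^+ 2) =
        n%:R^-1 * (4 * (r1 ^+ 2 + r2 ^+ 2 + r3 ^+ 2 + r4 ^+ 2)) by rewrite /c; ring.
    rewrite ler_pM2l ?invr_gt0 //.
    have := sqr_ge0 (r1 + r2); have := sqr_ge0 (r1 - r3); have := sqr_ge0 (r1 + r4).
    have := sqr_ge0 (r2 + r3); have := sqr_ge0 (r2 - r4); have := sqr_ge0 (r3 + r4).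
    move=> h1 h2 h3 h4 h5 h6; nra.
  have s3 : 0 <= c * r3 ^+ 2 by rewrite mulr_ge0 // sqr_ge0.
  have s4 : 0 <= c * r4 ^+ 2 by rewrite mulr_ge0 // sqr_ge0.
  have s1 : 0 <= c * r1 ^+ 2 by rewrite mulr_ge0 // sqr_ge0.
  have s2 : 0 <= c * r2 ^+ 2 by rewrite mulr_ge0 // sqr_ge0.
  rewrite ge_min; case: (lerP (c * r3 ^+ 2) K) => h3; case: (lerP (c * r4 ^+ 2) K) => h4;
    apply/orP; [left|right|right|right]; lra.
rewrite ge0_integralD //; first last.
- exact: emeasurable_funD.
- by move=> w _; exact: adde_ge0.
- by apply: emeasurable_funD; exact: mcM.
- by move=> w _; exact: adde_ge0.
rewrite [X in (X + _)%E]ge0_integralD //; first last.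
- exact: mcM.
- exact: mcM.
rewrite [X in (_ + X)%E]ge0_integralD //.
rewrite (bb n); apply: leeD; last by rewrite -mule2n mule_natl.
apply: (@le_trans _ _ (8%:E * tail_mass Pr X j Q W N + 8%:E * tail_mass Pr X j Q W N)%E).
  by apply: leeD; apply: cM => //; exact: hat_mart_tail.
rewrite -ge0_muleDl ?lee_fin // -EFinD.
by have -> : 8 + 8 = 16 :> R by ring.
Qed.

(** Each of the two martingales of the tails has second moment at most
    [2 * n * tail_mass], and [(a - b + c - d) ^ 2 <= 4 * (a ^ 2 + b ^ 2 + c ^ 2 + d ^ 2)],
    whence [4 * (2 + 2)]. *)
Definition tail_bound N : R := 16 * fine (tail_mass Pr X j Q W N).

Lemma tail_bound_cvg : tail_bound N @[N --> \oo] --> 0.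
Proof.
rewrite -[X in _ --> X](mulr0 16); apply: cvgMr; apply: fine_cvg.
exact: (tail_mass_cvg chain chainQ m0 stat W1 W_sqr).
Qed.

Let beta n K : R := fine (\int[Q]_w (bnd n K (X 0 w))%:E).

Let beta_cvg K : 0 < K -> beta n K @[n --> \oo] --> 0.
Proof. by move=> K0; apply: fine_cvg; exact: bnd_cvg. Qed.

Let rest_leR N n K : (0 < n)%N -> 0 < K ->
  mean (fun w => Num.min (rest N n w ^+ 2) K) <= tail_bound N + 2 * beta n K.
Proof.
move=> n0 K0; rewrite -lee_fin; apply: le_trans (rest_le N n0 K0) _.
have tfin := tail_mass_fin chain chainQ m0 stat W1 W_sqr N.
have tb : tame (fun w => bnd n K (X 0 w)).
  apply: (tame_comp_X chainQ 0 (C := K)) => y.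
  by rewrite ger0_norm ?bnd_ge0 // ge_min lexx orbT.
have bfin : (\int[Q]_w (bnd n K (X 0 w))%:E)%E \is a fin_num.
  by rewrite mean_integral.
by rewrite -(fineK tfin) -(fineK bfin) -!EFinM -EFinD.
Qed.

Let sqrD_le (eta a b : R) : 0 < eta ->
  (a + b) ^+ 2 <= (1 + eta) * a ^+ 2 + (1 + eta^-1) * b ^+ 2.
Proof.
move=> e0; rewrite -subr_ge0.
have -> : (1 + eta) * a ^+ 2 + (1 + eta^-1) * b ^+ 2 - (a + b) ^+ 2 =
   eta^-1 * (eta * a - b) ^+ 2 by field; rewrite gt_eqF.
by rewrite mulr_ge0 ?sqr_ge0 // invr_ge0 ltW.
Qed.

Let min_sqrD_le (eta a b K : R) : 0 < eta -> 0 < K ->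
  Num.min ((a + b) ^+ 2) K <=
  (1 + eta) * Num.min (a ^+ 2) K + (1 + eta^-1) * Num.min (b ^+ 2) K.
Proof.
move=> e0 K0; have i0 : 0 < eta^-1 by rewrite invr_gt0.
have := sqrD_le a b e0; move: (sqr_ge0 a) (sqr_ge0 b).
move: (a ^+ 2) (b ^+ 2) ((a + b) ^+ 2) => x y z x0 y0 h; rewrite ge_min.
case: (lerP x K) => h1; case: (lerP y K) => h2; apply/orP;
  [left; exact: h|right|right|right]; nra.
Qed.

Let tame_minW (Y : T -> R) K : 0 < K -> measurable_fun setT Y ->
  tame (fun w => Num.min (Y w ^+ 2) K).
Proof.
move=> K0 mY; split; last by exists K => w; exact: minK_bound.
by apply: measurable_minr => //; exact: measurable_funX.
Qed.

Let mscaled n : measurable_fun setT (scaled n).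
Proof. exact: (measurable_adapted mX (@adapted_scaled n)). Qed.

Let mappr N n : measurable_fun setT (appr N n).
Proof. by have [] := tame_appr N n. Qed.

Let mrest N n : measurable_fun setT (rest N n).
Proof. exact: (measurable_adapted mX (@adapted_rest N n)). Qed.

(** The function [min (x ^ 2) K] is bounded and continuous, so its means converge
    under convergence in law, and it recovers the second moment as [K] grows. *)
Definition truncated n K : R := mean (fun w => Num.min (scaled n w ^+ 2) K).

Let mean_min_sqrD_le (eta K : R) (Y1 Y2 Y3 : T -> R) : 0 < eta -> 0 < K ->
  measurable_fun setT Y1 -> measurable_fun setT Y2 -> measurable_fun setT Y3 ->
  (forall w, Y1 w = Y2 w + Y3 w) ->
  mean (fun w => Num.min (Y1 w ^+ 2) K) <=
  (1 + eta) * mean (fun w => Num.min (Y2 w ^+ 2) K) +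
  (1 + eta^-1) * mean (fun w => Num.min (Y3 w ^+ 2) K).
Proof.
move=> e0 K0 m1 m2 m3 E123.
have t1 := tame_minW K0 m1; have t2 := tame_minW K0 m2; have t3 := tame_minW K0 m3.
have t2' := tameZ (1 + eta) t2; have t3' := tameZ (1 + eta^-1) t3.
rewrite -(meanZ Q (1 + eta) t2) -(meanZ Q (1 + eta^-1) t3) -(meanD Q t2' t3').
apply: le_mean => //; first exact: tameD.
by move=> w; rewrite E123; exact: min_sqrD_le.
Qed.

Let truncated_upper N n K eta : 0 < eta -> 0 < K -> (0 < n)%N ->
  truncated n K <= (1 + eta) * bounded_variance N
    + (1 + eta^-1) * (tail_bound N + 2 * beta n K).
Proof.
move=> e0 K0 n0; have i0 : 0 < eta^-1 by rewrite invr_gt0.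
apply: (@le_trans _ _ ((1 + eta) * mean (fun w => Num.min (appr N n w ^+ 2) K) +
  (1 + eta^-1) * mean (fun w => Num.min (rest N n w ^+ 2) K))).
  apply: mean_min_sqrD_le => // w; by rewrite /rest addrC subrK.
apply: lerD; rewrite ler_pM2l ?addr_gt0 //; last exact: rest_leR.
rewrite -(mean_appr2 N n0); apply: le_mean.
- exact: tame_minW.
- exact/tameX/tame_appr.
- by move=> w; rewrite ge_min lexx.
Qed.

(** Truncation at [K] loses at most [x ^ 4 / K], and the fourth moments of the
    bounded martingale are of order [n ^ 2]. *)
Let truncated_lower N n K eta : 0 < eta -> 0 < K -> (0 < n)%N ->
  bounded_variance N - 8 * (2 * N%:R) ^+ 4 / K <= (1 + eta) * truncated n K
    + (1 + eta^-1) * (tail_bound N + 2 * beta n K).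
Proof.
move=> e0 K0 n0; have i0 : 0 < eta^-1 by rewrite invr_gt0.
have ta := tame_appr N n; have t2 := tameX 2 ta; have t4 := tameX 4 ta.
apply: (@le_trans _ _ (mean (fun w => Num.min (appr N n w ^+ 2) K))).
  apply: (@le_trans _ _ (mean (fun w => appr N n w ^+ 2 - K^-1 * appr N n w ^+ 4))).
    rewrite (meanB Q t2 (tameZ K^-1 t4)) (meanZ Q _ t4) mean_appr2 //.
    by rewrite lerD2l lerN2 mulrC ler_pM2r ?invr_gt0 // mean_appr4.
  apply: le_mean; [by apply: tameB => //; exact: tameZ|exact: tame_minW|].
  move=> w; move: (appr N n w) => a; rewrite le_min.
  have a4 : 0 <= K^-1 * a ^+ 4.
    rewrite mulr_ge0 ?invr_ge0 ?(ltW K0) // (exprM a 2 2); exact: sqr_ge0.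
  rewrite lerBlDr lerDl a4 /=.
  rewrite lerBlDr (exprM a 2 2) -(ler_pM2l K0).
  move: (sqr_ge0 a); move: (a ^+ 2) => x x0.
  have -> : K * (K + K^-1 * x ^+ 2) = K * K + x ^+ 2 by field; rewrite gt_eqF.
  nra.
apply: (@le_trans _ _ ((1 + eta) * mean (fun w => Num.min (scaled n w ^+ 2) K) +
  (1 + eta^-1) * mean (fun w => Num.min ((- rest N n w) ^+ 2) K))).
  apply: mean_min_sqrD_le => //; first exact: measurableT_comp.
  by move=> w; rewrite /rest opprB addrC subrK.
apply: lerD; rewrite ler_pM2l ?addr_gt0 //.
apply: le_trans (rest_leR N n0 K0); rewrite le_eqVlt; apply/orP; left; apply/eqP.
by apply: eq_mean => w; rewrite sqrrN.
Qed.

Let rhs_cvg N K eta : 0 < K ->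
  (1 + eta^-1) * (tail_bound N + 2 * beta n K) @[n --> \oo] -->
  (1 + eta^-1) * tail_bound N.
Proof.
move=> K0; apply: cvgMr; rewrite -[X in _ --> X]addr0; apply: cvgD; first exact: cvg_cst.
by rewrite -[X in _ --> X](mulr0 2); apply: cvgMr; exact: beta_cvg.
Qed.

Lemma truncated_limit_upper N K eta (phi : R) : 0 < eta -> 0 < K ->
  truncated n K @[n --> \oo] --> phi ->
  phi <= (1 + eta) * bounded_variance N + (1 + eta^-1) * tail_bound N.
Proof.
move=> e0 K0 cphi.
have c2 : (1 + eta) * bounded_variance N + (1 + eta^-1) * (tail_bound N + 2 * beta n K)
    @[n --> \oo] --> (1 + eta) * bounded_variance N + (1 + eta^-1) * tail_bound N.
  by apply: cvgD; [exact: cvg_cst|exact: rhs_cvg].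
apply: (ler_cvg_to cphi c2).
by near=> n; apply: truncated_upper => //; near: n; exact: nbhs_infty_gt.
Unshelve. all: by end_near. Qed.

Lemma truncated_limit_lower N K eta (phi : R) : 0 < eta -> 0 < K ->
  truncated n K @[n --> \oo] --> phi ->
  bounded_variance N - 8 * (2 * N%:R) ^+ 4 / K <=
  (1 + eta) * phi + (1 + eta^-1) * tail_bound N.
Proof.
move=> e0 K0 cphi.
have c2 : (1 + eta) * truncated n K + (1 + eta^-1) * (tail_bound N + 2 * beta n K)
    @[n --> \oo] --> (1 + eta) * phi + (1 + eta^-1) * tail_bound N.
  by apply: cvgD; [exact: cvgMr|exact: rhs_cvg].
apply: (ler_cvg_to (cvg_cst _) c2).
by near=> n; apply: truncated_lower => //; near: n; exact: nbhs_infty_gt.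
Unshelve. all: by end_near. Qed.

(** What excludes a nonzero cycle mean in a central limit theorem; see [c_eq0]. *)
Lemma truncated_bounded : exists B : R, forall K, 0 < K ->
  \forall n \near \oo, truncated n K <= B.
Proof.
exists (2 * bounded_variance 0 + 2 * tail_bound 0 + 1) => K K0.
have c1 := @rhs_cvg 0%N K 1 K0.
have : \forall n \near \oo,
    (1 + 1^-1) * (tail_bound 0 + 2 * beta n K) <= (1 + 1^-1) * tail_bound 0 + 1.
  by apply: (cvgr_le _ c1); rewrite ltrDl.
move=> h; near=> n.
have n0 : (0 < n)%N by near: n; exact: nbhs_infty_gt.
apply: (le_trans (truncated_upper 0 ltr01 K0 n0)).
have : (1 + 1^-1) * (tail_bound 0 + 2 * beta n K) <= (1 + 1^-1) * tail_bound 0 + 1.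
  by near: n.
rewrite invr1; lra.
Unshelve. all: by end_near. Qed.

Let measurable_sqr (F : T -> \bar R) : measurable_fun setT F ->
  measurable_fun setT (fun w => F w ^+ 2)%E.
Proof.
move=> mF; rewrite (_ : (fun w => F w ^+ 2)%E = (F \* F)%E); first exact: emeasurable_funM.
by apply/funext => w; rewrite expe2.
Qed.

Local Notation J F := (\int[Pr j]_w F w).
Local Notation Z u := (zetaR X j u).

Let zeta_W_fin : {ae Pr j, forall w, (zeta X j W w < +oo)%E}.
Proof.
have iW : (Pr j).-integrable setT (fun w => zeta X j W w ^+ 2)%E.
  apply/integrableP; split.
    by apply: measurable_sqr; exact: (measurable_zeta mX j W0).
  rewrite (eq_integral (fun w => zeta X j W w ^+ 2)%E) // => w _.
  by rewrite gee0_abs // expe_ge0 // zeta_ge0.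
apply: filterS (integrable_ae measurableT iW) => w /(_ I) h.
rewrite ltey; apply/eqP => Wy; move: h; rewrite Wy.
by rewrite expe2 mulyy.
Qed.

Let u_ge0 (u : E -> R) : (forall z, 0 <= u z <= W z) -> forall z, 0 <= u z.
Proof. by move=> uW z; case/andP: (uW z). Qed.

Let zeta_fin (u : E -> R) : (forall z, 0 <= u z <= W z) ->
  {ae Pr j, forall w, zeta X j u w \is a fin_num}.
Proof.
move=> uW; apply: filterS zeta_W_fin => w Ww.
rewrite ge0_fin_numE; last exact/zeta_ge0/u_ge0.
by apply: le_lt_trans Ww; apply: le_zeta; [exact: u_ge0|move=> y; case/andP: (uW y)].
Qed.

Let mZ (u : E -> R) : (forall z, 0 <= u z <= W z) -> measurable_fun setT (Z u).
Proof. by move=> uW; apply: measurableT_comp => //; exact/measurable_zeta/u_ge0. Qed.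

Let mean_Z2_integral (u : E -> R) : (forall z, 0 <= u z <= W z) ->
  (\int[Pr j]_w (Z u w ^+ 2)%:E = \int[Pr j]_w (zeta X j u w ^+ 2))%E.
Proof.
move=> uW; apply: ae_eq_integral => //.
- by apply/measurable_EFinP; apply: measurable_funX; exact: mZ.
- by apply: measurable_sqr; exact/measurable_zeta/u_ge0.
by apply: filterS (zeta_fin uW) => w uw _; rewrite /zetaR EFin_expe fineK.
Qed.

Let zeta_sqr_fin (u : E -> R) : (forall z, 0 <= u z <= W z) ->
  (\int[Pr j]_w (zeta X j u w ^+ 2) < +oo)%E.
Proof.
move=> uW; apply: le_lt_trans W_sqr; apply: ge0_le_integral => //.
- by move=> w _; rewrite expe_ge0 // zeta_ge0 //; exact: u_ge0.
- by apply: measurable_sqr; exact/measurable_zeta/u_ge0.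
- by apply: measurable_sqr; exact/measurable_zeta.
move=> w _; rewrite !expe2; have h := zeta_ge0 X j w (u_ge0 uW).
have h2 : (zeta X j u w <= zeta X j W w)%E.
  by apply: le_zeta; [exact: u_ge0|move=> y; case/andP: (uW y)].
exact: lee_pmul.
Qed.

Lemma square_integrable_zetaR (u : E -> R) : (forall z, 0 <= u z <= W z) -> square_integrable (Pr j) (Z u).
Proof.
move=> uW; split; first exact: mZ.
apply/integrableP; split; first by apply/measurable_EFinP; apply: measurable_funX; exact: mZ.
rewrite (eq_integral (fun w => (Z u w ^+ 2)%:E)); last first.
  by move=> w _; rewrite gee0_abs // lee_fin sqr_ge0.
by rewrite (mean_Z2_integral uW); exact: zeta_sqr_fin.
Qed.

(** A cycle sum of a function below [W] is almost surely finite, so that its real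
    version has the same moments. *)
Lemma mean_zetaR2 (u : E -> R) : (forall z, 0 <= u z <= W z) ->
  J (fun w => Z u w ^+ 2) = fine (\int[Pr j]_w (zeta X j u w ^+ 2))%E.
Proof. by move=> uW; rewrite /Rintegral mean_Z2_integral. Qed.

Lemma mean_zetaR (u : E -> R) : (forall z, 0 <= u z <= W z) ->
  J (Z u) = fine (grn u j).
Proof.
move=> uW; rewrite /Rintegral -(integral_zeta chain mX); last exact: u_ge0.
congr fine; apply: ae_eq_integral => //.
- by apply/measurable_EFinP; exact: mZ.
- exact/measurable_zeta/u_ge0.
by apply: filterS (zeta_fin uW) => w uw _; rewrite /zetaR fineK.
Qed.

Lemma zetaR_add (u v s : E -> R) : (forall z, 0 <= u z <= W z) ->
  (forall z, 0 <= v z <= W z) -> (forall z, s z = u z + v z) ->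
  {ae Pr j, forall w, Z s w = Z u w + Z v w}.
Proof.
move=> uW vW suv; apply: filterS2 (zeta_fin uW) (zeta_fin vW) => w uw vw.
rewrite /zetaR -fineD // -zetaD; [|exact: u_ge0|exact: u_ge0].
by congr (fine (zeta _ _ _ _)); apply/funext.
Qed.

(** The second moment of the cycle sum of [H] per unit of time; the positive and
    the negative part of [H] are summed separately. *)
Definition asymptotic_variance : R := m^-1 * J (fun w => (Z posp w - Z negp w) ^+ 2).

Let cp N := cut Pr X j W N posp.
Let cn N := cut Pr X j W N negp.
Let tp N := tail Pr X j W N posp.
Let tn N := tail Pr X j W N negp.
Let cpW N : forall z, 0 <= cp N z <= W z := cut_uW N pospW.
Let cnW N : forall z, 0 <= cn N z <= W z := cut_uW N negpW.
Let tpW N : forall z, 0 <= tp N z <= W z := tail_uW N pospW.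
Let tnW N : forall z, 0 <= tn N z <= W z := tail_uW N negpW.

Let x w := Z posp w - Z negp w.
Let xc N w := Z (cp N) w - Z (cn N) w.
Let xt N w := Z (tp N) w - Z (tn N) w.

Let sx : square_integrable (Pr j) x. Proof. by apply: square_integrableB; exact: square_integrable_zetaR. Qed.
Let sxc N : square_integrable (Pr j) (xc N).
Proof. by apply: square_integrableB; apply: square_integrable_zetaR; [exact: cpW|exact: cnW]. Qed.
Let sxt N : square_integrable (Pr j) (xt N).
Proof. by apply: square_integrableB; apply: square_integrable_zetaR; [exact: tpW|exact: tnW]. Qed.

Let x_split N : {ae Pr j, forall w, x w = xc N w + xt N w}.
Proof.
have h1 := zetaR_add (cpW N) (tpW N) (cutDtail Pr X j W N posp).
have h2 := zetaR_add (cnW N) (tnW N) (cutDtail Pr X j W N negp).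
by apply: filterS2 h1 h2 => w h1 h2; rewrite /x /xc /xt h1 h2; ring.
Qed.

Let cW N : forall z, 0 <= cp N z + cn N z <= W z.
Proof.
move=> z; have /andP[h1 _] := cpW N z; have /andP[h2 _] := cnW N z.
rewrite addr_ge0 //=; have := pospDnegp z; have := cutDtail Pr X j W N posp z.
have := cutDtail Pr X j W N negp z; have /andP[h3 _] := tpW N z; have /andP[h4 _] := tnW N z.
by rewrite -/(cp N z) -/(cn N z) -/(tp N z) -/(tn N z) /W; lra.
Qed.

Let tW N z : tp N z + tn N z <= tail Pr X j W N W z.
Proof.
Local Transparent tail.
rewrite /tp /tn /tail; case: ifP => _; rewrite ?addr0 //.
by rewrite pospDnegp /W; lra.
Local Opaque tail.
Qed.

Let tWW N : forall z, 0 <= tail Pr X j W N W z <= W z.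
Proof. by apply: tail_uW => z; rewrite W0 /=. Qed.

Let J_xt N : m^-1 * J (fun w => xt N w ^+ 2) <= tail_bound N.
Proof.
have tm_fin := tail_mass_fin chain chainQ m0 stat W1 W_sqr N.
have h : J (fun w => xt N w ^+ 2) <= J (fun w => Z (tail Pr X j W N W) w ^+ 2).
  have [mt it] := square_integrable_zetaR (tWW N); have [mx ix] := sxt N.
  have ttW : forall z, 0 <= tp N z + tn N z <= W z.
    move=> z; have /andP[h1 _] := tpW N z; have /andP[h2 _] := tnW N z.
    rewrite addr_ge0 //=; apply: le_trans (tW N z) _; by have /andP[] := tWW N z.
  have ae1 : {ae Pr j, forall w, xt N w ^+ 2 <= Z (tail Pr X j W N W) w ^+ 2}.
    apply: filterS3 (zetaR_add (tpW N) (tnW N) (fun=> erefl)) (zeta_fin (tWW N)) (zeta_fin ttW).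
    move=> w e1 f1 f2.
    have z1 : 0 <= Z (tp N) w by apply/fine_ge0/zeta_ge0/u_ge0; exact: tpW.
    have z2 : 0 <= Z (tn N) w by apply/fine_ge0/zeta_ge0/u_ge0; exact: tnW.
    have z3 : Z (fun z => tp N z + tn N z) w <= Z (tail Pr X j W N W) w.
      apply: fine_le => //; apply: le_zeta; first exact: u_ge0.
      exact: tW.
    rewrite /xt -[leLHS]real_normK ?num_real // ler_sqr ?nnegrE //; last first.
      by apply: le_trans z3; rewrite e1 addr_ge0.
    by rewrite ler_norml; apply/andP; split; lra.
  rewrite -lee_fin !fineK; [|exact: integrable_fin_num|exact: integrable_fin_num].
  apply: ae_ge0_le_integral => //.
  - by move=> w _; rewrite lee_fin sqr_ge0.
  - by apply/measurable_EFinP; apply: measurable_funX.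
  - by move=> w _; rewrite lee_fin sqr_ge0.
  - by apply/measurable_EFinP; apply: measurable_funX.
  by apply: filterS ae1 => w h _; rewrite lee_fin.
have h2 : J (fun w => Z (tail Pr X j W N W) w ^+ 2) <= 2 * (m * fine (tail_mass Pr X j Q W N)).
  rewrite (mean_zetaR2 (tWW N)) -lee_fin fineK; last first.
    rewrite ge0_fin_numE; first exact: zeta_sqr_fin.
    by apply: integral_ge0 => w _; rewrite expe_ge0 // zeta_ge0 //; apply: u_ge0; exact: tWW.
  rewrite 2!EFinM fineK //.
  exact: (zeta_tail_sqr_le chain chainQ m0 stat W1 N).
have t0 : 0 <= fine (tail_mass Pr X j Q W N).
  by apply/fine_ge0/integral_ge0 => w _; rewrite mule_ge0 ?level_ge0 // lee_fin tail_ge0.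
apply: (@le_trans _ _ (m^-1 * (2 * (m * fine (tail_mass Pr X j Q W N))))).
  by rewrite ler_pM2l ?invr_gt0 //; exact: le_trans h h2.
have -> : m^-1 * (2 * (m * fine (tail_mass Pr X j Q W N))) =
    2 * fine (tail_mass Pr X j Q W N) by field; rewrite gt_eqF.
by rewrite /tail_bound ler_wpM2r // ler_nat.
Qed.

Let J_x : J x = 0.
Proof.
rewrite RintegralB //; [|exact/square_integrable_integrable/square_integrable_zetaR|exact/square_integrable_integrable/square_integrable_zetaR].
by rewrite !mean_zetaR // mean_zero subrr.
Qed.

Let J_xc N : J (xc N) = - J (xt N).
Proof.
apply/eqP; rewrite -addr_eq0 -RintegralD //; [|exact/square_integrable_integrable|exact/square_integrable_integrable].
rewrite -J_x; apply/eqP; apply: ae_eq_mean.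
- by apply: measurable_funD; [case: (sxc N)|case: (sxt N)].
- by case: sx.
by apply: filterS (x_split N) => w ->.
Qed.

Let energy_variance (c J1 J2 J3 S1 S2 S3 a1 a2 g1 g2 jc jc2 : R) :
  J1 = S1 -> J2 = S2 -> J3 = S3 -> a1 = g1 -> a2 = g2 -> jc = a1 - a2 ->
  2 * J1 + 2 * J2 = jc2 + J3 ->
  c * (2 * S1 + 2 * S2 - S3 - (g1 - g2) ^+ 2) = c * (jc2 - jc ^+ 2).
Proof. by move=> <- <- <- <- <- -> ->; ring. Qed.

(** The energy is the variance, and not the second moment, of the cycle sum of the
    cut function, because cutting destroys the centering. *)
Let bounded_varianceE N :
  bounded_variance N = m^-1 * (J (fun w => xc N w ^+ 2) - J (xc N) ^+ 2).
Proof.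
rewrite /bounded_variance /f /g.
rewrite (bounded_energy chain chainQ stat (cutp_ge0 N) (cutn_ge0 N) (cutp_le N) (cutn_le N)).
rewrite -/(cp N) -/(cn N).
have ip := square_integrable_integrable (square_integrable_zetaR (cpW N)).
have iN := square_integrable_integrable (square_integrable_zetaR (cnW N)).
have jc : J (xc N) = J (Z (cp N)) - J (Z (cn N)) by exact: (RintegralB measurableT ip iN).
have [mp ip2] := square_integrable_zetaR (cpW N); have [mn in2] := square_integrable_zetaR (cnW N).
have [ms is2] := square_integrable_zetaR (cW N).
have zz : 2 * J (fun w => Z (cp N) w ^+ 2) + 2 * J (fun w => Z (cn N) w ^+ 2) =
   J (fun w => xc N w ^+ 2) + J (fun w => Z (fun y => cp N y + cn N y) w ^+ 2).
  have [mx ix2] := sxc N.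
  rewrite -(RintegralZl 2 measurableT ip2) -(RintegralZl 2 measurableT in2).
  have i1 := integrableZR 2 ip2; have i2 := integrableZR 2 in2.
  rewrite -(RintegralD measurableT i1 i2) -(RintegralD measurableT ix2 is2).
  apply: ae_eq_mean.
  - by apply: measurable_funD; apply: measurable_funM => //; apply: measurable_funX.
  - by apply: measurable_funD; apply: measurable_funX.
  apply: filterS (zetaR_add (cpW N) (cnW N) (fun=> erefl)) => w ->.
  by rewrite /xc; ring.
have X0 := @energy_variance m^-1 _ _ _ _ _ _ _ _ _ _ _ _ (mean_zetaR2 (cpW N)) (mean_zetaR2 (cnW N)) (mean_zetaR2 (cW N))
  (mean_zetaR (cpW N)) (mean_zetaR (cnW N)) jc zz.
by apply: etrans X0; congr (_ * (_ + _ - _ - _ ^+ 2)).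
Qed.

Let Vc N := m^-1 * J (fun w => xc N w ^+ 2).

Let Vc_bv N : bounded_variance N <= Vc N <= bounded_variance N + tail_bound N.
Proof.
rewrite bounded_varianceE mulrBr -/(Vc N) J_xc sqrrN.
have h := sqr_mean_le (sxt N); have h1 := J_xt N.
have m1 : 0 < m^-1 by rewrite invr_gt0.
have h2 : m^-1 * J (xt N) ^+ 2 <= tail_bound N by apply: le_trans h1; rewrite ler_pM2l.
have h3 : 0 <= m^-1 * J (xt N) ^+ 2 by rewrite mulr_ge0 ?sqr_ge0 // ltW.
by apply/andP; split; lra.
Qed.

(** Cutting changes the cycle sum by the cycle sum of the tails, which is small in
    mean square ([J_xt]). *)
Let V_le eta N : 0 < eta ->
  asymptotic_variance <= (1 + eta) * Vc N + (1 + eta^-1) * tail_bound N.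
Proof.
move=> e0; rewrite /asymptotic_variance.
have -> : J (fun w => (Z posp w - Z negp w) ^+ 2) = J (fun w => (xc N w + xt N w) ^+ 2).
  have [mx _] := sx; have [mc _] := sxc N; have [mt _] := sxt N.
  apply: ae_eq_mean; [exact: measurable_funX| |].
    by apply: measurable_funX; exact: measurable_funD.
  by apply: filterS (x_split N) => w <-.
have m1 : 0 < m^-1 by rewrite invr_gt0.
have := mean_sqrD_le e0 (sxc N) (sxt N); rewrite -(ler_pM2l m1) mulrDr => h.
apply: (le_trans h); rewrite /Vc; have h1 := J_xt N.
have e1 : 0 < 1 + eta^-1 by rewrite addr_gt0 // invr_gt0.
by rewrite mulrCA lerD2l mulrCA (ler_pM2l e1); exact: h1.
Qed.

Let Vc_le eta N : 0 < eta ->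
  Vc N <= (1 + eta) * asymptotic_variance + (1 + eta^-1) * tail_bound N.
Proof.
move=> e0; rewrite /asymptotic_variance /Vc.
have -> : J (fun w => xc N w ^+ 2) = J (fun w => (x w + (-1) * xt N w) ^+ 2).
  have [mx _] := sx; have [mc _] := sxc N; have [mt _] := sxt N.
  apply: ae_eq_mean; [exact: measurable_funX| |].
    by apply: measurable_funX; apply: measurable_funD => //; exact: measurable_funM.
  by apply: filterS (x_split N) => w ->; congr (_ ^+ 2); ring.
have m1 : 0 < m^-1 by rewrite invr_gt0.
have := mean_sqrD_le e0 sx (square_integrableZ (-1) (sxt N)); rewrite -(ler_pM2l m1) mulrDr => h.
apply: (le_trans h); have h1 := J_xt N.
have -> : J (fun w => (-1 * xt N w) ^+ 2) = J (fun w => xt N w ^+ 2).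
  by apply: eq_Rintegral => w _; ring.
have e1 : 0 < 1 + eta^-1 by rewrite addr_gt0 // invr_gt0.
by rewrite mulrCA lerD2l mulrCA (ler_pM2l e1); exact: h1.
Qed.

(** The level [K] of truncation goes to infinity at a fixed cut [N], then [N] goes to
    infinity, and only then the loss [eta] in the square of a sum goes to zero. *)
Lemma limit_variance (phi : R -> R) (s2 : R) :
  (forall K, 0 < K -> truncated n K @[n --> \oo] --> phi K) ->
  (forall K, 0 < K -> phi K <= s2) ->
  phi K @[K --> +oo] --> s2 -> s2 = asymptotic_variance.
Proof.
move=> cphi phile philim.
have V0 : 0 <= asymptotic_variance.
  rewrite mulr_ge0 //; first by rewrite invr_ge0 ltW.
  by apply: Rintegral_ge0 => w _; exact: sqr_ge0.
have up eta : 0 < eta -> s2 <= (1 + eta) ^+ 2 * asymptotic_variance.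
  move=> e0.
  pose t N := (1 + eta) * ((1 + eta) * asymptotic_variance + (1 + eta^-1) * tail_bound N) +
      (1 + eta^-1) * tail_bound N.
  have tl : t N @[N --> \oo] --> (1 + eta) ^+ 2 * asymptotic_variance.
    rewrite [X in _ --> X](_ : _ = (1 + eta) * ((1 + eta) * asymptotic_variance +
      (1 + eta^-1) * 0) + (1 + eta^-1) * 0); last by ring.
    apply: cvgD; last by apply: cvgMr; exact: tail_bound_cvg.
    by apply: cvgMr; apply: cvgD; [exact: cvg_cst|apply: cvgMr; exact: tail_bound_cvg].
  apply: (ler_cvg_to (cvg_cst s2) tl); near=> N.
  apply: (ler_cvg_to philim (cvg_cst (t N))).
  near=> K; have K0 : 0 < K by near: K; exact: nbhs_pinfty_gt.
  apply: le_trans (truncated_limit_upper N e0 K0 (cphi K K0)) _.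
  rewrite /t lerD2r ler_pM2l ?addr_gt0 //.
  apply: le_trans (Vc_le N e0); by have /andP[] := Vc_bv N.
have lo eta : 0 < eta -> asymptotic_variance <= (1 + eta) ^+ 2 * s2.
  move=> e0.
  have lo1 N : bounded_variance N <= (1 + eta) * s2 + (1 + eta^-1) * tail_bound N.
    have cl : bounded_variance N - 8 * (2 * N%:R) ^+ 4 * K^-1 @[K --> +oo] -->
        bounded_variance N - 8 * (2 * N%:R) ^+ 4 * 0.
      by apply: cvgB; [exact: cvg_cst|apply: cvgMr; apply/gtr0_cvgV0; [exact: nbhs_pinfty_gt|exact: cvg_id]].
    rewrite mulr0 subr0 in cl.
    apply: (ler_cvg_to cl (cvg_cst _)).
    near=> K; have K0 : 0 < K by near: K; exact: nbhs_pinfty_gt.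
    apply: le_trans (truncated_limit_lower N e0 K0 (cphi K K0)) _.
    by rewrite lerD2r ler_pM2l ?addr_gt0 //; exact: phile.
  pose t N := (1 + eta) * ((1 + eta) * s2 + (1 + eta^-1) * tail_bound N + tail_bound N) +
      (1 + eta^-1) * tail_bound N.
  have tl : t N @[N --> \oo] --> (1 + eta) ^+ 2 * s2.
    rewrite [X in _ --> X](_ : _ = (1 + eta) * ((1 + eta) * s2 +
      (1 + eta^-1) * 0 + 0) + (1 + eta^-1) * 0); last by ring.
    apply: cvgD; last by apply: cvgMr; exact: tail_bound_cvg.
    apply: cvgMr; apply: cvgD; last exact: tail_bound_cvg.
    by apply: cvgD; [exact: cvg_cst|apply: cvgMr; exact: tail_bound_cvg].
  apply: (ler_cvg_to (cvg_cst asymptotic_variance) tl); near=> N.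
  apply: le_trans (V_le N e0) _; rewrite /t lerD2r ler_pM2l ?addr_gt0 //.
  have /andP[_ h] := Vc_bv N; apply: (le_trans h); by rewrite lerD2r.
have sq0 (a : R) : (1 + eta) ^+ 2 * a @[eta --> 0^'+] --> a.
  have h : (1 + eta) ^+ 2 * a @[eta --> 0^'+] --> (1 + 0) ^+ 2 * a.
    apply: cvgMl; apply: (@continuous_cvg _ _ _ _ _ _ (fun x : R => x ^+ 2)).
      exact: exprn_continuous.
    by apply: cvgD; [exact: cvg_cst|apply: cvg_at_right_filter; exact: cvg_id].
  by rewrite addr0 expr1n mul1r in h.
apply/eqP; rewrite eq_le; apply/andP; split.
- apply: (ler_cvg_to (cvg_cst s2) (sq0 asymptotic_variance)).
  by near=> e; apply: up; near: e; exact: nbhs_right_gt.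
- apply: (ler_cvg_to (cvg_cst asymptotic_variance) (sq0 s2)).
  by near=> e; apply: lo; near: e; exact: nbhs_right_gt.
Unshelve. all: by end_near. Qed.

End martingale_approximation.

(** * Second moments of the normal law *)

Section normal_second_moment.
Context {R : realType}.
Local Notation mu := (@lebesgue_measure R).

(** The density is a Radon-Nikodym derivative of the normal law. *)
Lemma integral_normal (s : R) (f : R -> \bar R) : (forall x, 0 <= f x)%E ->
  measurable_fun setT f ->
  (\int[normal_prob 0 s : probability (measurableTypeR R) R]_x f x =
   \int[mu]_x (f x * (normal_pdf 0 s x)%:E))%E.
Proof.
move=> f0 mf; set nu := (normal_prob 0 s : probability _ _).
have dom : nu `<< mu by exact: normal_prob_dominates.
rewrite -(Radon_Nikodym_SigmaFinite.change_of_variables dom f0 measurableT mf).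
apply: ae_eq_integral => //.
- apply: emeasurable_funM => //.
  by have /integrableP[] := Radon_Nikodym_SigmaFinite.f_integrable dom.
- by apply: emeasurable_funM => //; apply/measurable_EFinP; exact: measurable_normal_pdf.
have h : ae_eq mu setT (Radon_Nikodym_SigmaFinite.f nu mu) (fun x => (normal_pdf 0 s x)%:E).
  apply: integral_ae_eq => //.
  - exact: Radon_Nikodym_SigmaFinite.f_integrable.
  - by apply/measurable_EFinP; exact: measurable_normal_pdf.
  by move=> A _ mA; rewrite -Radon_Nikodym_SigmaFinite.f_integral.
by apply: filterS h => x h _; rewrite h.
Qed.

Variable s : R.
Hypothesis s0 : 0 < s.
Local Notation q := (normal_pdf 0 s).

Let qE : q = (fun x => normal_peak s * expR (- (x ^+ 2) / (s ^+ 2 *+ 2))).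
Proof.
by rewrite normal_pdfE ?gt_eqF //; apply/funext => x; rewrite /normal_fun subr0.
Qed.

Let dq (x : R) : is_derive x 1 (fun x => - s ^+ 2 * q x) (x * q x).
Proof.
rewrite qE; apply: is_derive_eq.
rewrite /GRing.scale /=; field.
by rewrite gt_eqF.
Qed.

Let q_even x : q (- x) = q x. Proof. by rewrite qE /= sqrrN. Qed.
Let q_ge0 x : 0 <= q x. Proof. exact: normal_pdf_ge0. Qed.
Let q_cont : continuous q. Proof. by apply: continuous_normal_pdf; rewrite gt_eqF. Qed.
Let mq : measurable_fun setT q. Proof. exact: measurable_normal_pdf. Qed.
Let iq : mu.-integrable setT (EFin \o q). Proof. exact: integrable_normal_pdf. Qed.

(** Integration by parts: [- s ^+ 2 * q] is a primitive of [x * q x]. *)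
Let second_moment_segment (a : R) : 0 < a ->
  (\int[mu]_(x in `[(- a)%R, a]) (x ^+ 2 * q x)%:E =
   (- (2 * s ^+ 2) * (a * q a))%:E + (s ^+ 2)%:E * \int[mu]_(x in `[(- a)%R, a]) (q x)%:E)%E.
Proof.
move=> a0; pose G x := - s ^+ 2 * q x.
have Na : - a < a by lra.
have dG x : derivable G x 1 by have := dq x => h; exact: ex_derive.
have cG : continuous G by move=> x; apply: cvgMr; exact: q_cont.
have := @integration_by_parts R (@id R) G (cst 1) (fun x => x * q x) (- a) a Na.
under eq_integral do rewrite mulrA -expr2.
move=> ->.
- rewrite /G q_even (_ : a * _ - _ = - (2 * s ^+ 2) * (a * q a)); last by ring.
  congr (_ + _)%E; under eq_integral do rewrite /= mul1r EFinM.
  have iqa : mu.-integrable `[(- a)%R, a] (EFin \o q) by exact: integrableS iq.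
  by rewrite integralZl // EFinN mulNe oppeK.
- by apply: continuous_subspaceT => x; exact: cvg_cst.
- split; [by move=> x _; exact: derivable_id|exact: cvg_at_right_filter cvg_id|exact: cvg_at_left_filter cvg_id].
- by move=> x _; rewrite derive1E derive_id.
- by apply: continuous_subspaceT => x; apply: cvgM; [exact: cvg_id|exact: q_cont].
- split; [by move=> x _|exact: cvg_at_right_filter (cG _)|exact: cvg_at_left_filter (cG _)].
- by move=> x _; rewrite derive1E; exact: derive_val.
Qed.

Let boundary_cvg : n.+1%:R * q n.+1%:R @[n --> \oo] --> (0 : R).
Proof.
apply: (@squeeze_cvgr _ _ _ _ (cst 0) (fun n => normal_peak s * (2 * s ^+ 2) * n.+1%:R^-1)).
- apply: nearW => n; rewrite mulr_ge0 //= qE.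
  set a : R := n.+1%:R; have a0 : 0 < a by rewrite ltr0n.
  rewrite mulNr expRN mulrCA -mulrA; apply: ler_wpM2l; first exact: normal_peak_ge0.
  have h : a ^+ 2 / (s ^+ 2 *+ 2) <= expR (a ^+ 2 / (s ^+ 2 *+ 2)).
    by apply: le_trans (expR_ge1Dx _); rewrite lerDr.
  have y0 : 0 < a ^+ 2 / (s ^+ 2 *+ 2) by rewrite divr_gt0 ?exprn_gt0 // pmulrn_lgt0 // exprn_gt0.
  have h2 : (expR (a ^+ 2 / (s ^+ 2 *+ 2)))^-1 <= (a ^+ 2 / (s ^+ 2 *+ 2))^-1.
    by rewrite lef_pV2 ?posrE // expR_gt0.
  apply: (le_trans (ler_wpM2l (ltW a0) h2)).
  by rewrite le_eqVlt; apply/orP; left; apply/eqP; field; rewrite !gt_eqF.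
- exact: cvg_cst.
- rewrite -[X in _ --> X](mulr0 (normal_peak s * (2 * s ^+ 2))).
  by apply: cvgMr; exact: cvg_harmonic.
Qed.

Let segment_cvg (f : R -> R) : (forall x, 0 <= f x) -> measurable_fun setT f ->
  (\int[mu]_(x in `[(- n.+1%:R)%R, n.+1%:R]) (f x)%:E)%E @[n --> \oo] -->
  (\int[mu]_x (f x)%:E)%E.
Proof.
move=> f0 mf.
have -> : [set: R] = \bigcup_n [set` `[- n.+1%:R, n.+1%:R : R]].
  apply/esym; rewrite -subTset => x _; have := archimedean.Num.Theory.truncnP. 
  exists (Num.truncn `|x|) => //=; rewrite in_itv /= -ler_norml ltW //.
  exact: Num.Theory.truncnS_gt.
apply: ge0_nondecreasing_set_cvg_integral => //.
- apply/nondecreasing_seqP => n; apply/subsetPset => x /=; rewrite !in_itv /= -!ler_norml.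
  by move=> h; apply: le_trans h _; rewrite ler_nat.
- by move=> n; apply: measurable_funTS; apply/measurable_EFinP.
- by move=> n x _; rewrite lee_fin.
Qed.

Lemma normal_sqr_integral : (\int[mu]_x (x ^+ 2 * q x)%:E = (s ^+ 2)%:E)%E.
Proof.
have m2 : measurable_fun setT (fun x : R => x ^+ 2 * q x).
  by apply: measurable_funM => //; exact: measurable_funX.
have c1 := segment_cvg (fun x => mulr_ge0 (sqr_ge0 x) (q_ge0 x)) m2.
have c2 := segment_cvg q_ge0 mq.
rewrite integral_normal_pdf in c2.
apply: (cvg_unique _ c1) => //.
rewrite /= (funext (fun n => second_moment_segment (ltr0Sn R n))).
rewrite -[X in _ --> X]add0e -[X in _ --> (_ + X)%E]mule1.
apply: cvgeD => //.
  apply: cvg_EFin; first exact: nearW.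
  rewrite -[X in _ --> X](mulr0 (- (2 * s ^+ 2))).
  by apply: cvgMr; exact: boundary_cvg.
by apply: cvgeZl.
Qed.

End normal_second_moment.

Section truncated_second_moment.
Context {R : realType} (nu : probability (measurableTypeR R) R) (s2 : R).
Hypothesis nu2 : (\int[nu]_x (x ^+ 2)%:E = s2%:E)%E.

Let mmin (K : R) : measurable_fun setT (fun x : measurableTypeR R => (Num.min (x ^+ 2) K)%:E).
Proof. by apply/measurable_EFinP; apply: measurable_minr => //; exact: measurable_funX. Qed.

Lemma min_sqr_integral_le (K : R) : 0 < K ->
  (\int[nu]_x (Num.min (x ^+ 2) K)%:E <= s2%:E)%E.
Proof.
move=> K0; rewrite -nu2; apply: ge0_le_integral => //.
- by move=> x _; rewrite lee_fin le_min sqr_ge0 ltW.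
- by apply/measurable_EFinP; exact: measurable_funX.
- by move=> x _; rewrite lee_fin ge_min lexx.
Qed.

Lemma min_sqr_integral_cvg :
  fine (\int[nu]_x (Num.min (x ^+ 2) K)%:E)%E @[K --> +oo] --> s2.
Proof.
have c : (\int[nu]_x (Num.min (x ^+ 2) n%:R)%:E)%E @[n --> \oo] --> s2%:E.
  have lim_min (x : measurableTypeR R) :
      (x ^+ 2)%:E = limn (fun n => (Num.min (x ^+ 2) n%:R)%:E).
    apply/esym/cvg_lim => //; apply: cvg_EFin; first exact: nearW.
    apply: cvg_near_cst; near=> n; apply/min_idPl.
    near: n; exact: nbhs_infty_ger.
  rewrite -nu2 (eq_integral _ _ (fun x _ => lim_min x)).
  apply: cvg_monotone_convergence => //.
  - by move=> n x _; rewrite lee_fin le_min sqr_ge0 ler0n.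
  - move=> x _; apply/nondecreasing_seqP => n; rewrite lee_fin.
    by rewrite le_min ge_min lexx ge_min ler_nat leqnSn orbT.
apply/cvgrPdist_le => e e0.
move/fine_cvg : c => /cvgrPdist_le /(_ e e0) [N _ /(_ N.+1 (leqnSn N))] /= h.
near=> K; have NK : N.+1%:R <= K by near: K; exact: nbhs_pinfty_ge.
have K0 : 0 < K by apply: lt_le_trans NK; rewrite ltr0n.
have fin (L : R) : 0 < L -> (\int[nu]_x (Num.min (x ^+ 2) L)%:E)%E \is a fin_num.
  move=> L0; rewrite ge0_fin_numE; first by apply: le_lt_trans (min_sqr_integral_le L0) _; exact: ltry.
  by apply: integral_ge0 => x _; rewrite lee_fin le_min sqr_ge0 ltW.
have h1 : fine (\int[nu]_x (Num.min (x ^+ 2) K)%:E)%E <= s2.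
  by rewrite -lee_fin fineK; [exact: min_sqr_integral_le|exact: fin].
have h2 : fine (\int[nu]_x (Num.min (x ^+ 2) N.+1%:R)%:E)%E <=
   fine (\int[nu]_x (Num.min (x ^+ 2) K)%:E)%E.
  apply: fine_le; [exact: fin|exact: fin|].
  apply: ge0_le_integral => //.
  - by move=> x _; rewrite lee_fin le_min sqr_ge0 ler0n.
  - by move=> x _; rewrite lee_fin le_min ge_min lexx ge_min NK orbT.
rewrite ger0_norm ?subr_ge0 //; apply: le_trans h; apply: le_trans (ler_norm _).
by rewrite lerD2l lerN2.
Unshelve. all: by end_near. Qed.

End truncated_second_moment.

Lemma centered_normal_sqr {R : realType} (s2 : R) : 0 <= s2 ->
  (\int[centered_normal s2]_x (x ^+ 2)%:E = s2%:E)%E.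
Proof.
move=> s20; have m2 : measurable_fun setT (fun x : measurableTypeR R => (x ^+ 2)%:E).
  by apply/measurable_EFinP; exact: measurable_funX.
rewrite /centered_normal; have [->|s2n0] := eqVneq s2 0.
  by rewrite integral_dirac // diracT mul1e expr0n.
have s0 : 0 < Num.sqrt s2 by rewrite sqrtr_gt0 lt0r s2n0.
rewrite integral_normal //; last by move=> x; rewrite lee_fin sqr_ge0.
under eq_integral do rewrite -EFinM.
by rewrite normal_sqr_integral // sqr_sqrtr.
Qed.

(** * Identification of the variance constant *)

Section clt_identification.
Context {R : realType} {d : measure_display} {T : measurableType d}
  {E : countType} (p : E -> E -> R) (Pr : E -> probability T R)
  (X : nat -> T -> E) (j : E).
Hypothesis chain : forall x, markov_chain_from p (Pr x) X x.
Variables (h : E -> R) (s2 : R).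
Hypothesis clt : clt_variance p h s2.
Hypothesis h_sqr :
  (\int[Pr j]_w (zeta X j (fun y => (1 + `|h y|)%R) w ^+ 2) < +oo)%E.
Local Opaque green taboo step posp negp.

Let mX : forall k x, measurable [set w | X k w = x]. Proof. by case: (chain j) => [[]]. Qed.
Let V y := 1 + `|h y|.
Let V0 y : 0 <= V y. Proof. by rewrite addr_ge0. Qed.
Local Notation grn u := (green Pr X j (EFin \o u)).

Lemma le_zeta_sqr_fin (c : R) (u : E -> R) : 0 <= c -> (forall y, 0 <= u y <= c * V y) ->
  (\int[Pr j]_w (zeta X j u w ^+ 2) < +oo)%E.
Proof.
move=> c0 uV; have u0 y : 0 <= u y by case/andP: (uV y).
have me (v : E -> R) : (forall y, 0 <= v y) -> measurable_fun setT (fun w => zeta X j v w ^+ 2)%E.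
  move=> v0; rewrite (_ : (fun w => _) = (zeta X j v \* zeta X j v)%E); last first.
    by apply/funext => w; rewrite expe2.
  by apply: emeasurable_funM; exact: measurable_zeta.
apply: (@le_lt_trans _ _ (\int[Pr j]_w ((c ^+ 2)%:E * zeta X j V w ^+ 2))%E).
  apply: ge0_le_integral => //.
  - by move=> w _; rewrite expe_ge0 // zeta_ge0.
  - exact: me.
  - by apply: emeasurable_funM => //; exact: me.
  move=> w _; rewrite !expe2 EFinM muleACA -zetaZ //.
  have le : (zeta X j u w <= zeta X j (fun y => (c * V y)%R) w)%E.
    by apply: le_zeta => // y; case/andP: (uV y).
  by apply: lee_pmul => //; exact: zeta_ge0.
rewrite ge0_integralZl ?lee_fin ?sqr_ge0 //; last 2 first.
- exact: me.
- by move=> w _; rewrite expe_ge0 // zeta_ge0.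
by rewrite lte_mul_pinfty ?lee_fin ?sqr_ge0.
Qed.

Lemma le_green_fin (u : E -> R) : (forall y, 0 <= u y <= V y) -> (grn u j < +oo)%E.
Proof.
move=> uV; have u0 y : 0 <= u y by case/andP: (uV y).
have mZ : measurable_fun setT (zeta X j V) by exact: measurable_zeta.
apply: (@le_lt_trans _ _ (\int[Pr j]_w (1 + zeta X j V w ^+ 2))%E).
  rewrite -(integral_zeta chain mX) //; apply: ge0_le_integral => //.
  - by move=> w _; exact: zeta_ge0.
  - exact: measurable_zeta.
  - apply: emeasurable_funD => //; rewrite (_ : (fun w => _) = (zeta X j V \* zeta X j V)%E).
      exact: emeasurable_funM.
    by apply/funext => w; rewrite expe2.
  move=> w _; apply: (@le_trans _ _ (zeta X j V w)).
    by apply: le_zeta => // y; case/andP: (uV y).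
  have := @zeta_ge0 R d T E X j V w V0.
  case: (zeta X j V w) => [r| |] //; rewrite ?expe2 //= -?EFinD ?lee_fin.
  by move=> _; nra.
rewrite ge0_integralD //; last 2 first.
- by move=> w _; rewrite expe_ge0 // zeta_ge0.
- rewrite (_ : (fun w => _) = (zeta X j V \* zeta X j V)%E); first exact: emeasurable_funM.
  by apply/funext => w; rewrite expe2.
have -> : (\int[Pr j]_w 1 = 1)%E.
  by rewrite (integral_cst (Pr j) measurableT 1%E) mul1e; exact: probability_setT.
by rewrite lte_add_pinfty // ltry.
Qed.

Let green1_fin : (green Pr X j (cst 1) j < +oo)%E.
Proof. by apply: (le_green_fin (u := cst 1)) => y; rewrite /= ler01 lerDl /=. Qed.

Local Notation m := (cycle_mean Pr X j).
Let m0 : 0 < m := cycle_mean_gt0 chain green1_fin.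

Let pV y : 0 <= posp h y <= V y.
Proof.
have := pospDnegp h y; have := negp_ge0 h y; have := posp_ge0 h y.
by rewrite /V => *; apply/andP; split; lra.
Qed.
Let nV y : 0 <= negp h y <= V y.
Proof.
have := pospDnegp h y; have := negp_ge0 h y; have := posp_ge0 h y.
by rewrite /V => *; apply/andP; split; lra.
Qed.

Let c : R := (fine (grn (posp h) j) - fine (grn (negp h) j)) / m.
Let H y := h y - c.

Let H_sqr : (\int[Pr j]_w (zeta X j (fun y => (1 + `|H y|)%R) w ^+ 2) < +oo)%E.
Proof.
apply: (@le_zeta_sqr_fin (1 + `|c|)); first by rewrite addr_ge0.
move=> y; rewrite addr_ge0 //= /H /V; have := ler_normB (h y) c.
have := normr_ge0 (h y); have := normr_ge0 c; nra.
Qed.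

Let fin_of (u : E -> R) : (forall y, 0 <= u y <= V y) -> grn u j \is a fin_num.
Proof.
move=> uV; rewrite ge0_fin_numE; first exact: le_green_fin.
by apply: green_ge0 => y; rewrite lee_fin; case/andP: (uV y).
Qed.

Let green_cst (r : R) : 0 <= r -> grn (cst r) j = (r * m)%:E.
Proof.
move=> r0; transitivity (green Pr X j (fun=> r%:E * 1)%E j).
  by congr green; apply/funext => y; rewrite /= mule1.
rewrite (greenZ chain) ?lee_fin // EFinM fineK //; apply: (fin_of (u := cst 1)) => y.
by rewrite /= ler01 lerDl /=.
Qed.

Let green_add (u v : E -> R) : (forall y, 0 <= u y) -> (forall y, 0 <= v y) ->
  grn (fun y => (u y + v y)%R) j = (grn u j + grn v j)%E.
Proof.
move=> u0 v0; rewrite -(greenD chain); [|by move=> y; rewrite lee_fin..].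
by congr green; apply/funext => y.
Qed.

Let H_mean : grn (posp H) j = grn (negp H) j.
Proof.
pose cp := Num.max c 0; pose cn := Num.max (- c) 0.
have cE : cp - cn = c by exact/esym/(pospBnegp (fun _ : E => c) j).
have cp0 : 0 <= cp by rewrite le_max lexx orbT.
have cn0 : 0 <= cn by rewrite le_max lexx orbT.
have e y : (posp H y + negp h y) + cp = (negp H y + posp h y) + cn.
  by have := pospBnegp H y; have := pospBnegp h y; rewrite {1}/H; lra.
have : grn (fun y => (posp H y + negp h y) + cp) j = grn (fun y => (negp H y + posp h y) + cn) j.
  by congr green; apply/funext => y /=; rewrite e.
have pos := posp_ge0; have neg := negp_ge0.
rewrite (green_add (u := fun y => posp H y + negp h y) (v := cst cp)) //; last first.
  by move=> y; rewrite addr_ge0 ?pos ?neg.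
rewrite (green_add (u := fun y => negp H y + posp h y) (v := cst cn)) //; last first.
  by move=> y; rewrite addr_ge0 ?pos ?neg.
rewrite !green_add // !green_cst //.
rewrite -(fineK (fin_of pV)) -(fineK (fin_of nV)).
have cm : c * m = fine (grn (posp h) j) - fine (grn (negp h) j) by rewrite /c divfK // gt_eqF.
move: (fine _) (fine _) cm => a b cm.
have g1 : (0 <= grn (posp H) j)%E by apply: green_ge0 => y; rewrite lee_fin posp_ge0.
have g2 : (0 <= grn (negp H) j)%E by apply: green_ge0 => y; rewrite lee_fin negp_ge0.
move: (grn (posp H) j) (grn (negp H) j) g1 g2 => [x| |] [y| |] //=.
move=> _ _ [] ; rewrite -cE in cm => e2; congr (_%:E).
by move: cm; rewrite mulrBl; lra.
Qed.

Let phi K : R := fine (\int[centered_normal s2]_x (Num.min (x ^+ 2) K)%:E)%E.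
Let nu2 := centered_normal_sqr (proj1 clt).

Let phi_le K : 0 < K -> phi K <= s2.
Proof.
move=> K0; have hK := min_sqr_integral_le nu2 K0.
rewrite -lee_fin fineK // ge0_fin_numE; first exact: le_lt_trans hK (ltry _).
by apply: integral_ge0 => x _; rewrite lee_fin le_min sqr_ge0 ltW.
Qed.

Let truncated_cvg (Q : probability T R) K : markov_chain p Q X -> 0 < K ->
  truncated X Q h n K @[n --> \oo] --> phi K.
Proof.
move=> chainQ K0; have [_ /(_ d T Q X chainQ) law] := clt.
have cmin : continuous (fun x : R => Num.min (x ^+ 2) K).
  move=> x; apply: (@continuous_min _ _ (fun x : R => x ^+ 2) (cst K)).
    exact: exprn_continuous.
  exact: cst_continuous.
have bmin : exists M : R, forall x : R, `|Num.min (x ^+ 2) K| <= M.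
  exists K => x; rewrite ger0_norm ?ge_min ?lexx ?orbT //.
  by rewrite le_min sqr_ge0 ltW.
have fin : (\int[centered_normal s2]_x (Num.min (x ^+ 2) K)%:E)%E \is a fin_num.
  rewrite ge0_fin_numE; first exact: le_lt_trans (min_sqr_integral_le nu2 K0) (ltry _).
  by apply: integral_ge0 => x _; rewrite lee_fin le_min sqr_ge0 ltW.
have := law _ cmin bmin; rewrite -(fineK fin); exact: fine_cvg.
Qed.

Let mscaled (f : E -> R) n : measurable_fun setT (scaled X f n).
Proof.
apply: measurable_funM => //; apply: measurable_sum => k.
exact: (measurable_comp_X mX).
Qed.

Let tame_min (Y : T -> R) K : 0 < K -> measurable_fun setT Y ->
  tame (fun w => Num.min (Y w ^+ 2) K).
Proof.
move=> K0 mY; split; first by apply: measurable_minr => //; exact: measurable_funX.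
by exists K => w; rewrite ger0_norm ?ge_min ?lexx ?orbT // le_min sqr_ge0 ltW.
Qed.

Let min_sqrB (x y K : R) : 0 < K ->
  Num.min ((x - y) ^+ 2) K <= 2 * Num.min (x ^+ 2) K + 2 * Num.min (y ^+ 2) K.
Proof.
move=> K0; have : 0 <= (x + y) ^+ 2 by exact: sqr_ge0.
have := sqr_ge0 x; have := sqr_ge0 y; have := sqr_ge0 (x - y).
rewrite !minElt; case: ifP => h1; case: ifP => h2; case: ifP => h3; nra.
Qed.

(** Let [c] be the mean of [h] per unit of time. The scaled sums of [h] and of
    [h - c] differ by [c * sqrt n], while the truncated second moments of both are
    bounded independently of the truncation level, those of [h] by the central
    limit theorem and those of [h - c] by [truncated_bounded]. *)
Let c_eq0 : c = 0.
Proof.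
have [Q [chainQ stat]] := stationary_law chain green1_fin.
have [B HB] := truncated_bounded chain chainQ m0 stat H_sqr H_mean.
apply/eqP/negP => /negP cn0.
have c2 : 0 < c ^+ 2 by rewrite exprn_even_gt0.
(* more than the two bounds on truncated second moments allow for a square of size [K] *)
pose K := 2 * (s2 + 1) + 2 * `|B| + 1.
have s20 : 0 <= s2 by case: clt.
have K0 : 0 < K by rewrite /K; have := normr_ge0 B; lra.
have up : \forall n \near \oo, truncated X Q h n K <= s2 + 1.
  apply: (cvgr_le _ (truncated_cvg chainQ K0)); apply: le_lt_trans (phi_le K0) _.
  by rewrite ltrDl.
have [N _ hN] : \forall n \near \oo,
  [/\ truncated X Q h n K <= s2 + 1, truncated X Q H n K <= B,
      (0 < n)%N & K <= n%:R * c ^+ 2].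
  near=> n; split; [by near: n|by near: n; exact: HB|by near: n; exact: nbhs_infty_gt|].
  by rewrite -ler_pdivrMr //; near: n; exact: nbhs_infty_ger.
have {hN} [h1 h2 n0 Kn] := hN N (leqnn N).
have diff w : scaled X h N w - scaled X H N w = Num.sqrt N%:R * c.
  rewrite /scaled /partial_sum -mulrBr -sumrB.
  under eq_bigr do rewrite /H opprB addrCA subrr addr0.
  rewrite sumr_const_nat subSS subn0.
  have q0 : Num.sqrt N%:R != 0 :> R by rewrite gt_eqF // sqrtr_gt0 ltr0n.
  move: (c) => r; apply: (mulfI q0); rewrite mulVKf // mulrA -expr2 sqr_sqrtr //.
  by rewrite mulr_natl.
have t1 := tame_min K0 (mscaled h N); have t2 := tame_min K0 (mscaled H N).
have le : \int[Q]_w K <= \int[Q]_w (2 * Num.min (scaled X h N w ^+ 2) K +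
    2 * Num.min (scaled X H N w ^+ 2) K).
  apply: le_mean; [exact: tame_cst|by apply: tameD; exact: tameZ|].
  move=> w; apply: le_trans (min_sqrB _ _ K0); rewrite diff exprMn sqr_sqrtr //.
  by rewrite le_min Kn lexx.
move: le; rewrite (meanD Q (tameZ 2 t1) (tameZ 2 t2)) (meanZ Q 2 t1) (meanZ Q 2 t2).
rewrite -/(truncated X Q h N K) -/(truncated X Q H N K) (mean_cst Q K).
by have := ler_norm B; rewrite {1}/K; lra.
Unshelve. all: by end_near. Qed.

Let HE : H = h. Proof. by apply/funext => y; rewrite /H c_eq0 subr0. Qed.

Theorem clt_variance_cycle :
  grn (posp h) j = grn (negp h) j /\ s2 = asymptotic_variance Pr X j m h.
Proof.
have Hm := H_mean; rewrite HE in Hm; split => //.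
have [Q [chainQ stat]] := stationary_law chain green1_fin.
apply: (limit_variance chain chainQ m0 stat h_sqr Hm (phi := phi)).
- by move=> K; exact: truncated_cvg.
- exact: phi_le.
- exact: min_sqr_integral_cvg.
Qed.

End clt_identification.

Section variance_moments.
Context {R : realType} {d : measure_display} {T : measurableType d}
  {E : countType} (p : E -> E -> R) (Pr : E -> probability T R)
  (X : nat -> T -> E) (j : E).
Hypothesis chain : forall x, markov_chain_from p (Pr x) X x.
Variables (g : E -> R) (c s2 : R).
Hypothesis clt : clt_variance p (fun y => g y - c) s2.
Hypothesis g_sqr :
  (\int[Pr j]_w (zeta X j (fun y => (1 + `|g y|)%R) w ^+ 2) < +oo)%E.
Local Opaque green taboo step posp negp.

Definition cycle_sqr (u : E -> R) : R := fine (\int[Pr j]_w (zeta X j u w ^+ 2))%E.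
Definition cycle_sum_mean (u : E -> R) : R := fine (green Pr X j (EFin \o u) j).

Local Notation S := cycle_sqr.
Local Notation mean1 := cycle_sum_mean.
Local Notation J F := (\int[Pr j]_w F w).
Local Notation Z u := (zetaR X j u).
Local Notation m := (cycle_mean Pr X j).
Let h y := g y - c.
Let chainj : markov_chain p (Pr j) X. Proof. by case: (chain j). Qed.

(** A weight above every function that is summed over a cycle in this part. *)
Let V y := (3 + 2 * `|c|) * (1 + `|g y|).
Let V1 y : 3 + 2 * `|c| + 2 * `|g y| <= V y.
Proof. by rewrite /V; have := normr_ge0 (g y); have := normr_ge0 c; nra. Qed.
Let V_sqr : (\int[Pr j]_w (zeta X j (fun y => (1 + `|V y|)%R) w ^+ 2) < +oo)%E.
Proof.
apply: (le_zeta_sqr_fin chain g_sqr (c := 4 + 2 * `|c|)); first by rewrite addr_ge0.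
move=> y; have := V1 y; have := normr_ge0 (g y); have := normr_ge0 c => c0 g0 v1.
rewrite ger0_norm; last by lra.
by rewrite /V; apply/andP; split; nra.
Qed.
Let VW (u : E -> R) : (forall y, 0 <= u y <= 3 + 2 * `|c| + 2 * `|g y|) ->
  forall y, 0 <= u y <= 1 + `|V y|.
Proof.
move=> uV y; have /andP[-> h2] := uV y; have := V1 y; have := ler_norm (V y) => a b.
by apply: le_trans h2 _; lra.
Qed.
Let addZ (u v s : E -> R) : (forall y, 0 <= u y <= 3 + 2 * `|c| + 2 * `|g y|) ->
  (forall y, 0 <= v y <= 3 + 2 * `|c| + 2 * `|g y|) -> (forall z, s z = u z + v z) ->
  {ae Pr j, forall w, Z s w = Z u w + Z v w}.
Proof. by move=> uV vV; apply: (zetaR_add chainj V_sqr); exact: VW. Qed.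
Let sqZ (u : E -> R) : (forall y, 0 <= u y <= 3 + 2 * `|c| + 2 * `|g y|) -> square_integrable (Pr j) (Z u).
Proof. by move=> uV; apply: (square_integrable_zetaR chainj V_sqr); exact: VW. Qed.
Let SE (u : E -> R) : (forall y, 0 <= u y <= 3 + 2 * `|c| + 2 * `|g y|) ->
  J (fun w => Z u w ^+ 2) = S u.
Proof. by move=> uV; apply: (mean_zetaR2 chainj V_sqr); exact: VW. Qed.

Let a := posp g.
Let b := negp g.
Let cp := Num.max c 0.
Let cn := Num.max (- c) 0.
Let cpn : [/\ 0 <= cp, 0 <= cn, cp + cn = `|c| & cp - cn = c].
Proof.
split; [by rewrite le_max lexx orbT|by rewrite le_max lexx orbT| |].
- exact: (pospDnegp (fun _ : E => c) j).
- exact/esym/(pospBnegp (fun _ : E => c) j).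
Qed.
Let abn y : [/\ 0 <= a y, 0 <= b y, a y + b y = `|g y| & a y - b y = g y].
Proof.
by split; rewrite ?posp_ge0 ?negp_ge0 //; [exact: pospDnegp|exact/esym/pospBnegp].
Qed.
Let ab y : 0 <= posp h y /\ 0 <= negp h y /\ posp h y + negp h y <= `|c| + `|g y|
  /\ posp h y - negp h y = g y - c.
Proof.
rewrite posp_ge0 negp_ge0 pospDnegp -pospBnegp /h; split=> //; split=> //; split=> //.
by rewrite [leRHS]addrC; exact: ler_normB.
Qed.

Ltac bound := let y := fresh in move=> y /=; have [? ? ? ?] := abn y;
  have [? [? [? ?]]] := ab y; have ? := normr_ge0 (g y); have ? := normr_ge0 c;
  have [? ? ? ?] := cpn; apply/andP; split; lra.

Let ba : forall y, 0 <= a y <= 3 + 2 * `|c| + 2 * `|g y|. Proof. bound. Qed.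
Let bb : forall y, 0 <= b y <= 3 + 2 * `|c| + 2 * `|g y|. Proof. bound. Qed.
Let bp : forall y, 0 <= posp h y <= 3 + 2 * `|c| + 2 * `|g y|. Proof. bound. Qed.
Let bn : forall y, 0 <= negp h y <= 3 + 2 * `|c| + 2 * `|g y|. Proof. bound. Qed.
Let bab : forall y, 0 <= `|g y| <= 3 + 2 * `|c| + 2 * `|g y|. Proof. bound. Qed.
Let bat : forall y, 0 <= a y + 1 <= 3 + 2 * `|c| + 2 * `|g y|. Proof. bound. Qed.
Let bbt : forall y, 0 <= b y + 1 <= 3 + 2 * `|c| + 2 * `|g y|. Proof. bound. Qed.
Let b1 : forall y, 0 <= (cst 1 y : R) <= 3 + 2 * `|c| + 2 * `|g y|. Proof. bound. Qed.

Let Zdiff : {ae Pr j, forall w, Z (posp h) w - Z (negp h) w = Z a w - Z b w - c * Z (cst 1) w}.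
Proof.
have [cp0 cn0 _ cpB] := cpn.
have e1 := @addZ (posp h) b (fun y => posp h y + b y) ltac:(bound) ltac:(bound) (fun=> erefl).
have e2 := @addZ (fun y => posp h y + b y) (fun _ => cp * 1) (fun y => posp h y + b y + cp * 1)
  ltac:(bound) ltac:(bound) (fun=> erefl).
have e3 := @addZ (negp h) a (fun y => negp h y + a y) ltac:(bound) ltac:(bound) (fun=> erefl).
have e4 := @addZ (fun y => negp h y + a y) (fun _ => cn * 1) (fun y => negp h y + a y + cn * 1)
  ltac:(bound) ltac:(bound) (fun=> erefl).
have e5 : (fun y => posp h y + b y + cp * 1) = (fun y => negp h y + a y + cn * 1).
  apply/funext => y; have [_ [_ [_ e]]] := ab y; have [_ _ _ e'] := abn y.
  by move: e e'; rewrite /h; lra.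
apply: filterS2 (filterI e1 e2) (filterI e3 e4) => w [w1 w2] [w3 w4].
have Zc (r : R) : 0 <= r -> Z (fun=> r * 1) w = r * Z (cst 1) w.
  by move=> r0; rewrite /zetaR zetaZ // fineZ.
have cz : c * Z (cst 1) w = cp * Z (cst 1) w - cn * Z (cst 1) w by rewrite -mulrBl cpB.
have := w2; rewrite e5 w4 w1 w3 !Zc // cz; lra.
Qed.

Let J_lin (r : R) F G : (Pr j).-integrable setT (EFin \o F) ->
  (Pr j).-integrable setT (EFin \o G) ->
  J (fun w => r * F w + G w) = r * J F + J G.
Proof.
move=> iF iG; rewrite RintegralD //; last exact: integrableZR.
by rewrite RintegralZl.
Qed.

Local Opaque zetaR cycle_sqr.

Let combination (J1 J2 J3 J4 J5 J6 r1 r2 r3 r4 r5 r6 : R) :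
  J1 = r1 -> J2 = r2 -> J3 = r3 -> J4 = r4 -> J5 = r5 -> J6 = r6 ->
  2 * J1 + (2 * J2 + ((- 1) * J3 + (- c * J4 + (c * J1 + (c * J5 + (- c * J2 + c ^+ 2 * J6)))))) =
  2 * r1 + 2 * r2 - r3 - c * ((r4 - r1) - (r5 - r2)) + c ^+ 2 * r6.
Proof. by move=> -> -> -> -> -> ->; ring. Qed.

(** All second moments are those of cycle sums of nonnegative functions; products of
    cycle sums are recovered from them by polarisation. *)
Lemma variance_moments :
  c = (mean1 (posp g) - mean1 (negp g)) / m /\
  s2 = m^-1 * (2 * S (posp g) + 2 * S (negp g) - S (fun y => `|g y|)
    - c * ((S (fun y => posp g y + 1) - S (posp g)) - (S (fun y => negp g y + 1) - S (negp g)))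
    + c ^+ 2 * S (cst 1)).
Proof.
have h_sqr : (\int[Pr j]_w (zeta X j (fun y => (1 + `|h y|)%R) w ^+ 2) < +oo)%E.
  apply: (le_zeta_sqr_fin chain g_sqr (c := 1 + `|c|)); first by rewrite addr_ge0.
  move=> y; rewrite addr_ge0 //= /h; have := ler_normB (g y) c.
  by have := normr_ge0 (g y); have := normr_ge0 c; nra.
have [hm ->] := clt_variance_cycle chain clt h_sqr.
have sp := sqZ bp; have sn := sqZ bn.
have sa := sqZ ba; have sb := sqZ bb.
have st := sqZ b1.
have mZ (u : E -> R) (uV : forall y, 0 <= u y <= 3 + 2 * `|c| + 2 * `|g y|) : J (Z u) = mean1 u.
  by apply: (mean_zetaR chain chainj V_sqr); exact: VW.
have m_gt0 : 0 < m.
  apply: (cycle_mean_gt0 chain); apply: (le_green_fin chain g_sqr (u := cst 1)) => y.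
  by rewrite /= ler01 lerDl /=.
have Jd : J (fun w => Z (posp h) w - Z (negp h) w) = J (fun w => Z a w - Z b w - c * Z (cst 1) w).
  apply: ae_eq_mean Zdiff.
  - by apply: measurable_funB; [case: sp|case: sn].
  - apply: measurable_funB; first by apply: measurable_funB; [case: sa|case: sb].
    by apply: measurable_funM => //; case: st.
split.
  move: Jd; rewrite RintegralB //; [|exact: square_integrable_integrable|exact: square_integrable_integrable].
  rewrite RintegralB //; [|exact/square_integrable_integrable/square_integrableB|exact/square_integrable_integrable/square_integrableZ].
  rewrite RintegralB //; [|exact: square_integrable_integrable|exact: square_integrable_integrable].
  rewrite RintegralZl //; last exact: square_integrable_integrable.
  rewrite (mZ (posp h) bp) (mZ (negp h) bn).
  rewrite (mZ a ba) (mZ b bb) (mZ (cst 1) b1).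
  rewrite /mean1 hm subrr -/m => e; apply/eqP; rewrite eq_sym -subr_eq0; apply/eqP.
  apply: (mulIf (x := m)); first by rewrite gt_eqF.
  rewrite mulrBl divfK ?gt_eqF // mul0r /mean1.
  exact: esym e.
congr (_ * _).
have eab := @addZ a b (fun y => `|g y|) ba bb
  (fun y => esym (let: And4 _ _ e _ := abn y in e)).
have eat := @addZ a (cst 1) (fun y => a y + 1) ba b1 (fun=> erefl).
have ebt := @addZ b (cst 1) (fun y => b y + 1) bb b1 (fun=> erefl).
have [mp _] := sp; have [mn _] := sn.
have sab := sqZ bab.
have sat := sqZ bat.
have sbt := sqZ bbt.
have [ma ia] := sa; have [mb ib] := sb; have [mt it] := st.
have [mab iab] := sab; have [mat iat] := sat; have [mbt ibt] := sbt.
transitivity (J (fun w => 2 * Z a w ^+ 2 + (2 * Z b w ^+ 2 + ((-1) * Z (fun y => `|g y|) w ^+ 2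
  + (- c * Z (fun y => a y + 1) w ^+ 2 + (c * Z a w ^+ 2 + (c * Z (fun y => b y + 1) w ^+ 2 +
    (- c * Z b w ^+ 2 + c ^+ 2 * Z (cst 1) w ^+ 2)))))))).
  apply: ae_eq_mean.
  - by apply: measurable_funX; exact: measurable_funB.
  - by do 7 (apply: measurable_funD; first by apply: measurable_funM => //; exact: measurable_funX);
      apply: measurable_funM => //; exact: measurable_funX.
  apply: filterS2 (filterI Zdiff eab) (filterI eat ebt) => w [-> ->] [-> ->].
  by ring.
have i8 := integrableZR (c ^+ 2) it.
have i7 := integrableDR (integrableZR (- c) ib) i8.
have i6 := integrableDR (integrableZR c ibt) i7.
have i5 := integrableDR (integrableZR c ia) i6.
have i4 := integrableDR (integrableZR (- c) iat) i5.
have i3 := integrableDR (integrableZR (- 1) iab) i4.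
have i2 := integrableDR (integrableZR 2 ib) i3.
rewrite (J_lin 2 ia i2) (J_lin 2 ib i3) (J_lin (-1) iab i4) (J_lin (- c) iat i5).
rewrite (J_lin c ia i6) (J_lin c ibt i7) (J_lin (- c) ib i8) (RintegralZl _ measurableT it).
exact: (combination (SE ba) (SE bb) (SE bab) (SE bat) (SE bbt) (SE b1)).
Qed.

End variance_moments.

(** * Lower bounds in the limit *)

Section eventual_lower_bound.
Context {R : realType}.
Local Open Scope ereal_scope.
Implicit Types (a b : nat -> \bar R) (L M : \bar R).

(** [L] is at most the lower limit of [a]. This form is stable under the operations
    from which the Green function is built. *)
Definition liminf_ge a L := forall r : R, r%:E < L -> \forall n \near \oo, r%:E < a n.

Lemma liminf_ge_le_near a b L : liminf_ge a L -> (\forall n \near \oo, a n <= b n) -> liminf_ge b L.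
Proof.
move=> aL ab r rL; have h := aL r rL; near=> n.
by apply: lt_le_trans (_ : a n <= b n); near: n.
Unshelve. all: by end_near. Qed.

Lemma liminf_ge_cst a L : (\forall n \near \oo, L <= a n) -> liminf_ge a L.
Proof. by move=> h r rL; apply: filterS h => n; exact: lt_le_trans. Qed.

Lemma liminf_ge0 a : (forall n, 0 <= a n) -> liminf_ge a 0.
Proof. by move=> a0; apply: liminf_ge_cst; exact: nearW. Qed.

Let split_lt (r : R) L M : 0 <= L -> 0 <= M -> r%:E < L + M ->
  exists r1 r2 : R, [/\ r = (r1 + r2)%R, r1%:E < L & r2%:E < M].
Proof.
case: L M => [l| |] [m| |] // l0 m0.
- rewrite -EFinD lte_fin => h; exists (l - (l + m - r) / 2)%R, (m - (l + m - r) / 2)%R.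
  by rewrite !lte_fin; split; lra.
- by move=> _; exists (l - 1)%R, (r - l + 1)%R; rewrite lte_fin ltry; split => //; lra.
- by move=> _; exists (r - m + 1)%R, (m - 1)%R; rewrite lte_fin ltry; split => //; lra.
- by move=> _; exists r, 0%R; rewrite !ltry addr0.
Qed.

Lemma liminf_geD a b L M : 0 <= L -> 0 <= M -> liminf_ge a L -> liminf_ge b M ->
  liminf_ge (fun n => a n + b n) (L + M).
Proof.
move=> L0 M0 aL bM r /(split_lt L0 M0) [r1 [r2 [-> h1 h2]]].
have h1' := aL _ h1; have h2' := bM _ h2.
by near=> n; rewrite EFinD; apply: lteD; near: n.
Unshelve. all: by end_near. Qed.

Lemma liminf_geZ (c : R) a L : (0 <= c)%R -> (forall n, 0 <= a n) -> 0 <= L -> liminf_ge a L ->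
  liminf_ge (fun n => c%:E * a n) (c%:E * L).
Proof.
rewrite le_eqVlt => /predU1P[<- a0 L0 aL|c0 a0 L0 aL].
  by rewrite mul0e; apply: liminf_ge0 => n; rewrite mul0e.
move=> r rL; have h : (r / c)%:E < L.
  by rewrite -(lte_pmul2l (_ : c%:E \is a fin_num) (_ : 0 < c%:E)) // -EFinM mulrCA divff ?mulr1 // gt_eqF.
apply: filterS (aL _ h) => n hn.
have -> : r%:E = c%:E * (r / c)%:E by rewrite -EFinM mulrCA divff ?mulr1 // gt_eqF.
by rewrite lte_pmul2l.
Qed.

Lemma liminf_ge_sum (a : nat -> nat -> \bar R) (L : nat -> \bar R) K :
  (forall k n, 0 <= a k n) -> (forall k, 0 <= L k) -> (forall k, liminf_ge (a k) (L k)) ->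
  liminf_ge (fun n => \sum_(0 <= k < K) a k n) (\sum_(0 <= k < K) L k).
Proof.
move=> a0 L0 aL; elim: K => [|K IH].
  by rewrite big_nil; apply: liminf_ge0 => n; rewrite big_nil.
rewrite big_nat_recr //=; apply: liminf_ge_le_near (liminf_geD _ _ IH (aL K)) _ => //.
  exact: sume_ge0.
by apply: nearW => n; rewrite big_nat_recr.
Qed.

Lemma liminf_ge_series (a : nat -> nat -> \bar R) (L : nat -> \bar R) b :
  (forall k n, 0 <= a k n) -> (forall k, 0 <= L k) -> (forall k, liminf_ge (a k) (L k)) ->
  (forall K, \forall n \near \oo, \sum_(0 <= k < K) a k n <= b n) ->
  liminf_ge b (\sum_(0 <= k <oo) L k).
Proof.
move=> a0 L0 aL ab r rL.
have [K rK] : exists K, r%:E < \sum_(0 <= k < K) L k.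
  apply/not_existsP => h; move: rL; apply/negP; rewrite -leNgt; apply: nneseries_le => // n.
  by rewrite leNgt; apply/negP; exact: h.
exact: (liminf_ge_le_near (liminf_ge_sum a0 L0 aL) (ab K)).
Qed.

Lemma liminf_ge_squeeze a b (s : nat -> \bar R) (A B : R) :
  (forall n, 0 <= a n) -> (forall n, 0 <= b n) ->
  liminf_ge a A%:E -> liminf_ge b B%:E -> (\forall n \near \oo, s n = a n + b n) ->
  s n @[n --> \oo] --> (A + B)%:E ->
  fine (a n) @[n --> \oo] --> A.
Proof.
move=> a0 b0 aA bB sab sAB; apply/cvgrPdist_lt => e e0.
have e2 : (0 < e / 2)%R by rewrite divr_gt0.
have ha : \forall n \near \oo, (A - e)%:E < a n by apply: aA; rewrite lte_fin ltrBlDr ltrDl.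
have hb : \forall n \near \oo, (B - e / 2)%:E < b n by apply: bB; rewrite lte_fin ltrBlDr ltrDl.
have hs : \forall n \near \oo, s n < (A + B + e / 2)%:E.
  have /= := sAB [set x | x < (A + B + e / 2)%:E]; apply.
  apply: open_nbhs_nbhs; split; first exact: open_ereal_lt_ereal.
  by rewrite /= lte_fin ltrDl.
near=> n.
have h1 : (A - e)%:E < a n by near: n.
have h2 : (B - e / 2)%:E < b n by near: n.
have h3 : a n + b n < (A + B + e / 2)%:E.
  by rewrite (_ : a n + b n = s n); [near: n|apply/esym; near: n].
move: h1 h2 h3 (a0 n) (b0 n); case: (a n) (b n) => [x| |] [y| |] //.
rewrite -!EFinD !lte_fin /= => h1 h2 h3 _ _.
rewrite distrC ltr_norml; apply/andP; split; lra.
Unshelve. all: by end_near. Qed.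

End eventual_lower_bound.

Section chain_limits.
Context {R : realType} {d : measure_display} {Omega : measurableType d}
  (Pr : nat -> probability Omega R) (P : nat -> nat -> R) (Phi : nat -> Omega -> nat)
  (j : nat) (Pt : forall n, 'M[R]_n.+1) (Phit : forall n, nat -> Omega -> 'I_n.+1).
Hypothesis P_ge0 : forall x y, 0 <= P x y.
Hypothesis Phi_chain : forall i, markov_chain_from P (Pr i) Phi i.
Hypothesis Pt_augmentation :
  forall n (i k : 'I_n.+1), nw_truncation P n i k <= Pt n i k.
Hypothesis Phit_chain : forall n i, (i <= n)%N ->
  markov_chain_from (Pt n) (Pr i) (Phit n) (inord i).
Local Open Scope ereal_scope.

(** The laws of the finite chain, indexed by its own states. *)
Definition trunc_law n (x : 'I_n.+1) : probability Omega R := Pr x.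

Lemma trunc_chain n (x : 'I_n.+1) : markov_chain_from (Pt n) (trunc_law x) (Phit n) x.
Proof. by have := @Phit_chain n x (ltn_ord x); rewrite inord_val. Qed.

Lemma step_ge_seq {E : countType} (p : E -> E -> R) (Q : E -> probability Omega R)
  (X : nat -> Omega -> E) (s : seq E) (f : E -> \bar R) x :
  (forall x, markov_chain_from p (Q x) X x) ->
  uniq s -> (forall y, 0 <= f y) ->
  \sum_(y <- s) (p x y)%:E * f y <= step Q X f x.
Proof.
move=> ch; elim: s f => [|z s IH] f /=; first by move=> _ f0; rewrite big_nil step_ge0.
move=> /andP[zs us] f0; rewrite big_cons.
pose f1 y := if y == z then f z else 0.
have f10 y : 0 <= f1 y by rewrite /f1; case: eqP.
have m0 y : 0 <= mask z f y by exact: mask_ge0.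
have -> : step Q X f x = step Q X f1 x + step Q X (mask z f) x.
  rewrite -(stepD ch) //; congr step; apply/funext => y; rewrite /f1 /mask.
  by case: eqP => [->|_]; rewrite ?adde0 ?add0e.
apply: leeD; first by have := step_atom ch x z f10; rewrite /f1 eqxx.
apply: le_trans (IH _ us m0); rewrite le_eqVlt; apply/orP; left; apply/eqP.
apply: eq_big_seq => y ys; rewrite /mask; case: eqP => // yz.
by rewrite -yz ys in zs.
Qed.

Lemma nat_stepE (f : nat -> \bar R) x : (forall y, 0 <= f y) ->
  step Pr Phi f x = \sum_(0 <= y <oo) (P x y)%:E * f y.
Proof.
move=> f0; rewrite (stepE Phi_chain) //; apply: eq_eseriesr => y _.
have -> : pickle_inv y = Some y by rewrite -[y in pickle_inv y]/(pickle y) pickleK_inv.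
by rewrite muleC.
Qed.

Definition liminf_gef (F : forall n, 'I_n.+1 -> \bar R) (f : nat -> \bar R) :=
  [/\ forall n y, 0 <= F n y, forall y, 0 <= f y &
      forall x, liminf_ge (fun n => F n (inord x)) (f x)].

(** Finitely many terms of the series for the infinite chain are below the step of a
    large finite chain, since the augmented truncation dominates the
    truncation. *)
Lemma liminf_gef_step F f : liminf_gef F f ->
  liminf_gef (fun n => step (@trunc_law n) (Phit n) (F n)) (step Pr Phi f).
Proof.
move=> [F0 f0 Ff]; split; [by move=> n y; exact: step_ge0|by move=> y; exact: step_ge0|].
move=> x; rewrite nat_stepE //.
apply: (@liminf_ge_series _ (fun y n => (P x y)%:E * F n (inord y))) => //.
- by move=> y n; rewrite mule_ge0 // lee_fin.
- by move=> y; rewrite mule_ge0 // lee_fin.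
- by move=> y; apply: liminf_geZ.
move=> K; near=> n.
have xn : (x <= n)%N by near: n; exact: nbhs_infty_ge.
have Kn : (K <= n)%N by near: n; exact: nbhs_infty_ge.
have us : uniq [seq (inord y : 'I_n.+1) | y <- iota 0 K].
  rewrite map_inj_in_uniq ?iota_uniq // => y z; rewrite !mem_iota !add0n /= => yK zK.
  move=> /(congr1 val) /=; rewrite !inordK // ltnS ltnW // ; exact: leq_trans Kn.
apply: le_trans (step_ge_seq (inord x) (@trunc_chain n) us (F0 n)).
rewrite big_map /index_iota subn0 !big_seq; apply: lee_sum => y.
rewrite mem_iota add0n /= => yK; apply: lee_wpmul2r => //; rewrite lee_fin.
have := @Pt_augmentation n (inord x) (inord y); rewrite mxE !inordK //.
by rewrite ltnS ltnW //; exact: leq_trans Kn.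
Unshelve. all: by end_near. Qed.

Lemma liminf_gef_mask F f : liminf_gef F f ->
  liminf_gef (fun n => mask (inord j) (F n)) (mask j f).
Proof.
move=> [F0 f0 Ff]; split; [by move=> n y; exact: mask_ge0|by move=> y; exact: mask_ge0|].
move=> x; rewrite /mask; case: eqP => xj; first by apply: liminf_ge0 => n; case: ifP.
apply: liminf_ge_le_near (Ff x) _; near=> n.
have xn : (x <= n)%N by near: n; exact: nbhs_infty_ge.
have jn : (j <= n)%N by near: n; exact: nbhs_infty_ge.
by case: eqP => // /(congr1 val) /=; rewrite !inordK.
Unshelve. all: by end_near. Qed.

Lemma liminf_gef_taboo F f : liminf_gef F f ->
  liminf_gef (fun n => taboo (@trunc_law n) (Phit n) (inord j) (F n)) (taboo Pr Phi j f).
Proof. by move=> /liminf_gef_mask /liminf_gef_step. Qed.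

Lemma liminf_gef_green F f : liminf_gef F f ->
  liminf_gef (fun n => green (@trunc_law n) (Phit n) (inord j) (F n)) (green Pr Phi j f).
Proof.
move=> Ff.
have h k : liminf_gef (fun n => iter k (taboo (@trunc_law n) (Phit n) (inord j)) (F n))
    (iter k (taboo Pr Phi j) f).
  by elim: k => //= k IH; exact: liminf_gef_taboo.
split.
- by move=> n y; apply: green_ge0; case: Ff.
- by move=> y; apply: green_ge0; case: Ff.
move=> x; rewrite /green.
apply: (@liminf_ge_series _ (fun k n => iter k (taboo (@trunc_law n) (Phit n) (inord j)) (F n) (inord x))) => //.
- by move=> k n; case: (h k).
- by move=> k; case: (h k).
- by move=> k; case: (h k).
move=> K; apply: nearW => n; apply: nneseries_lim_ge => k _ _.
by case: (h k).
Qed.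

Lemma liminf_gefD F G f g : liminf_gef F f -> liminf_gef G g ->
  liminf_gef (fun n y => F n y + G n y) (fun y => f y + g y).
Proof.
move=> [F0 f0 Ff] [G0 g0 Gg]; split; [by move=> n y; rewrite adde_ge0|by move=> y; rewrite adde_ge0|].
by move=> x; apply: liminf_geD.
Qed.

Lemma liminf_gef_mul (u : nat -> R) F f : (forall y, (0 <= u y)%R) -> liminf_gef F f ->
  liminf_gef (fun n y => (u (val y))%:E * F n y) (fun y => (u y)%:E * f y).
Proof.
move=> u0 [F0 f0 Ff]; split.
- by move=> n y; rewrite mule_ge0 // lee_fin.
- by move=> y; rewrite mule_ge0 // lee_fin.
move=> x; apply: liminf_ge_le_near (liminf_geZ (u0 x) _ (f0 x) (Ff x)) _ => //.
near=> n; rewrite /= inordK // ltnS; near: n; exact: nbhs_infty_ge.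
Unshelve. all: by end_near. Qed.

Lemma liminf_gef_fun (u : nat -> R) : (forall y, (0 <= u y)%R) ->
  liminf_gef (fun n y => (u (val y))%:E) (fun y => (u y)%:E).
Proof.
move=> u0; split; [by move=> n y; rewrite lee_fin|by move=> y; rewrite lee_fin|].
move=> x; apply: liminf_ge_cst; near=> n; rewrite /= inordK // ltnS; near: n; exact: nbhs_infty_ge.
Unshelve. all: by end_near. Qed.

End chain_limits.

(** * Convergence of the moments of cycle sums *)

Section polarisation.
Context {R : realType} {d : measure_display} {T : measurableType d}
  {E : countType} (p : E -> E -> R) (Pr : E -> probability T R)
  (X : nat -> T -> E) (l : E).
Hypothesis chain : forall x, markov_chain_from p (Pr x) X x.
Local Open Scope ereal_scope.
Local Opaque green taboo.

(** The value at the starting point of the Green function of [cross u v + cross v u]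
    is twice the mean of the product of the cycle sums of [u] and [v]; on the
    diagonal this is [integral_zeta_sqr]. *)
Definition cross (u v : E -> R) (y : E) : \bar R :=
  (u y)%:E * ((v y)%:E + 2%:E * taboo Pr X l (green Pr X l (EFin \o v)) y).

Lemma cross_ge0 u v y : (forall z, 0 <= u z)%R -> (forall z, 0 <= v z)%R -> 0 <= cross u v y.
Proof.
move=> u0 v0; rewrite mule_ge0 ?lee_fin // adde_ge0 ?lee_fin // mule_ge0 ?lee_fin //.
by apply: taboo_ge0 => z; apply: green_ge0 => t; rewrite lee_fin.
Qed.

Lemma green_cross_split (u v w : E -> R) x : (forall z, 0 <= u z)%R ->
  (forall z, 0 <= v z)%R -> (forall z, w z = u z + v z)%R ->
  green Pr X l (cross w w) x = green Pr X l (cross u u) x +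
    green Pr X l (fun y => cross v v y + (cross u v y + cross v u y)) x.
Proof.
move=> u0 v0 wE; rewrite -(greenD chain) /=; last 2 first.
- by move=> y; exact: cross_ge0.
- by move=> y; rewrite !adde_ge0 ?cross_ge0.
congr green; apply/funext => y.
have -> : w = (fun z => u z + v z)%R by apply/funext.
rewrite /cross.
have G0 (f : E -> R) z : (forall z, 0 <= f z)%R -> 0 <= green Pr X l (EFin \o f) z.
  by move=> f0; apply: green_ge0 => t; rewrite lee_fin.
have -> : green Pr X l (EFin \o (fun z => u z + v z)%R) =
    (fun z => green Pr X l (EFin \o u) z + green Pr X l (EFin \o v) z).
  apply/funext => z; rewrite -(greenD chain) => [|t|t]; rewrite ?lee_fin //.
have -> : taboo Pr X l (green Pr X l (EFin \o u) \+ green Pr X l (EFin \o v)) y =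
    taboo Pr X l (green Pr X l (EFin \o u)) y + taboo Pr X l (green Pr X l (EFin \o v)) y.
  by rewrite -(tabooD chain) // => z; exact: G0.
have T0 (f : E -> R) : (forall z, 0 <= f z)%R -> 0 <= taboo Pr X l (green Pr X l (EFin \o f)) y.
  by move=> f0; apply: taboo_ge0 => z; exact: G0.
move: (taboo _ _ _ _ _) (taboo _ _ _ _ _) (T0 v v0) (T0 u u0) (u0 y) (v0 y) => b a b0 a0.
move: (u y) (v y) => r s r0 s0.
have R0 : 0 <= r%:E by rewrite lee_fin.
have S0 : 0 <= s%:E by rewrite lee_fin.
have A0 : 0 <= r%:E + 2%:E * b by rewrite adde_ge0 ?mule_ge0.
have B0 : 0 <= s%:E + 2%:E * a by rewrite adde_ge0 ?mule_ge0.
rewrite EFinD (ge0_muleDr 2%:E a0 b0) addeACA.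
rewrite (ge0_muleDl _ R0 S0) !(ge0_muleDr _ A0 B0) -addeA; congr (_ + _).
by rewrite addeA addeC.
Qed.

End polarisation.

Section moment_convergence.
Context {R : realType} {d : measure_display} {Omega : measurableType d}
  (Pr : nat -> probability Omega R) (P : nat -> nat -> R) (Phi : nat -> Omega -> nat)
  (j : nat) (Pt : forall n, 'M[R]_n.+1) (Phit : forall n, nat -> Omega -> 'I_n.+1).
Hypothesis P_ge0 : forall x y, 0 <= P x y.
Hypothesis Phi_chain : forall i, markov_chain_from P (Pr i) Phi i.
Hypothesis Pt_augmentation :
  forall n (i k : 'I_n.+1), nw_truncation P n i k <= Pt n i k.
Hypothesis Phit_chain : forall n i, (i <= n)%N ->
  markov_chain_from (Pt n) (Pr i) (Phit n) (inord i).
Local Open Scope ereal_scope.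
Local Notation zetat n u := (zeta (Phit n) (inord j) (fun y : 'I_n.+1 => u (val y))).
Variable V : nat -> R.
Hypothesis V1 : forall y, (1 <= V y)%R.
Hypothesis V_sqr : \int[Pr j]_w (zeta Phi j V w ^+ 2) < +oo.
Hypothesis zeta_dominated : {ae Pr j, forall w, forall n, (j <= n)%N ->
  zetat n V w <= zeta Phi j V w}.
Hypothesis zeta_converges : {ae Pr j, forall w,
  zetat n V w @[n --> \oo] --> zeta Phi j V w}.

Let V0 y : (0 <= V y)%R. Proof. exact: le_trans ler01 (V1 y). Qed.
Let mX : forall k x, measurable [set w | Phi k w = x].
Proof. by case: (Phi_chain j) => [[]]. Qed.
Let tchain n (x : 'I_n.+1) : markov_chain_from (Pt n) (trunc_law Pr x) (Phit n) x.
Proof. exact: trunc_chain. Qed.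
Let mXt n : forall k x, measurable [set w | Phit n k w = x].
Proof. by case: (@tchain n ord0) => [[]]. Qed.

Let measurable_sqr (F : Omega -> \bar R) : measurable_fun setT F ->
  measurable_fun setT (fun w => F w ^+ 2).
Proof.
move=> mF; rewrite (_ : (fun w => F w ^+ 2) = (F \* F)); first exact: emeasurable_funM.
by apply/funext => w; rewrite expe2.
Qed.

Lemma trunc_lawE n : (j <= n)%N -> trunc_law Pr (inord j : 'I_n.+1) = Pr j.
Proof. by move=> jn; rewrite /trunc_law /= inordK. Qed.

Let mz : measurable_fun setT (zeta Phi j V). Proof. exact: measurable_zeta. Qed.
Let mzt n : measurable_fun setT (zetat n V). Proof. by apply: measurable_zeta => //; exact: mXt. Qed.
Let z_ge0 w : 0 <= zeta Phi j V w. Proof. exact: zeta_ge0. Qed.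
Let zt_ge0 n w : 0 <= zetat n V w. Proof. exact: zeta_ge0. Qed.

Let int_sqr : (Pr j).-integrable setT (fun w => zeta Phi j V w ^+ 2).
Proof.
apply/integrableP; split; first exact: measurable_sqr.
rewrite (eq_integral (fun w => zeta Phi j V w ^+ 2)) // => w _.
by rewrite gee0_abs // expe_ge0.
Qed.

Let zeta_le_sqr w : zeta Phi j V w <= zeta Phi j V w ^+ 2.
Proof.
have h : 1 <= zeta Phi j V w.
  apply: le_trans (nneseries_ge_term 0 _); first by rewrite /cycle_term /= lee_fin.
  by move=> k; rewrite lee_fin cycle_term_ge0.
by rewrite expe2 -{1}[zeta _ _ _ _]mule1; apply: lee_wpmul2l.
Qed.

Let int_zeta : (Pr j).-integrable setT (zeta Phi j V).
Proof.
apply: le_integrable int_sqr => // w _; rewrite !gee0_abs ?expe_ge0 //.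
Qed.

Let sqr_dominated : {ae Pr j, forall w, forall n, setT w ->
  `|zetat (n + j)%N V w ^+ 2| <= zeta Phi j V w ^+ 2}.
Proof.
apply: filterS zeta_dominated => w h n _; rewrite gee0_abs ?expe_ge0 // !expe2.
by apply: lee_pmul => //; apply: h; rewrite leq_addl.
Qed.

Let sqr_converges : {ae Pr j, forall w, setT w ->
  zetat (n + j)%N V w ^+ 2 @[n --> \oo] --> zeta Phi j V w ^+ 2}.
Proof.
have fin : {ae Pr j, forall w, zeta Phi j V w \is a fin_num}.
  by apply: filterS (integrable_ae measurableT int_zeta) => w; apply.
apply: filterS2 fin zeta_converges => w fw h _.
rewrite expe2; under eq_fun do rewrite expe2.
have h' : zetat (n + j)%N V w @[n --> \oo] --> zeta Phi j V w.
  by apply: (cvg_comp _ _ _ h); exact: cvg_addnr.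
by apply: cvgeM => //; exact: mule_def_fin.
Qed.

Let sqr_cvg : \int[Pr j]_w (zetat n V w ^+ 2) @[n --> \oo] -->
  \int[Pr j]_w (zeta Phi j V w ^+ 2).
Proof.
rewrite -(cvg_shiftn j).
have [_ _] := dominated_convergence measurableT (fun n => measurable_sqr (mzt (n + j)))
  (measurable_sqr mz) sqr_converges int_sqr sqr_dominated.
by [].
Qed.

Let mean_cvg : \int[Pr j]_w zetat n V w @[n --> \oo] --> \int[Pr j]_w zeta Phi j V w.
Proof.
rewrite -(cvg_shiftn j).
have h1 : {ae Pr j, forall w, setT w ->
  zetat (n + j)%N V w @[n --> \oo] --> zeta Phi j V w}.
  apply: filterS zeta_converges => w h _.
  by apply: (cvg_comp _ _ _ h); exact: cvg_addnr.
have h2 : {ae Pr j, forall w, forall n, setT w ->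
  `|zetat (n + j)%N V w| <= zeta Phi j V w}.
  by apply: filterS zeta_dominated => w h n _; rewrite gee0_abs //; apply: h; rewrite leq_addl.
by have [_ _] := dominated_convergence measurableT (fun n => mzt (n + j)) mz h1 int_zeta h2.
Qed.

Variable u : nat -> R.
Hypothesis u_V : forall y, (0 <= u y <= V y)%R.
Let v y := (V y - u y)%R.
Let u0 y : (0 <= u y)%R. Proof. by case/andP: (u_V y). Qed.
Let v0 y : (0 <= v y)%R. Proof. by rewrite subr_ge0; case/andP: (u_V y). Qed.
Let Vuv y : V y = (u y + v y)%R. Proof. by rewrite addrC subrK. Qed.
Let ut n (y : 'I_n.+1) := u (val y).
Let vt n (y : 'I_n.+1) := v (val y).
Let Vt n (y : 'I_n.+1) := V (val y).

Local Notation G := (green Pr Phi j).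
Local Notation Gt n := (green (@trunc_law _ _ _ Pr n) (Phit n) (inord j)).
Local Notation crosst n := (cross (@trunc_law _ _ _ Pr n) (Phit n) (inord j)).

Let liminf_ge_cross (a b : nat -> R) : (forall y, 0 <= a y)%R -> (forall y, 0 <= b y)%R ->
  liminf_gef (fun n => crosst n (fun y => a (val y)) (fun y => b (val y))) (cross Pr Phi j a b).
Proof.
move=> a0 b0; apply: liminf_gef_mul => //; apply: liminf_gefD; first exact: liminf_gef_fun.
apply: (liminf_gef_mul (u := fun=> 2%R)) => //.
by apply: liminf_gef_taboo => //; apply: liminf_gef_green => //; exact: liminf_gef_fun.
Qed.

Let squeeze (a b s : nat -> \bar R) (A B S : \bar R) : (forall n, 0 <= a n) ->
  (forall n, 0 <= b n) -> 0 <= A -> 0 <= B -> liminf_ge a A -> liminf_ge b B ->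
  (forall n, s n = a n + b n) -> S = A + B -> S < +oo -> s n @[n --> \oo] --> S ->
  fine (a n) @[n --> \oo] --> fine A.
Proof.
move=> a0 b0 A0 B0 aA bB sab SAB Sfin.
have Afin : A \is a fin_num.
  by rewrite ge0_fin_numE //; apply: le_lt_trans Sfin; rewrite SAB leeDl.
have Bfin : B \is a fin_num.
  by rewrite ge0_fin_numE //; apply: le_lt_trans Sfin; rewrite SAB leeDr.
rewrite SAB -{1}(fineK Afin) -{1}(fineK Bfin) -EFinD => c.
have sab' : \forall n \near \oo, s n = a n + b n by exact: nearW.
by apply: liminf_ge_squeeze sab' c => //; rewrite fineK.
Qed.

Lemma cycle_sum_mean_cvg :
  cycle_sum_mean (@trunc_law _ _ _ Pr n) (Phit n) (inord j) (fun y : 'I_n.+1 => u (val y))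
    @[n --> \oo] --> cycle_sum_mean Pr Phi j u.
Proof.
have VE : G (EFin \o V) j = G (EFin \o u) j + G (EFin \o v) j.
  rewrite -(greenD Phi_chain) => [|y|y]; rewrite ?lee_fin //.
  by congr green; apply/funext => y /=; rewrite Vuv EFinD.
have VEt n : Gt n (EFin \o @Vt n) (inord j) =
    Gt n (EFin \o @ut n) (inord j) + Gt n (EFin \o @vt n) (inord j).
  rewrite -(greenD (@tchain n)) => [|y|y]; rewrite ?lee_fin ?/ut ?/vt //.
  by congr green; apply/funext => y /=; rewrite /Vt Vuv EFinD.
have liminf_geG (a : nat -> R) : (forall y, 0 <= a y)%R ->
    liminf_gef (fun n => Gt n (fun y => (a (val y))%:E)) (G (EFin \o a)).
  by move=> a0; apply: liminf_gef_green => //; exact: liminf_gef_fun.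
have [gu gu' gu''] := liminf_geG u u0; have [gv gv' gv''] := liminf_geG v v0.
apply: (squeeze (fun n => gu n (inord j)) (fun n => gv n (inord j)) (gu' j) (gv' j)
  (gu'' j) (gv'' j) VEt VE).
- rewrite -(integral_zeta Phi_chain) //.
  have /integrableP[_] := int_zeta; rewrite (eq_integral (zeta Phi j V)) // => w _.
  by rewrite gee0_abs.
rewrite -(integral_zeta Phi_chain) //.
apply: cvg_trans mean_cvg; apply: near_eq_cvg; near=> n.
rewrite -(integral_zeta (@tchain n)) //; last 2 first.
- exact: mXt.
- by move=> y; rewrite /Vt.
rewrite trunc_lawE //; near: n; exact: nbhs_infty_ge.
Unshelve. all: by end_near. Qed.

(** The moments for [u] and the complementary expression both stay above their
    limits, and their sum, the moment for [V], converges to the sum of the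
    limits. *)
Lemma cycle_sqr_cvg :
  cycle_sqr (@trunc_law _ _ _ Pr n) (Phit n) (inord j) (fun y : 'I_n.+1 => u (val y))
    @[n --> \oo] --> cycle_sqr Pr Phi j u.
Proof.
rewrite /cycle_sqr (integral_zeta_sqr Phi_chain mX) //.
under eq_fun => n do rewrite (integral_zeta_sqr (@tchain n) (@mXt n)) //.
have VE := green_cross_split j Phi_chain j u0 v0 Vuv.
have VEt n := green_cross_split (inord j) (@tchain n) (inord j) (fun y => u0 (val y)) (fun y => v0 (val y)) (fun y : 'I_n.+1 => Vuv (val y)).
have [gu gu' gu''] := liminf_gef_green j P_ge0 Phi_chain Pt_augmentation Phit_chain (liminf_ge_cross u0 u0).
have liminf_geB := liminf_gefD (liminf_ge_cross v0 v0) (liminf_gefD (liminf_ge_cross u0 v0) (liminf_ge_cross v0 u0)).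
have [gv gv' gv''] := liminf_gef_green j P_ge0 Phi_chain Pt_augmentation Phit_chain liminf_geB.
apply: (squeeze (fun n => gu n (inord j)) (fun n => gv n (inord j)) (gu' j) (gv' j)
  (gu'' j) (gv'' j) VEt VE).
- by rewrite -(integral_zeta_sqr Phi_chain mX).
rewrite -(integral_zeta_sqr Phi_chain mX) //.
apply: cvg_trans sqr_cvg; apply: near_eq_cvg; near=> n.
rewrite -(integral_zeta_sqr (@tchain n) (@mXt n)) //.
rewrite trunc_lawE //; near: n; exact: nbhs_infty_ge.
Unshelve. all: by end_near. Qed.

End moment_convergence.

(** * Change of the base state *)

Section change_of_base_state.
Context {R : realType} {d : measure_display} {T : measurableType d}
  {E : countType} (p : E -> E -> R) (Pr : E -> probability T R)
  (X : nat -> T -> E).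
Hypothesis chain : forall x, markov_chain_from p (Pr x) X x.
Local Open Scope ereal_scope.
Local Notation A l u := (green Pr X l u).
Local Notation Tb l f := (taboo Pr X l f).
Local Opaque green taboo.

(** A path of positive probability from [a] to [b] that does not enter [r] after its
    start, stated through its effect on nonnegative functions. *)
Definition reaches_avoiding (r a b : E) := exists k, exists2 c : R, (0 < c)%R &
  forall f : E -> \bar R, (forall y, 0 <= f y) -> c%:E * f b <= iter k (taboo Pr X r) f a.

Let mX : forall (x : E) k y, measurable [set w | X k w = y].
Proof. by move=> x; case: (chain x) => [[]]. Qed.

Lemma iter_taboo_green_le l u k x : (forall y, 0 <= u y) ->
  iter k (taboo Pr X l) (A l u) x <= A l u x.
Proof.
move=> u0; elim: k x => //= k IH x.
apply: le_trans (taboo_green_le chain l x u0); apply: (le_taboo chain) => // y.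
by apply: iter_taboo_ge0 => z; exact: green_ge0.
Qed.

(** The chain collects [green r u b] with positive probability before it enters
    [r]. *)
Lemma green_reached (r a b : E) u : reaches_avoiding r a b -> (forall y, 0 <= u y) ->
  A r u a < +oo -> A r u b < +oo.
Proof.
move=> [k [c c0 h]] u0 fin; have G0 y : 0 <= A r u y by exact: green_ge0.
have := le_trans (h _ G0) (iter_taboo_green_le r k a u0) => hc.
rewrite ltNge; apply/negP; rewrite leye_eq => /eqP e; move: hc.
by rewrite e gt0_muley ?lte_fin // leye_eq => /eqP ea; rewrite ea ltxx in fin.
Qed.

Variables l j : E.
Hypothesis j_to_l : reaches_avoiding j j l.
Hypothesis l_to_j : reaches_avoiding l l j.
Hypothesis j_positive : A j (cst 1) j < +oo.

Let at_l (y : E) : \bar R := if y == l then 1 else 0.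
Let at_l0 y : 0 <= at_l y. Proof. by rewrite /at_l; case: eqP. Qed.

(** By the maximum principle it suffices to start at [l], and [l] is reached from
    [j], where the mean cycle length is finite. *)
Let visits_bounded : exists2 C : R, (0 <= C)%R & forall x, A j at_l x <= C%:E.
Proof.
have fin : A j at_l l < +oo.
  apply: (green_reached j_to_l) => //; apply: le_lt_trans j_positive.
  by apply: (le_green chain) => // y; rewrite /at_l; case: eqP.
have G0 y : 0 <= A j at_l y by exact: green_ge0.
have fin' : A j at_l l \is a fin_num by rewrite ge0_fin_numE.
exists (fine (A j at_l l)); first by rewrite fine_ge0.
move=> x; rewrite fineK //; apply: (green_max chain (A := [set l])) => //.
- by move=> y /= yl; rewrite /at_l; case: eqP.
- by move=> y /= ->.
Qed.

(** A cycle at [j] is covered by the path up to the first visit to [l] and by one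
    cycle at [l] for each visit to [l] during the cycle at [j]. *)
Lemma green_change_base u x : (forall y, 0 <= u y) ->
  A j u x <= A l u x + A l u l * A j at_l x.
Proof.
move=> u0; set a := A l u l.
have Al0 y : 0 <= A l u y by exact: green_ge0.
have Gj0 y : 0 <= A j at_l y by exact: green_ge0.
pose B y := Tb j (A j at_l) y.
have B0 y : 0 <= B y by exact: taboo_ge0.
apply: (@le_trans _ _ (A l u x + a * B x)); last first.
  by apply: leeD2l; apply: lee_wpmul2l; [exact: Al0|exact: (taboo_green_le chain j x at_l0)].
apply: (green_min chain (U := fun y => A l u y + a * B y)) => // y.
  by apply: adde_ge0; [exact: Al0|apply: mule_ge0; [exact: Al0|exact: B0]].
have aB0 z : 0 <= a * B z by apply: mule_ge0; [exact: Al0|exact: B0].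
rewrite (tabooD chain) //.
rewrite (tabooZ chain j y B0 (Al0 l)) (greenE chain l y u0) -(addeA (u y)).
apply: leeD2l.
have -> : B y = Tb j at_l y + Tb j B y.
  rewrite -(tabooD chain) //; apply: eq_taboo => z.
  exact: (greenE chain).
have t1 : 0 <= Tb j at_l y by exact: taboo_ge0.
have t2 : 0 <= Tb j B y by exact: taboo_ge0.
rewrite (ge0_muleDr _ t1 t2) -/a.
rewrite addeA leeD2r //.
have m0 z : 0 <= mask j at_l z by exact: mask_ge0.
have m0' z : 0 <= mask l (A l u) z by exact: mask_ge0.
Local Transparent taboo.
have am0 z : 0 <= a * mask j at_l z by apply: mule_ge0; [exact: Al0|exact: m0].
have -> : a * Tb j at_l y = step Pr X (fun z => a * mask j at_l z) y.
  by rewrite (stepZ chain _ m0 (Al0 l)).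
rewrite /taboo -(stepD chain) //.
apply: (le_step chain) => z; first exact: mask_ge0.
rewrite /mask /at_l; case: (z =P j) => [->|zj].
  by rewrite mule0 adde0; case: ifP.
case: (z =P l) => [->|_]; first by rewrite mule1 add0e.
by rewrite mule0 adde0.
Local Opaque taboo.
Qed.

(** By [integral_zeta_sqr] the second moment is comparable with the Green function
    of [W * green W], to which [green_change_base] applies twice. *)
Lemma zeta_sqr_change_base (W : E -> R) : (forall y, (1 <= W y)%R) ->
  \int[Pr l]_w (zeta X l W w ^+ 2) < +oo -> \int[Pr j]_w (zeta X j W w ^+ 2) < +oo.
Proof.
move=> W1 finl; have W0 y : (0 <= W y)%R by exact: le_trans ler01 (W1 y).
have [C C0 hC] := visits_bounded.
pose V := EFin \o W; have V0 y : 0 <= V y by rewrite lee_fin.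
have V1 y : 1 <= V y by rewrite lee_fin.
have GV0 r y : 0 <= A r V y by exact: green_ge0.
have finWA : A l (fun y => V y * A l V y) l < +oo.
  apply: le_lt_trans finl; rewrite (integral_zeta_sqr chain (mX l)) //.
  apply: (le_green chain) => y; first by rewrite mule_ge0.
  apply: lee_wpmul2l => //; rewrite [leLHS](greenE chain) //; apply: leeD2l.
  have t0 : 0 <= Tb l (A l V) y by exact: taboo_ge0.
  by rewrite -[leLHS]mul1e; apply: lee_wpmul2r => //; rewrite lee_fin ler1n.
have finA : A l V l < +oo.
  apply: le_lt_trans finWA; apply: (le_green chain) => // y.
  rewrite -[leLHS]mule1; apply: lee_wpmul2l => //.
  by apply: le_trans (V1 y) _; exact: (le_green_ge chain).
pose K := A l V l * C%:E.
have K0 : 0 <= K by rewrite mule_ge0 ?lee_fin.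
have Kfin : K < +oo.
  by rewrite /K -(fineK (_ : A l V l \is a fin_num)) ?ge0_fin_numE // -EFinM ltry.
have AjV y : A j V y <= A l V y + K.
  apply: le_trans (green_change_base y V0) _.
  by rewrite leeD2l //; apply: lee_wpmul2l => //; exact: hC.
pose F y := V y * (A l V y + K).
have F0 y : 0 <= F y by rewrite mule_ge0 // adde_ge0.
have Fl : A l F l < +oo.
  have -> : A l F l = A l (fun y => V y * A l V y) l + K * A l V l.
    rewrite -(greenZ chain) // -(greenD chain) //.
    - by congr green; apply/funext => y; rewrite /F ge0_muleDr // [K * _]muleC.
    - by move=> y; rewrite mule_ge0.
    - by move=> y; rewrite mule_ge0.
  apply: lte_add_pinfty => //.
  rewrite -(fineK (_ : A l V l \is a fin_num)) ?ge0_fin_numE //.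
  by rewrite -(fineK (_ : K \is a fin_num)) ?ge0_fin_numE // -EFinM ltry.
have Fj : A l F j < +oo by exact: green_reached Fl.
have FJ : A j F j < +oo.
  apply: le_lt_trans (green_change_base j F0) _; apply: lte_add_pinfty => //.
  have Fl0 : 0 <= A l F l by exact: green_ge0.
  apply: (@le_lt_trans _ _ (A l F l * C%:E)); first by apply: lee_wpmul2l.
  by rewrite -(fineK (_ : A l F l \is a fin_num)) ?ge0_fin_numE // -EFinM ltry.
rewrite (integral_zeta_sqr chain (mX j)) //.
apply: (@le_lt_trans _ _ (A j (fun y => 2%:E * F y) j)); last first.
  by rewrite (greenZ chain) // lte_mul_pinfty // lee_fin.
apply: (le_green chain) => y.
  have t0 : 0 <= Tb j (A j (EFin \o W)) y by apply: taboo_ge0 => z; exact: GV0.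
  by apply: mule_ge0; [exact: V0|apply: adde_ge0; [exact: V0|exact: mule_ge0]].
rewrite /F muleCA; apply: lee_wpmul2l; first exact: V0.
apply: (@le_trans _ _ (2%:E * A j V y)); last by apply: lee_wpmul2l.
have t0 : 0 <= Tb j (A j V) y by apply: taboo_ge0 => z; exact: GV0.
rewrite (greenE chain j y V0) (ge0_muleDr _ (V0 y) t0).
by apply: leeD2r; rewrite -EFinM lee_fin; have := W0 y; lra.
Qed.

End change_of_base_state.

Section irreducibility.
Context {R : realType} {d : measure_display} {T : measurableType d}
  (P : nat -> nat -> R) (Pr : nat -> probability T R) (X : nat -> T -> nat).
Hypothesis chain : forall x, markov_chain_from P (Pr x) X x.
Hypothesis P_ge0 : forall x y, 0 <= P x y.
Hypothesis P_irreducible : irreducible P.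

(** After its last visit to [r], a path of positive probability from [r] to [b]
    avoids [r]; the induction on the length keeps track of a path from the
    current state or, once [r] has been met, of one from [r]. *)
Lemma irreducible_reaches r b : b != r -> reaches_avoiding Pr X r r b.
Proof.
move=> br.
suff h k a : (0 < nstep P k a b)%E ->
    reaches_avoiding Pr X r a b \/ reaches_avoiding Pr X r r b.
  by have [k /h[]] := P_irreducible r b.
have nstep_ge0 n x y : (0 <= nstep P n x y)%E.
  elim: n x => [|n IH] x /=; first by rewrite lee_fin.
  by apply: nneseries_ge0 => m _ _; rewrite mule_ge0 // lee_fin.
elim: k a => [|k IH] a /=.
  rewrite lte_fin; case: eqP => [->|_]; last by rewrite ltxx.
  by move=> _; left; exists 0%N, 1 => // f f0; rewrite mul1e.
move=> h; have [m hm] : exists m, (0 < (P a m)%:E * nstep P k m b)%E.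
  apply/not_existsP => n0; move: h; apply/negP; rewrite -leNgt eseries0 // => m _ _.
  apply/eqP; rewrite eq_le mule_ge0 ?lee_fin // andbT leNgt; apply/negP; exact: n0.
have Pm : 0 < P a m.
  rewrite lt0r P_ge0 andbT; apply/eqP => P0; move: hm; by rewrite P0 mul0e ltxx.
have nm : (0 < nstep P k m b)%E.
  rewrite lt0e nstep_ge0 andbT; apply/eqP => P0; move: hm; by rewrite P0 mule0 ltxx.
case: (IH m nm) => [|rb]; last by right.
case: (m =P r) => [->|/eqP mr]; first by right.
move=> [n [c c0 hc]]; left; exists n.+1, (P a m * c); first exact: mulr_gt0.
move=> f f0; rewrite EFinM -muleA /=.
set F := iter n _ f; have F0 y : (0 <= F y)%E by exact: iter_taboo_ge0.
apply: (@le_trans _ _ ((P a m)%:E * F m)%E).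
  by apply: lee_wpmul2l; [rewrite lee_fin|exact: hc].
have := step_atom chain a m (fun y => mask_ge0 r y F0).
by rewrite /mask (negbTE mr).
Qed.

End irreducibility.

(** * Return times as cycle sums *)

Section return_times.
Context {R : realType} {d : measure_display} {T : measurableType d} {E : countType}.
Variables (X : nat -> T -> E) (l : E) (w : T).

(** This turns the summation range of [cycle_sum] into the test that defines
    [zeta]. *)
Lemma lt_return_time k : (((k%:R)%:E : \bar R) < return_time X l w)%E = avoids X l 0 k w.
Proof.
apply/idP/idP => [h|/allP h].
  apply/allP => i; rewrite mem_iota => /andP[i0 ik]; apply/eqP => Xi; move: h; apply/negP.
  rewrite -leNgt; apply: (@le_trans _ _ ((i%:R)%:E)).
    by apply: ereal_inf_lbound; exists i.
  by rewrite lee_fin ler_nat; move: ik; rewrite add1n ltnS.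
apply: (@lt_le_trans _ _ ((k.+1%:R)%:E)); first by rewrite lte_fin ltr_nat.
apply/ereal_infP => _ [i [i0 Xi] <-]; rewrite lee_fin ler_nat ltnNge.
apply/negP => ik; have := h i; rewrite mem_iota i0 add1n ltnS ik Xi eqxx.
by move=> /(_ isT).
Qed.

Lemma cycle_sumE (h : E -> R) : cycle_sum X l h w = zeta X l h w.
Proof.
rewrite /cycle_sum eseries_mkcond /zeta; apply: eq_eseriesr => k _.
by rewrite lt_return_time /cycle_term; case: ifP.
Qed.

Lemma return_timeE : return_time X l w = zeta X l (cst 1 : E -> R) w.
Proof.
have [[k [k1 Xk]]|none] := pselect (exists k, (1 <= k)%N /\ X k w = l).
  have ex : exists k, (1 <= k)%N && (X k w == l) by exists k; rewrite k1 Xk eqxx.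
  have [N /andP[N1 /eqP XN] Nmin] := ex_minnP ex.
  have aN i : avoids X l 0 i w = (i < N)%N.
    apply/idP/idP => [/allP h|iN].
      rewrite ltnNge; apply/negP => Ni; have := h N; rewrite mem_iota N1 add1n ltnS Ni XN eqxx.
      by move=> /(_ isT).
    apply/allP => k'; rewrite mem_iota add1n ltnS => /andP[k0 ki]; apply/eqP => Xk'.
    have := Nmin k'; rewrite k0 Xk' eqxx => /(_ isT) Nk.
    by have := leq_trans Nk ki; rewrite leqNgt iN.
  transitivity ((N%:R)%:E : \bar R).
    apply/eqP; rewrite eq_le; apply/andP; split; first by apply: ereal_inf_lbound; exists N.
    apply/ereal_infP => _ [i [i1 Xi] <-]; rewrite lee_fin ler_nat; apply: Nmin.
    by rewrite i1 Xi eqxx.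
  rewrite /zeta (nneseries_shift N); last by move=> k'; rewrite lee_fin cycle_term_ge0.
  rewrite [X in (_ + X)%E]eseries0 ?adde0; last first.
    by move=> i _ _; rewrite /cycle_term aN ltnNge leq_addl.
  rewrite (eq_big_nat _ _ (F2 := fun=> 1%E)); last first.
    by move=> i /andP[_ iN]; rewrite /cycle_term aN iN.
  by rewrite sumEFin sumr_const_nat subn0.
have av i : avoids X l 0 i w.
  apply/allP => k; rewrite mem_iota => /andP[k0 _]; apply/eqP => Xk.
  by apply: none; exists k.
transitivity (+oo%E : \bar R).
  rewrite /return_time (_ : [set _ | _ in _] = set0) ?ereal_inf0 //.
  rewrite -subset0 => x [k [k1 Xk] _]; by apply: none; exists k.
apply/esym/eq_infty => t.
apply: (@le_trans _ _ (((Num.truncn t).+1%:R)%:E)).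
  by rewrite lee_fin ltW // truncnS_gt.
apply: le_trans (nneseries_lim_ge (Num.truncn t).+1 _); last first.
  by move=> k _ _; rewrite lee_fin cycle_term_ge0.
rewrite (eq_bigr (fun=> 1%E)); last by move=> i _; rewrite /cycle_term av.
by rewrite sumEFin sumr_const_nat subn0.
Qed.

End return_times.

Lemma increases_to_le {R : realType} (u : nat -> \bar R) m l n :
  increases_to u m l -> (m <= n)%N -> (u n <= l)%E.
Proof.
move=> [inc ul] mn; rewrite -(cvg_lim (@ereal_hausdorff R) ul).
apply: lime_ge; first by apply/cvg_ex; exists l.
near=> k; apply: inc => //; near: k; exact: nbhs_infty_ge.
Unshelve. all: by end_near. Qed.

Lemma zeta_return_time {R : realType} {d : measure_display} {T : measurableType d}
    {E : countType} (X : nat -> T -> E) (l : E) (u : E -> R) w :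
  (forall y, 0 <= u y) ->
  zeta X l (fun y => 1 + u y) w = (return_time X l w + cycle_sum X l u w)%E.
Proof. by move=> u0; rewrite return_timeE cycle_sumE -zetaD. Qed.

Lemma sqr_addE_le {R : realType} (x y : \bar R) : (0 <= x)%E -> (0 <= y)%E ->
  ((x + y) ^+ 2 <= 2%:E * x ^+ 2 + 2%:E * y ^+ 2)%E.
Proof.
have yy : (2%:E * +oo ^+ 2 = +oo :> \bar R)%E by rewrite expe2 mulyy gt0_muley // lte_fin.
case: x y => [x| |] [y| |] // x0 y0; rewrite ?yy.
- by rewrite !expe2 -EFinD -!EFinM -EFinD lee_fin; have := sqr_ge0 (x - y); nra.
- by rewrite addey ?leey // expe2 -!EFinM.
- by rewrite addye ?leey // expe2 -!EFinM.
- by rewrite addye ?leey.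
Qed.

Lemma cvg_variance_formula {R : realType} (a b ab a1 b1 o mi c : nat -> R)
    (a' b' ab' a1' b1' o' mi' c' : R) :
  mi n @[n --> \oo] --> mi' -> c n @[n --> \oo] --> c' ->
  a n @[n --> \oo] --> a' -> b n @[n --> \oo] --> b' ->
  ab n @[n --> \oo] --> ab' -> a1 n @[n --> \oo] --> a1' ->
  b1 n @[n --> \oo] --> b1' -> o n @[n --> \oo] --> o' ->
  mi n * (2 * a n + 2 * b n - ab n - c n * ((a1 n - a n) - (b1 n - b n)) + c n ^+ 2 * o n)
    @[n --> \oo] -->
  mi' * (2 * a' + 2 * b' - ab' - c' * ((a1' - a') - (b1' - b')) + c' ^+ 2 * o').
Proof.
move=> cm cc ca cb cab ca1 cb1 co.
apply: (cvgM cm); apply: cvgD; last first.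
  by apply: cvgM co; rewrite expr2; exact: cvgM.
apply: cvgB; last by apply: (cvgM cc); apply: cvgB; exact: cvgB.
by apply: cvgB cab; apply: cvgD; exact: cvgMr.
Qed.

Theorem theorem3p2 (R : realType) (d : measure_display)
  (Omega : measurableType d) (Pr : nat -> probability Omega R)
  (P : nat -> nat -> R) (Phi : nat -> Omega -> nat) (pi g : nat -> R) (j : nat)
  (Pt : forall n : nat, 'M[R]_n.+1) (pit : forall n : nat, 'rV[R]_n.+1)
  (Phit : forall n : nat, nat -> Omega -> 'I_n.+1)
  (P_stochastic : stochastic P)
  (P_irreducible : irreducible P)
  (Phi_chain : forall i, markov_chain_from P (Pr i) Phi i)
  (Phi_positive_recurrent :
    forall i, (\int[Pr i]_w return_time Phi i w < +oo)%E)
  (pi_invariant : invariant_prob P pi)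
  (pi_g : cvgn (series (fun i => pi i * `|g i|)))
  (Pt_stochastic : forall n, stochastic_mx (Pt n))
  (Pt_augmentation : forall n (i k : 'I_n.+1), nw_truncation P n i k <= Pt n i k)
  (pit_invariant : forall n, unique_invariant_prob_mx (Pt n) (pit n))
  (Phit_chain : forall n i, (i <= n)%N ->
    markov_chain_from (Pt n) (Pr i) (Phit n) (inord i))
  (tau_increases : forall i, {ae Pr i, forall w,
    increases_to (fun n => return_time (Phit n) (inord j) w) (maxn i j)
      (return_time Phi j w : \bar R)})
  (zeta_increases : forall i, {ae Pr i, forall w,
    increases_to
      (fun n => cycle_sum (Phit n) (inord j)
                  (fun x => `|trunc_vec g n ord0 x|) w)
      (maxn i j)
      (cycle_sum Phi j (fun x => `|g x|) w)})
  (second_moments : exists l,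
    (\int[Pr l]_w (return_time Phi l w ^+ 2) < +oo)%E /\
    (\int[Pr l]_w (cycle_sum Phi l (fun x => `|centered pi g x|%R) w ^+ 2)
       < +oo)%E)
  (sigma2 : R) (sigma2t : nat -> R)
  (sigma2_clt : clt_variance P (centered pi g) sigma2)
  (sigma2t_clt : forall n, (j <= n)%N ->
    clt_variance (Pt n)
      (fun x => centered_rV (pit n) (trunc_vec g n) ord0 x) (sigma2t n)) :
  sigma2t @ \oo --> sigma2.

Proof.
have P_ge0 x y : 0 <= P x y by case: (P_stochastic x).
have mX k x : measurable [set w | Phi k w = x] by case: (Phi_chain j) => [[]].
have msqr (F : Omega -> \bar R) : measurable_fun setT F ->
    measurable_fun setT (fun w => F w ^+ 2)%E.
  move=> mF; rewrite (_ : (fun w => _) = (F \* F)%E); first exact: emeasurable_funM.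
  by apply/funext => w; rewrite expe2.
pose V y := 1 + `|g y|.
have V1 y : 1 <= V y by rewrite lerDl.
have V0 y : 0 <= V y by exact: le_trans (V1 y).
pose c := limn (series (fun i => pi i * g i)).
have j_positive : (green Pr Phi j (cst 1) j < +oo)%E.
  apply: le_lt_trans (Phi_positive_recurrent j).
  rewrite (eq_integral (zeta Phi j (cst 1 : nat -> R))); last by move=> w _; rewrite return_timeE.
  by rewrite (integral_zeta Phi_chain mX).
have V_sqr : (\int[Pr j]_w (zeta Phi j V w ^+ 2) < +oo)%E.
  have [l [tau2 zeta2]] := second_moments.
  pose h := centered pi g.
  have W_sqr : (\int[Pr l]_w (zeta Phi l (fun y => (1 + `|h y|)%R) w ^+ 2) < +oo)%E.
    have mr : measurable_fun setT (return_time Phi l : Omega -> \bar R).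
      rewrite (_ : return_time Phi l = zeta Phi l (cst 1 : nat -> R)); first exact: measurable_zeta.
      by apply/funext => w; rewrite return_timeE.
    have mc : measurable_fun setT (cycle_sum Phi l (fun x => `|h x|)).
      rewrite (_ : cycle_sum _ _ _ = zeta Phi l (fun x => `|h x|)); first exact: measurable_zeta.
      by apply/funext => w; rewrite cycle_sumE.
    have r0 w : (0 <= return_time Phi l w :> \bar R)%E by rewrite return_timeE zeta_ge0.
    have c0 w : (0 <= cycle_sum Phi l (fun x => `|h x|%R) w)%E by rewrite cycle_sumE zeta_ge0.
    apply: (@le_lt_trans _ _ (\int[Pr l]_w (2%:E * return_time Phi l w ^+ 2 +
        2%:E * cycle_sum Phi l (fun x => `|h x|%R) w ^+ 2))%E).
      apply: ge0_le_integral => //.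
      - by move=> w _; rewrite expe_ge0 // zeta_ge0.
      - by apply: msqr; exact: measurable_zeta.
      - by apply: emeasurable_funD; apply: emeasurable_funM => //; exact: msqr.
      by move=> w _; rewrite zeta_return_time //; exact: sqr_addE_le.
    rewrite ge0_integralD //; last 4 first.
    - by move=> w _; rewrite mule_ge0 // expe_ge0.
    - by apply: emeasurable_funM => //; exact: msqr.
    - by move=> w _; rewrite mule_ge0 // expe_ge0.
    - by apply: emeasurable_funM => //; exact: msqr.
    rewrite !ge0_integralZl //; [|exact: msqr|by move=> w _; rewrite expe_ge0|exact: msqr|by move=> w _; rewrite expe_ge0].
    by rewrite lte_add_pinfty // lte_mul_pinfty.
  have h_sqr : (\int[Pr j]_w (zeta Phi j (fun y => (1 + `|h y|)%R) w ^+ 2) < +oo)%E.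
    have [<- //|lj] := eqVneq l j.
    have jl : j != l by rewrite eq_sym.
    have r1 := irreducible_reaches Phi_chain P_ge0 P_irreducible lj.
    have r2 := irreducible_reaches Phi_chain P_ge0 P_irreducible jl.
    have h1 y : 1 <= 1 + `|h y| by rewrite lerDl.
    exact: (zeta_sqr_change_base Phi_chain r1 r2 j_positive h1 W_sqr).
  apply: (le_zeta_sqr_fin Phi_chain h_sqr (c := 1 + `|c|)); first by rewrite addr_ge0.
  move=> y; rewrite V0 /=; have -> : V y = 1 + `|h y + c| by rewrite /h /centered subrK.
  have := ler_normD (h y) c; have := normr_ge0 (h y); have := normr_ge0 c; nra.
have V_ae := tau_increases j; have g_ae := zeta_increases j; rewrite maxnn in V_ae g_ae.
have zetatE n w : zeta (Phit n) (inord j) (fun y : 'I_n.+1 => V (val y)) w =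
    (return_time (Phit n) (inord j) w +
     cycle_sum (Phit n) (inord j) (fun x => `|trunc_vec g n ord0 x|%R) w)%E.
  rewrite -zeta_return_time //; congr (zeta _ _ _ _).
  by apply/funext => y; rewrite /V mxE.
have zeta_dominated : {ae Pr j, forall w, forall n, (j <= n)%N ->
    (zeta (Phit n) (inord j) (fun y : 'I_n.+1 => V (val y)) w <= zeta Phi j V w)%E}.
  apply: filterS2 V_ae g_ae => w hr hc n jn; rewrite zetatE zeta_return_time //.
  by apply: leeD; [exact: increases_to_le hr jn|exact: increases_to_le hc jn].
have zeta_converges : {ae Pr j, forall w,
    zeta (Phit n) (inord j) (fun y : 'I_n.+1 => V (val y)) w @[n --> \oo] --> zeta Phi j V w}.
  apply: filterS2 V_ae g_ae => w [_ hr] [_ hc]; rewrite zeta_return_time //.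
  under eq_fun do rewrite zetatE.
  apply: cvgeD => //; apply: ge0_adde_def; rewrite inE.
  - by rewrite return_timeE zeta_ge0.
  - by rewrite cycle_sumE zeta_ge0.
have mean_cvg u (uV : forall y, 0 <= u y <= V y) :=
  cycle_sum_mean_cvg P_ge0 Phi_chain Pt_augmentation Phit_chain V1 V_sqr
    zeta_dominated zeta_converges uV.
have sqr_cvg u (uV : forall y, 0 <= u y <= V y) :=
  cycle_sqr_cvg P_ge0 Phi_chain Pt_augmentation Phit_chain V1 V_sqr
    zeta_dominated zeta_converges uV.
have [cE ->] := variance_moments Phi_chain (c := c) sigma2_clt V_sqr.
pose ct n := \sum_i pit n ord0 i * trunc_vec g n ord0 i.
have tchain n := trunc_chain Phit_chain (n := n).
have V_sqrt n : (j <= n)%N -> (\int[trunc_law Pr (inord j : 'I_n.+1)]_w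
    (zeta (Phit n) (inord j) (fun y : 'I_n.+1 => (1 + `|g (val y)|)%R) w ^+ 2) < +oo)%E.
  move=> jn; rewrite (trunc_lawE _ jn); refine (le_lt_trans _ V_sqr).
  have mXt k x : measurable [set w | Phit n k w = x] by case: (@tchain n ord0) => [[]].
  apply: ae_ge0_le_integral => //.
  - by move=> w _; rewrite expe_ge0 // zeta_ge0 // => y; exact: V0.
  - by apply: msqr; apply: measurable_zeta => // y; exact: V0.
  - by move=> w _; rewrite expe_ge0 // zeta_ge0.
  - by apply: msqr; exact: measurable_zeta.
  apply: filterS zeta_dominated => w hw _; rewrite !expe2.
  by apply: lee_pmul; rewrite ?zeta_ge0 //; try exact: hw; move=> y; exact: V0.
have cltt n : (j <= n)%N -> clt_variance (Pt n) (fun y : 'I_n.+1 => g (val y) - ct n) (sigma2t n).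
  move=> jn; have := sigma2t_clt n jn.
  rewrite (_ : (fun x => _) = (fun y : 'I_n.+1 => g (val y) - ct n)) //.
  by apply/funext => y; rewrite /centered_rV !mxE.
have momt n (jn : (j <= n)%N) := variance_moments (@tchain n) (cltt n jn) (V_sqrt n jn).
have a0 := posp_ge0 g; have b0 := negp_ge0 g; have abE := pospDnegp g.
have ua : forall y, 0 <= posp g y <= V y.
  by move=> y; rewrite a0 /= /V -abE; have := b0 y; lra.
have ub : forall y, 0 <= negp g y <= V y.
  by move=> y; rewrite b0 /= /V -abE; have := a0 y; lra.
have uab : forall y, 0 <= `|g y| <= V y by move=> y; rewrite normr_ge0 /= lerDr.
have ua1 : forall y, 0 <= posp g y + 1 <= V y.
  by move=> y; rewrite addr_ge0 //= /V -abE; have := b0 y; lra.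
have ub1 : forall y, 0 <= negp g y + 1 <= V y.
  by move=> y; rewrite addr_ge0 //= /V -abE; have := a0 y; lra.
have u1 : forall y, 0 <= (cst 1 : nat -> R) y <= V y by move=> y; rewrite /= ler01 V1.
have m_gt0 : 0 < cycle_mean Pr Phi j := cycle_mean_gt0 Phi_chain j_positive.
have m_cvg : cycle_mean (@trunc_law _ _ _ Pr n) (Phit n) (inord j) @[n --> \oo] -->
  cycle_mean Pr Phi j := mean_cvg (cst 1) u1.
have mV_cvg : (cycle_mean (@trunc_law _ _ _ Pr n) (Phit n) (inord j))^-1 @[n --> \oo] -->
  (cycle_mean Pr Phi j)^-1 by apply: cvgV => //; rewrite gt_eqF.
have ct_cvg : ct n @[n --> \oo] --> c.
  rewrite cE; apply: cvg_trans (cvgM (cvgB (mean_cvg _ ua) (mean_cvg _ ub)) mV_cvg).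
  apply: near_eq_cvg; near=> n.
  have jn : (j <= n)%N by near: n; exact: nbhs_infty_ge.
  by rewrite [RHS](proj1 (momt n jn)).
have S1 := sqr_cvg _ ua; have S2 := sqr_cvg _ ub; have S3 := sqr_cvg _ uab.
have S4 := sqr_cvg _ ua1; have S5 := sqr_cvg _ ub1; have S6 := sqr_cvg _ u1.
have var_cvg := cvg_variance_formula mV_cvg ct_cvg S1 S2 S3 S4 S5 S6.
apply: cvg_trans var_cvg; apply: near_eq_cvg; near=> n.
have jn : (j <= n)%N by near: n; exact: nbhs_infty_ge.
by rewrite [RHS](proj2 (momt n jn)).
Unshelve. all: by end_near. Qed.
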